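(* The Hilbert–Samuel function of a splice-quotient singularity is not determined by its resolution graph. More precisely: Let $a_1,a_2,b,c$ be pairwise relatively prime positive integers. There is a unique star-shaped graph of determinant $1$ with four branches, of determinants $a_1,a_2,b,c$. Let $\gamma$ be a complex number different from $0$ and $1$. (A) The equations $$x_1^{a_1}+y^b+z^c=0,\qquad x_2^{a_2}+y^b+\gamma z^c=0$$ are a possible system of splice diagram equations for this graph, so they define (at the origin of $\mathbb C^4$) a splice-quotient singularity with this resolution graph. Its Hilbert–Samuel function is $$\frac{(1-t^{a_1})(1-t^{a_2})}{(1-t)^4}.$$ (B) Suppose in addition that $i$ is an integer and that $$2\le a_1<a_2<b<c,\qquad i a_1>a_2,\qquad a_1-1+i<a_2,\qquad b+a_1-1>2a_2-i.$$ Then the equations $$x_1^{a_1}+y^b+z^c=0,\qquad x_2^{a_2}+y^b+\gamma z^c+x_1^{a_1-1}x_2^i=0,$$ obtained from those of (A) by adding a higher degree term, define another splice-quotient singularity with the same resolution graph. Its Hilbert–Samuel function is $$\frac{1}{(1-t)^2}\left(\frac{t-t^{a_1-1}}{1-t}\cdot\frac{1-t^{a_2}}{1-t}+\frac{1-t^{2a_2-i}}{1-t}+t^{a_1-1}\frac{1-t^i}{1-t}\right).$$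
   Context: For an isolated singularity whose local ring has maximal ideal $m$, the Hilbert–Samuel function is the power series $\sum_{k\ge0}\dim(m^k/m^{k+1})\,t^k\in\mathbb Z[[t]]$. Star-shaped graph: a tree with a central vertex, whose branches (components after removing the central vertex) are paths. Graphs here are negative definite resolution graphs of projective lines; the determinant of such a graph is the determinant of minus its intersection matrix. Splice-quotient singularities (Neumann–Wahl): start with a tree $\Gamma$ with at least 3 vertices, whose vertices of degree $\ge2$ represent exceptional curves $E_u$ (carrying self-intersection numbers and forming a negative definite subtree) and whose degree-one vertices $w$ represent end curves, each with a variable $z_w$. Let $L=\bigoplus\mathbb ZE_u$ with its intersection form $(\cdot,\cdot)$, and let $E_v^*\in L\otimes\mathbb Q$ be defined by $(E_v^*,E_v)=-1$, $(E_v^*,E_u)=0$ for $u\ne v$, with $E_w^*:=E_u^*$ for a degree-one vertex $w$ with neighbour $u$; $H=L'/L$, where $L'$ is the dual lattice. Let $\delta_v$ be the degree of $v$ in $\Gamma$. A monomial $\prod z_w^{\alpha_w}$ in the variables of a branch $C$ (component of $\Gamma\setminus v$) is admissible for $C$ if $\sum_{w\in C,\delta_w=1}\alpha_wE_w^*-\sum_{w\in C,\delta_w\ge2}\alpha_wE_w=E_v^*$ for some non-negative integers $\alpha_w$ ($w\in C$, $\delta_w\ge2$). It is required (Monomial Condition) that every branch of every vertex with at least 3 branches has an admissible monomial. The $v$-degree of $\prod z_j^{\alpha_j}$ is $-\sum\alpha_j(E_v^*,E_j^* )$, and that of a power series is the minimum over its monomials with non-zero coefficient. The splice diagram equations are,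 for each vertex $v$ with at least 3 branches, $\delta_v-2$ equations $\sum_Ca_{v,k,C}M_{v,C}+H_{v,k}=0$ ($k=1,\dots,\delta_v-2$), where $M_{v,C}$ is a chosen admissible monomial of the branch $C$, all maximal minors of $(a_{v,k,C})_{k,C}$ are non-zero, and $H_{v,k}$ is a convergent power series of $v$-degree greater than $-(E_v^*,E_v^* )$ with the same $H$-character as the $M_{v,C}$, where $[E_v^*]\in H$ acts on $z_w$ by $e^{-2\pi \sqrt{-1}(E_v^*,E_w^* )}$. The quotient by $H$ of the germ defined by these equations is the splice-quotient singularity; its resolution graph is the subtree of vertices of degree $\ge2$. When the determinant of the graph is 1, $H$ is trivial, so the equations define the splice-quotient singularity itself.
   Formalization: The Hilbert–Samuel formula in (A) is claimed only when max(a1,a2) ≤ min(b,c), as it fails otherwise, e.g. for (3,5,2,7); the graph is unique among those whose branch curves have self-intersection at most −2, since blowing up an edge would otherwise give further graphs. *)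

(* Defs.v *)
From HB Require Import structures.
From mathcomp Require Import all_boot all_order all_algebra.
From mathcomp Require Import boolp classical_sets functions reals trigo complex.

Set Implicit Arguments.
Unset Strict Implicit.
Unset Printing Implicit Defensive.

Import Order.TTheory GRing.Theory Num.Theory.

Local Open Scope classical_set_scope.
Local Open Scope ring_scope.
Local Open Scope complex_scope.

Notation mindex W := {ffun W -> nat}.

Definition mdeg (W : finType) (m : mindex W) : nat := (\sum_w m w)%N.

Definition msub (W : finType) (m k : mindex W) : mindex W :=
  [ffun w => (m w - k w)%N].

(* The multi-indices k <= m (componentwise), without repetition. *)
Definition below (W : finType) (m : mindex W) : seq (mindex W) :=
  [seq [ffun w => nat_of_ord (k w)] | k : {dffun forall w, 'I_(m w).+1}].

Lemma mem_below (W : finType) (m k : mindex W) :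
  (k \in below m) = [forall w, (k w <= m w)%N].
Proof.
apply/mapP/forallP => [[u _ ->] w|km]; first by rewrite ffunE -ltnS.
pose u : {dffun forall w, 'I_(m w).+1} :=
  [ffun w => Ordinal (km w : (k w < (m w).+1)%N)].
exists u; first by rewrite mem_enum.
by apply/ffunP => w; rewrite !ffunE.
Qed.

Lemma uniq_below (W : finType) (m : mindex W) : uniq (below m).
Proof.
rewrite map_inj_uniq ?enum_uniq // => u v uv; apply/ffunP => w.
by apply: val_inj; move/ffunP: uv => /(_ w); rewrite !ffunE.
Qed.

(* A power series is the function sending a multi-index to its coefficient;
   the ring structure put on this alias is the Cauchy product, not the
   pointwise product of functions. *)
Definition fps (K : comNzRingType) (W : finType) : Type := mindex W -> K.

Section PowerSeries.
Variables (K : comNzRingType) (W : finType).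
Implicit Types (f g h : fps K W) (m k : mindex W).

HB.instance Definition _ := GRing.Lmodule.copy (fps K W) (mindex W -> K^o).

Definition fps_one : fps K W := fun m => (m == [ffun=> 0%N])%:R.

Definition fps_mul f g : fps K W :=
  fun m => \sum_(k <- below m) f k * g (msub m k).

Let fpsDE f g m : (f + g) m = f m + g m. Proof. by []. Qed.

Fact fps_mulC : commutative fps_mul.
Proof.
move=> f g; apply/funext => m; rewrite /fps_mul.
have bij : perm_eq (below m) [seq msub m k | k <- below m].
  have km k : k \in below m -> msub m (msub m k) = k.
    rewrite mem_below => /forallP km; apply/ffunP => w.
    by rewrite !ffunE subKn.
  have sub k : msub m k \in below m.
    by rewrite mem_below; apply/forallP => w; rewrite ffunE leq_subr.
  apply: uniq_perm; first exact: uniq_below.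
    rewrite map_inj_in_uniq ?uniq_below // => k l kb lb kl.
    by rewrite -(km k) // kl km.
  move=> k; apply/idP/mapP => [kb|[l lb ->]]; last exact: sub.
  by exists (msub m k); rewrite ?sub ?km.
rewrite (perm_big _ bij) big_map !big_seq; apply: eq_bigr => k.
rewrite mem_below => /forallP km; rewrite mulrC; congr (g _ * f _).
by apply/ffunP => w; rewrite !ffunE subKn.
Qed.

Fact fps_mul1 : left_id fps_one fps_mul.
Proof.
move=> f; apply/funext => m; rewrite /fps_mul.
have b0 : [ffun=> 0%N] \in below m.
  by rewrite mem_below; apply/forallP => w; rewrite ffunE.
rewrite (bigD1_seq [ffun=> 0%N]) ?uniq_below //= big1 => [|k /negPf k0].
  rewrite /fps_one eqxx mul1r addr0; congr (f _).
  by apply/ffunP => w; rewrite !ffunE subn0.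
by rewrite /fps_one k0 mul0r.
Qed.

Fact fps_mulDl : left_distributive fps_mul +%R.
Proof.
move=> f g h; apply/funext => m; rewrite fpsDE /fps_mul -big_split /=.
by apply: eq_bigr => k _; rewrite fpsDE mulrDl.
Qed.

Fact fps_mulA : associative fps_mul.
Proof.
move=> f g h; apply/funext => m; rewrite /fps_mul.
under eq_bigr do rewrite mulr_sumr.
under [RHS]eq_bigr do rewrite mulr_suml.
pose addm (p q : mindex W) : mindex W := [ffun w => (p w + q w)%N].
have E k : k \in below m -> \sum_(p <- below k) f p * g (msub k p) * h (msub m k)
  = \sum_(p <- below m | [forall w, p w <= k w]%N)
      f p * g (msub k p) * h (msub m k).
  rewrite mem_below => /forallP km; rewrite -[RHS]big_filter; apply: perm_big.
  apply: uniq_perm; rewrite ?filter_uniq ?uniq_below // => p.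
  rewrite mem_filter !mem_below; apply/idP/andP => [pk|[]//]; split=> //.
  by apply/forallP => w; exact: leq_trans (forallP pk w) (km w).
rewrite [RHS]big_seq [RHS](eq_bigr _ E) -[RHS]big_seq.
rewrite (exchange_big_dep xpredT) //= big_seq [RHS]big_seq.
apply: eq_bigr => p; rewrite mem_below => /forallP pm.
rewrite -[RHS]big_filter.
have bij : perm_eq [seq k : mindex W <- below m | [forall w, p w <= k w]%N]
                   [seq addm p q | q <- below (msub m p)].
  apply: uniq_perm; first by rewrite filter_uniq ?uniq_below.
    rewrite map_inj_uniq ?uniq_below // => q r /ffunP qr.
    by apply/ffunP => w; move: (qr w); rewrite !ffunE => /addnI.
  move=> k; rewrite mem_filter; apply/andP/mapP => [[/forallP pk]|[q + ->]].
    rewrite mem_below => /forallP km; exists (msub k p).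
      by rewrite mem_below; apply/forallP => w; rewrite !ffunE leq_sub2r.
    by apply/ffunP => w; rewrite !ffunE subnKC.
  rewrite !mem_below => /forallP qm; split; apply/forallP => w.
    by rewrite ffunE leq_addr.
  by move: (qm w); rewrite !ffunE leq_subRL.
rewrite (perm_big _ bij) [RHS]big_map /=; apply: eq_bigr => q _.
rewrite mulrA; congr (f p * g _ * h _); apply/ffunP => w; rewrite !ffunE.
  by rewrite addKn.
by rewrite subnDA.
Qed.

Fact fps_one_neq0 : fps_one != 0 :> fps K W.
Proof.
apply/eqP => /(congr1 (fun f : fps K W => f [ffun=> 0%N])).
by rewrite /fps_one eqxx; apply/eqP; exact: oner_neq0.
Qed.

HB.instance Definition _ := GRing.Zmodule_isComNzRing.Build (fps K W)
  fps_mulA fps_mulC fps_mul1 fps_mulDl fps_one_neq0.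

Fact fps_scaleAl (a : K) (f g : fps K W) : a *: (f * g) = (a *: f) * g.
Proof.
apply/funext => m.
change (a * (\sum_(k <- below m) f k * g (msub m k)) =
        \sum_(k <- below m) (a * f k) * g (msub m k)).
by rewrite mulr_sumr; apply: eq_bigr => k _; rewrite mulrA.
Qed.

HB.instance Definition _ :=
  GRing.Lmodule_isLalgebra.Build K (fps K W) fps_scaleAl.

HB.instance Definition _ := GRing.Lalgebra_isComAlgebra.Build K (fps K W).

Definition fps_unit : pred (fps K W) := fun f => `[< exists g, g * f = 1 >].

Definition fps_inv (f : fps K W) : fps K W :=
  if pselect (exists g, g * f = 1) is left e then projT1 (cid e) else f.

Fact fps_mulVr : {in fps_unit, left_inverse 1 fps_inv *%R}.
Proof.
move=> f /asboolP uf; rewrite /fps_inv.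
by case: pselect => // e; exact: (projT2 (cid e)).
Qed.

Fact fps_unitP (f g : fps K W) : g * f = 1 -> fps_unit f.
Proof. by move=> gf; apply/asboolP; exists g. Qed.

Fact fps_invr_out : {in [predC fps_unit], fps_inv =1 id}.
Proof.
move=> f nuf; rewrite /fps_inv.
by case: pselect => // e; case/negP: nuf; exact/asboolP.
Qed.

HB.instance Definition _ := GRing.ComNzRing_hasMulInverse.Build (fps K W)
  fps_mulVr fps_unitP fps_invr_out.

Definition fps_mono (m : mindex W) : fps K W := fun k => (k == m)%:R.

Definition fps_var (w : W) : fps K W :=
  fps_mono [ffun w' => nat_of_bool (w' == w)].

End PowerSeries.

Notation "''z_' w" := (fps_var _ w) (at level 8, w at level 2) : ring_scope.

(* Z[[t]]: power series in the single variable indexed by tt : unit. *)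
Notation Zt := (fps int unit).
Notation "''t'" := (fps_var int tt) (at level 0) : ring_scope.

(* Sum of |f_m| r^|m| over all multi-indices m is finite for some r > 0,
   i.e. f converges absolutely on some polydisc around the origin. *)
Definition convergent (R : realType) (W : finType) (f : fps R[i] W) : Prop :=
  exists r M : R[i], 0 < r /\
    forall s : seq (mindex W), uniq s ->
      \sum_(m <- s) `|f m| * r ^+ mdeg m <= M.

Section Ideals.
Variable A : comNzRingType.

Definition mul_set (P Q : set A) : set A :=
  [set x | exists s : seq (A * A),
     (forall p, p \in s -> P p.1 /\ Q p.2) /\ x = \sum_(p <- s) p.1 * p.2].

(* powers of an ideal m of the subring B; the 0-th power is B *)
Fixpoint ideal_pow (B m : set A) (k : nat) : set A :=
  if k is k'.+1 then mul_set m (ideal_pow B m k') else B.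

Definition add_set (P Q : set A) : set A :=
  [set x | exists p q, [/\ P p, Q q & x = p + q]].

Definition gen_ideal (B : set A) (s : seq A) : set A :=
  [set x | exists g : 'I_(size s) -> A,
     (forall j, B (g j)) /\ x = \sum_(j < size s) g j * s`_j].

End Ideals.

(* dim_K (U / V) = d: the classes of some e_0, ..., e_(d-1) in U form a basis
   of U / V. *)
Definition quotient_dim (K : fieldType) (E : lmodType K) (U V : set E)
    (d : nat) : Prop :=
  exists e : 'I_d -> E, (forall j, U (e j)) /\
    forall x, U x ->
      exists! c : 'rV[K]_d, V (x - \sum_(j < d) c 0 j *: e j).

(* h is the Hilbert-Samuel function of the local ring B / I, where B is a
   subring of A, I an ideal of B, and m / I the maximal ideal of B / I;
   the k-th power of m / I is (m^k + I) / I. *)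
Definition is_hilbert_samuel (K : fieldType) (A : comAlgType K)
    (B I m : set A) (h : Zt) : Prop :=
  forall k, exists d : nat, h [ffun=> k] = d%:Z /\
    quotient_dim (add_set (ideal_pow B m k) I)
                 (add_set (ideal_pow B m k.+1) I) d.

(* The degree-one vertices stand for the end curves; their weight is never
   used. *)
Record wgraph := WGraph {
  vertex :> finType;
  adj : rel vertex;
  weight : vertex -> int
}.

Section Graph.
Variable G : wgraph.
Implicit Types (u v : G) (A C : {set G}) (x y : {ffun G -> rat}).

Definition degree v : nat := #|[set u | adj v u]|.

Definition is_tree : Prop :=
  [/\ symmetric (@adj G), irreflexive (@adj G),
      forall u v, connect (@adj G) u v
    & forall c : seq G, ucycle (@adj G) c -> (size c <= 2)%N].

(* the exceptional curves E_u *)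
Definition curve v : bool := (1 < degree v)%N.

Definition curves : {set G} := [set v | curve v].

Definition node v : bool := (2 < degree v)%N.

Definition end_vertex : Type := {w : G | degree w == 1%N}.

HB.instance Definition _ := SubFinite.on end_vertex.

Definition inter u v : int := if u == v then weight u else (adj u v : nat)%:Z.

(* Elements of L (x) Q are written as functions G -> rat; only the values at
   the exceptional curves matter for the form. *)
Definition form x y : rat :=
  \sum_(u | curve u) \sum_(v | curve v) x u * y v * (inter u v)%:~R.

Definition negative_definite : Prop :=
  forall x, (exists2 u, curve u & x u != 0) -> form x x < 0.

Definition resolution_tree : Prop :=
  [/\ is_tree, (3 <= #|G|)%N & negative_definite].

(* determinant of minus the intersection matrix of the curves in A *)
Definition graph_det A : int :=
  \det (\matrix_(i < #|A :&: curves|, j < #|A :&: curves|)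
           - inter (enum_val i) (enum_val j)).

Definition Evec v : {ffun G -> rat} := [ffun u => (u == v)%:R].

Definition curve_dual v : {ffun G -> rat} :=
  xget 0 [set x : {ffun G -> rat} |
    (forall u, ~~ curve u -> x u = 0) /\
    (forall u, curve u -> form x (Evec u) = - (u == v)%:R)].

(* E_v^*; a degree-one vertex takes the dual of its unique neighbour *)
Definition dual v : {ffun G -> rat} :=
  if curve v then curve_dual v
  else curve_dual (odflt v [pick u | adj v u]).

(* the component of u in the graph with v removed *)
Definition branch v u : {set G} :=
  [set w | connect (fun p q => [&& p != v, q != v & adj p q]) u w].

Definition branches v : {set {set G}} := [set branch v u | u : G & adj v u].

(* Each branch of o is a path, running away from o. *)
Definition star_shaped (o : G) : Prop :=
  is_tree /\ forall C, C \in branches o ->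
    exists p : seq G, [/\ path (@adj G) o p, uniq p & C =i p].

(* G is a resolution tree, star-shaped around o, whose branches are listed
   without repetition by the end vertices ws they contain; their determinants
   are ds. The curves on the branches have self-intersection at most -2. If the
   only vertex of a branch is an end vertex, the branch has determinant 1. *)
Definition star_graph (o : G) (ws : seq end_vertex) (ds : seq nat) : Prop :=
  [/\ resolution_tree, star_shaped o,
      forall u, curve u -> u != o -> weight u <= - 2%:Z,
      uniq [seq branch o (val w) | w <- ws]
        /\ branches o =i [seq branch o (val w) | w <- ws]
    & [seq graph_det (branch o (val w)) | w <- ws] = [seq d%:Z | d <- ds]].

End Graph.

Definition wgraph_iso (G G' : wgraph) : Prop :=
  exists phi : G -> G', [/\ bijective phi,
    forall u v, adj (phi u) (phi v) = adj u v
  & forall u, curve u -> weight (phi u) = weight u].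

Definition expi (R : realType) (x : R) : R[i] := (cos x +i* sin x)%C.

Section Splice.
Variables (R : realType) (G : wgraph).

Local Notation ends := (end_vertex G).
Local Notation series := (fps R[i] ends).

(* Only alpha on the curves of C is used; the exponents of the end curves of C
   are those of the monomial m itself. *)
Definition admissible (v : G) (C : {set G}) (m : mindex ends) : Prop :=
  (forall w, m w != 0%N -> val w \in C) /\
  exists alpha : G -> nat,
    \sum_(w : ends) dual (val w) *+ m w
      - \sum_(u in C | curve u) Evec u *+ alpha u = dual v.

Definition vdegree (v : G) (m : mindex ends) : rat :=
  - \sum_(w : ends) form (dual v) (dual (val w)) *+ m w.

(* the scalar by which the class of E_u^* in H acts on the monomial m *)
Definition char_of (u : G) (m : mindex ends) : R[i] :=
  \prod_(w : ends)
    expi (- (2 * pi * ratr (form (dual u) (dual (val w))))) ^+ m w.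

Definition H_act (u : G) (f : series) : series := fun m => char_of u m * f m.

Definition splice_system (s : seq series) : Prop :=
  resolution_tree G /\
  exists (M : G -> {set G} -> mindex ends) (a : G -> nat -> {set G} -> R[i])
         (F : G -> nat -> series),
  [/\ forall v C, node v -> C \in branches v -> admissible v C (M v C),
      forall v, node v -> forall D : 'I_(degree v - 2) -> {set G},
        injective D -> (forall j, D j \in branches v) ->
        \det (\matrix_(k < degree v - 2, j < degree v - 2) a v k (D j)) != 0,
      forall v k, node v -> (k < degree v - 2)%N ->
        [/\ convergent (F v k),
            forall m, F v k m != 0 ->
              - form (dual v) (dual v) < vdegree v m
          & forall C, C \in branches v -> forall u, curve u ->
              H_act u (F v k) = char_of u (M v C) *: F v k]
    & perm_eq s
        [seq \sum_(C in branches v) a v k C *: fps_mono _ (M v C) + F v k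
           | v <- enum (@node G), k <- iota 0 (degree v - 2)]].

(* The local ring of the quotient by H of the germ defined by s consists of the
   H-invariants of C{z}/(s). It is presented as B / (s), where B is the ring of
   convergent series that are H-invariant modulo (s). *)
Definition splice_ideal (s : seq series) : set series :=
  gen_ideal [set f : series | convergent f] s.

Definition splice_ring (s : seq series) : set series :=
  [set f | convergent f /\
     forall u, curve u -> splice_ideal s (H_act u f - f)].

Definition splice_hilbert_samuel (s : seq series) (h : Zt) : Prop :=
  is_hilbert_samuel (K := R[i]) (splice_ring s) (splice_ideal s)
    [set f | splice_ring s f /\ f [ffun=> 0%N] = 0] h.

End Splice.

(* Main.v *)
Require Import Defs.
From HB Require Import structures.
From mathcomp Require Import all_boot all_order all_algebra all_fingroup.
From mathcomp Require Import boolp classical_sets functions reals trigo complex.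
From mathcomp Require Import zify ring lra.
Import Order.TTheory GRing.Theory Num.Theory.

(* The Hilbert-Samuel function counts monomials x1^k x2^j y^p z^q outside the
   initial ideal of the two equations. In (A) this ideal is (x1^a1, x2^a2) when
   the equations have orders a1 and a2. In (B) the new term becomes the initial
   form of the second equation f2, and with the first equation f1 the elements
   g3 = x1 f2 - x2^i f1 and x2^(a2-i) f2 - x1^(a1-2) g3 produce the initial ideal
   (x1^a1, x1^(a1-1) x2^i, x1 x2^a2, x2^(2 a2-i)). These inclusions show that
   the remaining monomials span the graded pieces. For their independence, the
   linear forms that read off a coefficient of the normal form modulo
   x1^a1 -> -(y^b + z^c), x2^a2 -> -(y^b + gamma z^c + x1^(a1-1) x2^i) kill the
   equations; the order in (x1, x2, y, z) is controlled by giving x1^(a1-1) x2^j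
   with j >= i the weight a2 + j - i instead of a1 - 1 + j.

   A leg with self-intersections -c1, .., -cr, counted from the centre, is
   determined by the continued fraction a / w = c1 - 1 / (c2 - ..), a being its
   determinant. The determinant of the star with central curve of
   self-intersection -e is e N - sum w_i N / a_i with N = prod a_i; if it is 1,
   then w_i and e are determined by congruences modulo the coprime numbers a_i.
   As the graph is unimodular, all dual vectors are integral and H acts
   trivially. *)

Set Implicit Arguments.
Unset Strict Implicit.
Unset Printing Implicit Defensive.

Local Open Scope ring_scope.
Local Open Scope complex_scope.
Local Notation form := Defs.form.
Local Notation dual := Defs.dual.

(** * Formal and convergent power series *)

(** In both cases the rewriting rules leave the same a1 a2 monomials in x1, x2, multiplied by all
    monomials in y and z. The two Hilbert-Samuel functions are therefore 1/(1-t)^2 times a sum of a1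
    a2 powers of t, and the new term of (B) can only move exponents: for i <= j < a2, x1^(a1-1) x2^j
    is -x2^(a2+j-i) up to heavier terms, so it counts in degree a2+j-i instead of a1-1+j, and a1-1+i
    < a2 makes this a genuine shift. The obstacle is that in (B) the rule for x2^a2 lowers the
    degree. The linear forms kill the ideal by construction, but that they kill m^(k+1) is only
    visible in the corrected weight, which no rule lowers. The hypothesis b+a1-1 > 2a2-i keeps
    x1^(a1-1) y^b above the degree of x2^(2a2-i), so that y and z do not enter the initial ideal; i
    a1 > a2 is the degree condition on splice equations and also gives i > 0. Working in one graded
    piece at a time replaces any division theorem for convergent series: only monomial cofactors of
    the equations occur. *)

Section FormalSeries.
Variables (K : comNzRingType) (W : finType).
Implicit Types (f g : fps K W) (m n k : mindex W).

Definition madd m n : mindex W := [ffun w => (m w + n w)%N].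

Definition mconst (d : nat) : mindex W := [ffun=> d].

Lemma fpsDE f g m : (f + g) m = f m + g m. Proof. by []. Qed.
Lemma fpsNE f m : (- f) m = - f m. Proof. by []. Qed.
Lemma fps0E m : (0 : fps K W) m = 0. Proof. by []. Qed.
Lemma fpsZE (c : K) f m : (c *: f) m = c * f m. Proof. by []. Qed.
Lemma fps_sumE (I : Type) (r : seq I) (P : pred I) (F : I -> fps K W) m :
  (\sum_(i <- r | P i) F i) m = \sum_(i <- r | P i) F i m.
Proof. by elim/big_rec2: _ => // i y1 y2 _ <-. Qed.

Lemma mdeg_madd m n : mdeg (madd m n) = (mdeg m + mdeg n)%N.
Proof. by rewrite /mdeg -big_split; apply: eq_bigr => w _; rewrite ffunE. Qed.

Lemma fps_mulE f g m : (f * g) m = \sum_(k <- below m) f k * g (msub m k).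
Proof. by []. Qed.

Lemma fps_mul_mono g n m :
  (g * fps_mono K n) m = if [forall w, (n w <= m w)%N] then g (msub m n) else 0.
Proof.
rewrite mulrC fps_mulE; case: ifP => nm.
  rewrite (bigD1_seq n) ?uniq_below ?mem_below //= big1 => [|k /negPf kn].
    by rewrite /fps_mono eqxx mul1r addr0.
  by rewrite /fps_mono kn mul0r.
rewrite big_seq big1 // => k; rewrite /fps_mono mem_below.
by case: eqVneq => [->|]; rewrite ?mul0r // nm.
Qed.

Lemma mulr_mono m n : fps_mono K m * fps_mono K n = fps_mono K (madd m n).
Proof.
apply/funext => k; rewrite fps_mul_mono /fps_mono.
case: ifP => [/forallP nk|/negbT/forallPn[w]].
  congr (_%:R); congr (nat_of_bool _); apply/eqP/eqP => [<-|->].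
    by apply/ffunP => w; rewrite !ffunE subnK.
  by apply/ffunP => w; rewrite !ffunE addnK.
rewrite -ltnNge => kw; case: eqP => // ke.
by move: kw; rewrite ke ffunE ltnNge leq_addl.
Qed.

Lemma mono0 : fps_mono K (mconst 0) = 1.
Proof. by apply/funext. Qed.

Definition mvar (w : W) (d : nat) : mindex W :=
  [ffun w' => if w' == w then d else 0%N].

Lemma fps_varX w d : 'z_w ^+ d = fps_mono K (mvar w d).
Proof.
elim: d => [|d IH].
  by rewrite expr0 -mono0; congr fps_mono; apply/ffunP => w'; rewrite !ffunE if_same.
rewrite exprS IH /fps_var mulr_mono; congr fps_mono; apply/ffunP => w'.
by rewrite !ffunE; case: eqP.
Qed.

Lemma mdeg_mvar w d : mdeg (mvar w d) = d.
Proof.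
rewrite /mdeg (bigD1 w) //= ffunE eqxx big1 ?addn0 // => w' /negPf ne.
by rewrite ffunE ne.
Qed.

Lemma leq_mdeg m w : (m w <= mdeg m)%N.
Proof. by rewrite /mdeg (bigD1 w) //= leq_addr. Qed.

Lemma below_const m d : (mdeg m <= d)%N -> m \in below (mconst d).
Proof.
move=> md; rewrite mem_below; apply/forallP => w; rewrite ffunE.
exact: leq_trans (leq_mdeg _ _) md.
Qed.

Definition ord_ge (d : nat) f := forall m, (mdeg m < d)%N -> f m = 0.

Lemma ord_geD d f g : ord_ge d f -> ord_ge d g -> ord_ge d (f + g).
Proof. by move=> fd gd m md; rewrite fpsDE fd // gd // addr0. Qed.

Lemma ord_ge_mono d m : (d <= mdeg m)%N -> ord_ge d (fps_mono K m).
Proof.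
by move=> dm n nd; rewrite /fps_mono; case: eqP => // nm; move: nd; rewrite nm ltnNge dm.
Qed.

Lemma mdeg_split m k : k \in below m -> mdeg m = (mdeg k + mdeg (msub m k))%N.
Proof.
rewrite mem_below => /forallP km; rewrite -mdeg_madd; congr mdeg.
by apply/ffunP => w; rewrite !ffunE subnKC.
Qed.

Lemma ord_geM d e f g : ord_ge d f -> ord_ge e g -> ord_ge (d + e) (f * g).
Proof.
move=> fd ge m md; rewrite fps_mulE big_seq big1 // => k km.
case: (ltnP (mdeg k) d) => kd; first by rewrite fd // mul0r.
rewrite [g _]ge ?mulr0 //.
by move: md; rewrite (mdeg_split km) => md; rewrite -(ltn_add2l d); apply: leq_ltn_trans md; rewrite leq_add2r.
Qed.

(* Contraction against [lam]; if [lam] vanishes in degrees above [d], it is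
   well defined on series and kills those of order above [d]. *)
Definition pairing (d : nat) (lam : mindex W -> K) f : K :=
  \sum_(m <- below (mconst d)) f m * lam m.

Lemma pairingD d lam f g : pairing d lam (f + g) = pairing d lam f + pairing d lam g.
Proof. by rewrite /pairing -big_split; apply: eq_bigr => m _; rewrite mulrDl. Qed.

Lemma pairingZ d lam c f : pairing d lam (c *: f) = c * pairing d lam f.
Proof. by rewrite /pairing mulr_sumr; apply: eq_bigr => m _; rewrite mulrA. Qed.

Section Bounded.
Variables (d : nat) (lam : mindex W -> K).
Hypothesis lamP : forall m, (d < mdeg m)%N -> lam m = 0.

Lemma pairing_ord f : ord_ge d.+1 f -> pairing d lam f = 0.
Proof.
move=> fd; rewrite /pairing big1 // => m _; case: (ltnP (mdeg m) d.+1) => md.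
  by rewrite fd // mul0r.
by rewrite lamP // mulr0.
Qed.

Lemma pairing_mono n : (mdeg n <= d)%N -> pairing d lam (fps_mono K n) = lam n.
Proof.
move=> nd; rewrite /pairing (bigD1_seq n) ?uniq_below ?below_const //=.
rewrite big1 => [|k /negPf kn]; rewrite /fps_mono ?kn ?mul0r //.
by rewrite eqxx mul1r addr0.
Qed.

(** Adjointness: multiplication by a monomial turns into a shift of the argument of [lam]. Shifted
    indices that leave the box have degree above [d], where [lam] vanishes. *)
Lemma pairing_mul_mono g n :
  pairing d lam (g * fps_mono K n) =
  \sum_(m <- below (mconst d)) g m * lam (madd m n).
Proof.
rewrite /pairing.
under eq_bigr => m _ do rewrite fps_mul_mono.
pose A := [seq m : mindex W <- below (mconst d) | [forall w, (n w <= m w)%N]].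
pose B := [seq m : mindex W <- below (mconst d) | madd m n \in below (mconst d)].
have E1 : perm_eq A [seq madd m n | m <- B].
  have addI : injective (fun m => madd m n).
    move=> p q /ffunP pq; apply/ffunP => w.
    by move: (pq w); rewrite !ffunE => /addIn.
  apply: uniq_perm; rewrite ?filter_uniq ?(map_inj_uniq addI) ?filter_uniq ?uniq_below //.
  move=> m; apply/idP/mapP => [|[k]].
    rewrite mem_filter mem_below => /andP[/forallP nm /forallP md].
    have E : madd (msub m n) n = m by apply/ffunP => w; rewrite !ffunE subnK.
    exists (msub m n); rewrite // mem_filter E !mem_below.
    apply/andP; split; apply/forallP => w; first exact: md.
    by rewrite ffunE (leq_trans (leq_subr _ _)) ?md.
  rewrite mem_filter => /andP[kn _] ->; rewrite mem_filter kn andbT.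
  by apply/forallP => w; rewrite ffunE leq_addl.
transitivity (\sum_(m <- A) g (msub m n) * lam m).
  rewrite big_filter [RHS]big_mkcond; apply: eq_bigr => m _.
  by case: ifP; rewrite ?mul0r.
rewrite (perm_big _ E1) big_map big_filter big_mkcond; apply: eq_bigr => m _.
case: ifPn => mn; first by congr (g _ * _); apply/ffunP => w; rewrite !ffunE addnK.
rewrite lamP ?mulr0 // ltnNge; apply: contra mn; exact: below_const.
Qed.

End Bounded.

End FormalSeries.

(** * Convergent series and the powers of their maximal ideal *)

Section Convergence.
Variables (R : realType) (W : finType).
Implicit Types (f g : fps R[i] W) (m n : mindex W).

Lemma convergent_mono n : convergent (fps_mono R[i] n).
Proof.
exists 1, 1; split=> // s us.
case: (boolP (n \in s)) => ns.
  rewrite (bigD1_seq n) //= big1 => [|k /negPf kn].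
    by rewrite /fps_mono eqxx normr1 expr1n mulr1 addr0.
  by rewrite /fps_mono kn normr0 mul0r.
rewrite big_seq big1 // => k ks; rewrite /fps_mono.
by case: eqVneq ks ns => [->->|]; rewrite ?normr0 ?mul0r.
Qed.

Lemma convergent0 : convergent (0 : fps R[i] W).
Proof. by exists 1, 0; split=> // s _; rewrite big1 // => m _; rewrite normr0 mul0r. Qed.

Lemma convergentZ c f : convergent f -> convergent (c *: f).
Proof.
move=> [r [M [r0 fM]]]; exists r, (`|c| * M); split=> // s us.
rewrite (eq_bigr (fun m => `|c| * (`|f m| * r ^+ mdeg m))).
  by rewrite -mulr_sumr ler_wpM2l // fM.
by move=> m _; rewrite normrM mulrA.
Qed.

Lemma convergentD f g : convergent f -> convergent g -> convergent (f + g).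
Proof.
move=> [r [M [r0 fM]]] [r' [M' [r'0 gM]]].
wlog rr' : f g r r' M M' r0 r'0 fM gM / r <= r'.
  move=> wl; have := real_leVge (gtr0_real r0) (gtr0_real r'0).
  by case/orP => h; last rewrite addrC; apply: wl h; eassumption.
exists r, (M + M'); split=> // s us.
apply: le_trans (lerD (fM s us) (gM s us)); rewrite -big_split /=.
apply: ler_sum => m _; apply: le_trans (_ : (`|f m| + `|g m|) * r ^+ mdeg m <= _).
  by rewrite ler_wpM2r ?ler_normD // exprn_ge0 // ltW.
rewrite mulrDl lerD2l ler_wpM2l // lerXn2r // ?nnegrE ?ltW //.
Qed.

Lemma convergentN f : convergent f -> convergent (- f).
Proof. by rewrite -scaleN1r; exact: convergentZ. Qed.

Lemma convergent_sum (I : Type) (s : seq I) (F : I -> fps R[i] W) :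
  (forall i, convergent (F i)) -> convergent (\sum_(i <- s) F i).
Proof.
move=> cF; elim/big_rec: _ => [|i x _ cx]; first exact: convergent0.
exact: convergentD.
Qed.

(** For a common radius r, the factor r^|m| is multiplicative along the Cauchy product, so a finite
    partial sum for the product is at most a product of finite partial sums for the factors. *)
Lemma convergentM f g : convergent f -> convergent g -> convergent (f * g).
Proof.
move=> [r [M [r0 fM]]] [r' [M' [r'0 gM]]].
wlog rr' : f g r r' M M' r0 r'0 fM gM / r <= r'.
  move=> wl; have := real_leVge (gtr0_real r0) (gtr0_real r'0).
  by case/orP => h; last rewrite mulrC; apply: wl h; eassumption.
have {r' r'0 rr'}gM s : uniq s -> \sum_(m <- s) `|g m| * r ^+ mdeg m <= M'.
  move=> us; apply: le_trans (gM s us); apply: ler_sum => m _.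
  by rewrite ler_wpM2l // lerXn2r // ?nnegrE ?ltW.
have M'0 : 0 <= M' by have := gM [::] isT; rewrite big_nil.
pose F (h : fps R[i] W) (m : mindex W) : R[i] := `|h m| * r ^+ mdeg m.
have F0 h m : 0 <= F h m by rewrite mulr_ge0 // exprn_ge0 // ltW.
exists r, (M * M'); split=> // s us.
(* [T] collects the finitely many first factors that occur; after exchanging the sums, the second
   factors belonging to a fixed [k] are distinct and their sum is at most [M']. *)
pose T := undup (flatten [seq below m | m <- s]).
have TE m : m \in s -> \sum_(k <- below m) F f k * F g (msub m k) =
    \sum_(k <- T) if k \in below m then F f k * F g (msub m k) else 0.
  move=> ms; rewrite -big_mkcond /= -[RHS]big_filter; apply: perm_big.
  apply: uniq_perm; rewrite ?filter_uniq ?uniq_below ?undup_uniq // => k.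
  rewrite mem_filter mem_undup; apply/idP/andP => [km|[]//]; split=> //.
  by apply/flattenP; exists (below m); rewrite // map_f.
apply: le_trans (_ : \sum_(m <- s) \sum_(k <- below m) F f k * F g (msub m k) <= _).
  apply: ler_sum => m _; rewrite fps_mulE.
  apply: le_trans (ler_wpM2r _ (ler_norm_sum _ _ _)) _; first by rewrite exprn_ge0 // ltW.
  rewrite mulr_suml le_eqVlt big_seq [X in _ == X]big_seq; apply/orP; left; apply/eqP.
  apply: eq_bigr => k km; rewrite /F normrM (mdeg_split km) exprD; ring.
rewrite big_seq (eq_bigr _ TE) -big_seq exchange_big /=.
apply: le_trans (_ : \sum_(k <- T) F f k * M' <= _).
  apply: ler_sum => k _; rewrite -big_mkcond /= -mulr_sumr ler_wpM2l //.
  rewrite -big_filter -(big_map (fun m => msub m k) xpredT (F g)); apply: gM.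
  rewrite map_inj_in_uniq ?filter_uniq // => m n.
  rewrite !mem_filter !mem_below => /andP[/forallP km _] /andP[/forallP kn _] /ffunP e.
  by apply/ffunP => w; have := e w; rewrite !ffunE -{2}(subnK (km w)) => ->; rewrite subnK.
by rewrite -mulr_suml ler_wpM2r // fM // undup_uniq.
Qed.

(** Division by z_w of a part of [f]. The predicate [P] will select the monomials charged to the
    variable [w] when a series without constant term is split as a sum of z_w F_w. *)
Lemma convergent_shift (w : W) (P : pred (mindex W)) f : convergent f ->
  convergent ((fun m => if P m then f (madd m (mvar w 1)) else 0) : fps R[i] W).
Proof.
move=> [r [M [r0 fM]]]; exists r, (r^-1 * M); split=> // s us.
rewrite -(ler_pM2l r0) mulrA mulfV ?gt_eqF // mul1r mulr_sumr.
have addI : injective (fun m => madd m (mvar w 1)).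
  by move=> p q /ffunP pq; apply/ffunP => v; move: (pq v); rewrite !ffunE => /addIn.
have := fM [seq madd m (mvar w 1) | m <- s]; rewrite map_inj_uniq // => /(_ us).
apply: le_trans; rewrite big_map; apply: ler_sum => m _.
rewrite mdeg_madd mdeg_mvar addn1 exprS mulrCA; case: ifP => // _.
by rewrite normr0 mul0r mulr_ge0 // mulr_ge0 ?exprn_ge0 // ltW.
Qed.

Definition conv_ring : set (fps R[i] W) := [set f | convergent f].
Definition conv_max : set (fps R[i] W) :=
  [set f | convergent f /\ f (mconst W 0) = 0].

Local Notation mpow := (ideal_pow conv_ring conv_max).

Lemma mpowD k f g : mpow k f -> mpow k g -> mpow k (f + g).
Proof.
case: k => [|k] /=; first exact: convergentD.
move=> [s [sP ->]] [s' [sP' ->]]; exists (s ++ s'); split.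
  by move=> p; rewrite mem_cat => /orP[/sP|/sP'].
by rewrite big_cat.
Qed.

Lemma mpowZ k c f : mpow k f -> mpow k (c *: f).
Proof.
case: k => [|k] /=; first exact: convergentZ.
move=> [s [sP ->]]; exists [seq (c *: p.1, p.2) | p <- s]; split.
  move=> _ /mapP[p /sP[[p1 p1'] p2] ->]; split=> //=; split; first exact: convergentZ.
  by rewrite fpsZE p1' mulr0.
by rewrite big_map scaler_sumr; apply: eq_bigr => p _ /=; rewrite scalerAl.
Qed.

Lemma mpow_convergent k f : mpow k f -> convergent f.
Proof.
elim: k f => // k IH f [s [sP ->]]; rewrite big_seq.
elim/big_rec: _ => [|p x /sP[[p1 _] /IH p2] cx]; first exact: convergent0.
by apply: convergentD => //; exact: convergentM.
Qed.

Lemma mpow0 k : mpow k 0.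
Proof.
by case: k => [|k] /=; [exact: convergent0 | exists [::]; split=> //; rewrite big_nil].
Qed.

Lemma mdeg_eq0 m : mdeg m = 0%N -> m = mconst W 0.
Proof.
move=> m0; apply/ffunP => w; rewrite ffunE; apply/eqP; rewrite -leqn0 -m0.
exact: leq_mdeg.
Qed.

Lemma ord_ge_mpow k f : mpow k f -> ord_ge k f.
Proof.
elim: k f => [|k IH] f //= [s [sP ->]].
rewrite big_seq; elim/big_rec: _ => // p x /sP[[_ p1] /IH p2] xk.
apply: ord_geD xk; apply: (@ord_geM _ _ 1) => // m.
by rewrite ltnS leqn0 => /eqP/mdeg_eq0 ->.
Qed.

(** Each monomial of positive degree is charged to one variable that divides it, so f is the sum of
    z_w F_w with F_w convergent of order one less. Together with [ord_ge_mpow] this identifies m^k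
    with the convergent series of order at least k. *)
Lemma ord_ge_in_mpow k f : convergent f -> ord_ge k f -> mpow k f.
Proof.
elim: k f => [|k IH] f fc fk //=.
pose ch m := [pick w | 0 < m w]%N.
pose F w : fps R[i] W :=
  fun m => if ch (madd m (mvar w 1)) == Some w then f (madd m (mvar w 1)) else 0.
exists [seq ('z_w, F w) | w <- enum W]; split.
  move=> _ /mapP[w _ ->] /=; split; first split.
  - exact: convergent_mono.
  - rewrite /fps_var /fps_mono; case: eqP => // /ffunP/(_ w).
    by rewrite !ffunE eqxx.
  - apply: IH; first exact: (@convergent_shift w (fun m => ch (madd m (mvar w 1)) == Some w)).
    move=> m mk; rewrite /F; case: ifP => // _; apply: fk.
    by rewrite mdeg_madd mdeg_mvar addn1 ltnS.
rewrite big_map; apply/funext => m; rewrite fps_sumE big_enum /=.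
have vE w : 'z_w = fps_mono R[i] (mvar w 1).
  by rewrite -fps_varX expr1.
have E w : ('z_w * F w) m = if ch m == Some w then f m else 0.
  rewrite vE mulrC fps_mul_mono /F; case: ifP => [/forallP wm|/negbT nwm].
    have -> // : madd (msub m (mvar w 1)) (mvar w 1) = m.
    by apply/ffunP => v; rewrite !ffunE subnK //; move: (wm v); rewrite ffunE.
  case: ifP => //; rewrite /ch; case: pickP => // v v0 /eqP[vw].
  case/negP: nwm; apply/forallP => u; rewrite ffunE -vw; case: eqP => // ->.
  by [].
under eq_bigr => w _ do rewrite E.
rewrite /ch; case: pickP => [w w0|m0].
  rewrite (bigD1 w) //= eqxx big1 ?addr0 // => v /negPf vw.
  by case: eqP => // -[/eqP]; rewrite eq_sym vw.
rewrite big1 // fk // /mdeg big1 // => w _; move: (m0 w); lia.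
Qed.

End Convergence.

(** * Hilbert-Samuel functions *)

(** Uniqueness of the coordinates comes from linear forms that vanish on [V] and are dual to the
    [e j] up to non-zero scalars; the scalars leave room for the sign -1 that occurs in (B). *)
Lemma quotient_dim_dual (K : fieldType) (E : lmodType K) (U V : set E) d
    (e : 'I_d -> E) (L : 'I_d -> E -> K) (s : 'I_d -> K) :
  (forall x y, V x -> V y -> V (x + y)) -> (forall c x, V x -> V (c *: x)) ->
  (forall j x y, L j (x + y) = L j x + L j y) ->
  (forall j c x, L j (c *: x) = c * L j x) ->
  (forall j v, V v -> L j v = 0) ->
  (forall i j, L j (e i) = if i == j then s j else 0) ->
  (forall j, s j != 0) -> (forall j, U (e j)) ->
  (forall x, U x -> exists c : 'rV[K]_d, V (x - \sum_(j < d) c 0 j *: e j)) ->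
  quotient_dim U V d.
Proof.
move=> VD VZ LD LZ LV Le s0 Ue Usp; exists e; split=> // x /Usp[c Vc].
exists c; split=> // c' Vc'; apply/rowP => j; apply/eqP; rewrite -subr_eq0.
have /(LV j) : V (\sum_(i < d) (c 0 i - c' 0 i) *: e i).
  have -> : \sum_(i < d) (c 0 i - c' 0 i) *: e i =
      (x - \sum_i c' 0 i *: e i) + (-1) *: (x - \sum_i c 0 i *: e i).
    under eq_bigr do rewrite scalerBl.
    by rewrite sumrB scaleN1r opprB [RHS]addrC subrKA.
  by apply: VD => //; exact: VZ.
have -> : L j (\sum_(i < d) (c 0 i - c' 0 i) *: e i) =
          \sum_(i < d) L j ((c 0 i - c' 0 i) *: e i).
  have L0 : L j 0 = 0 by rewrite -(scale0r 0) LZ mul0r.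
  by elim/big_rec2: _ => // i y z _ <-; rewrite LD.
rewrite (bigD1 j) //= big1 => [|i /negPf ij]; rewrite LZ Le ?ij ?mulr0 //.
by rewrite eqxx addr0 => /eqP; rewrite mulf_eq0 (negPf (s0 j)) orbF.
Qed.

(** * Normal forms modulo the two equations and the linear forms that read them *)

Section InverseSystem.
Variables (K : comNzRingType) (a1 a2 b c i : nat) (gam eps : K).
Hypotheses (a1_gt0 : (0 < a1)%N) (a2_gt0 : (0 < a2)%N) (lt_ia2 : (i < a2)%N).

Variables (t1 t2 t3 t4 : nat).

Fixpoint inv_fuel (n al be p q : nat) : K :=
  if n is n'.+1 then
    if (a1 <= al)%N then
      - (inv_fuel n' (al - a1) be (p + b) q + inv_fuel n' (al - a1) be p (q + c))
    else if (a2 <= be)%N then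
      - (inv_fuel n' al (be - a2) (p + b) q
         + gam * inv_fuel n' al (be - a2) p (q + c)
         + eps * inv_fuel n' (al + (a1 - 1)) (be - a2 + i) p q)
    else [&& al == t1, be == t2, p == t3 & q == t4]%:R
  else 0.

(** Termination measure. The third term of the second rule lowers [be] by a2 - i >= 1 but raises
    [al] by a1 - 1, hence the factor a1. *)
Let msr (al be : nat) := (a1 * be + al)%N.

Let msr1 al be : (a1 <= al)%N -> (msr (al - a1) be < msr al be)%N.
Proof. rewrite /msr; lia. Qed.
Let msr2 al be : (a2 <= be)%N -> (msr al (be - a2) < msr al be)%N.
Proof. rewrite /msr => h; have : (a1 * (be - a2) < a1 * be)%N by rewrite ltn_pmul2l //; lia.
lia. Qed.
Let msr3 al be : (a2 <= be)%N ->
  (msr (al + (a1 - 1)) (be - a2 + i) < msr al be)%N.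
Proof.
rewrite /msr => h.
have : (a1 * (be - a2 + i).+1 <= a1 * be)%N by rewrite leq_pmul2l //; lia.
rewrite mulnS; lia.
Qed.

Lemma inv_fuelE n n' al be p q : (msr al be < n)%N -> (msr al be < n')%N ->
  inv_fuel n al be p q = inv_fuel n' al be p q.
Proof.
elim: n n' al be p q => [//|n IH] [//|n'] al be p q h h' /=.
case: ifP => [/(msr1 be) m1|_]; first by rewrite 2?[inv_fuel n _ _ _ _](IH n') //; lia.
case: ifP => // h2; have m2 := msr2 al h2; have m3 := msr3 al h2.
by rewrite 3?[inv_fuel n _ _ _ _](IH n') //; lia.
Qed.

(* An element of the Macaulay inverse system of the two equations: the linear
   form reading off the coefficient at [(t1, t2, t3, t4)] of the normal form
   modulo [x1 ^ a1 -> - ..] and [x2 ^ a2 -> - ..]. *)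
Definition inv_sys al be p q := inv_fuel (msr al be).+1 al be p q.

Lemma inv_sysE1 al be p q : (a1 <= al)%N -> inv_sys al be p q =
  - (inv_sys (al - a1) be (p + b) q + inv_sys (al - a1) be p (q + c)).
Proof.
move=> h; rewrite [LHS]/inv_sys; move: (msr1 be h) => m1.
set n0 := _.+1; have : (msr al be < n0)%N by []; case: n0 => // n mn.
rewrite /= h; congr (- (_ + _)); apply: inv_fuelE => //; exact: leq_trans m1 _.
Qed.

Lemma inv_sysE2 al be p q : (al < a1)%N -> (a2 <= be)%N -> inv_sys al be p q =
  - (inv_sys al (be - a2) (p + b) q + gam * inv_sys al (be - a2) p (q + c)
     + eps * inv_sys (al + (a1 - 1)) (be - a2 + i) p q).
Proof.
move=> h1 h2; rewrite [LHS]/inv_sys; move: (msr2 al h2) (msr3 al h2) => m2 m3.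
set n0 := _.+1; have : (msr al be < n0)%N by []; case: n0 => // n mn.
rewrite /= leqNgt h1 /= h2; congr (- (_ + _ * _ + _ * _)); apply: inv_fuelE => //.
- exact: leq_trans m2 _.
- exact: leq_trans m2 _.
- exact: leq_trans m3 _.
Qed.

Lemma inv_sys_eq1 al be p q :
  inv_sys (al + a1) be p q + inv_sys al be (p + b) q + inv_sys al be p (q + c) = 0.
Proof. by rewrite inv_sysE1 ?leq_addl // addnK -addrA addNr. Qed.

(** Confluence of the two rules. The recursion gives this relation directly only for [al < a1], as
    the x1 rule has priority. For larger [al], applying the x1 rule to every term turns it into
    minus the sum of two instances at [al - a1]. *)
Lemma inv_sys_eq2 al be p q :
  inv_sys al (be + a2) p q + inv_sys al be (p + b) q
    + gam * inv_sys al be p (q + c) + eps * inv_sys (al + (a1 - 1)) (be + i) p q = 0.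
Proof.
have [n] := ubnP al; elim: n => // n IH in al be p q *; rewrite ltnS => aln.
have [h|h] := leqP a1 al.
  have E k be' p' q' : inv_sys (al + k) be' p' q' =
      - (inv_sys (al - a1 + k) be' (p' + b) q' + inv_sys (al - a1 + k) be' p' (q' + c)).
    apply/eqP; rewrite eq_sym eqr_oppLR -addr_eq0 addrC addrA; apply/eqP.
    by rewrite -(inv_sys_eq1 (al - a1 + k) be' p' q'); congr (inv_sys _ _ _ _ + _ + _); lia.
  have E0 be' p' q' : inv_sys al be' p' q' =
      - (inv_sys (al - a1) be' (p' + b) q' + inv_sys (al - a1) be' p' (q' + c)).
    by have := E 0%N be' p' q'; rewrite !addn0.
  have lt : (al - a1 < n)%N by lia.
  have H1 := IH (al - a1)%N be (p + b)%N q lt.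
  have H2 := IH (al - a1)%N be p (q + c)%N lt.
  rewrite E !E0.
  set X := (X in X = 0); rewrite -[RHS]oppr0 -[in RHS](addr0 0) -{1}H1 -{1}H2 {}/X.
  ring.
by rewrite inv_sysE2 ?leq_addl // addnK -!addrA addNr.
Qed.

Lemma inv_sys_box al be p q : (al < a1)%N -> (be < a2)%N ->
  inv_sys al be p q = [&& al == t1, be == t2, p == t3 & q == t4]%:R.
Proof. by move=> h1 h2; rewrite /inv_sys /= leqNgt h1 /= leqNgt h2. Qed.

Variable wt : nat -> nat -> nat.
Hypotheses
  (wt1 : forall al be, (a1 <= al)%N -> (wt al be <= wt (al - a1) be + minn b c)%N)
  (wt2 : forall al be, (al < a1)%N -> (a2 <= be)%N ->
     (wt al be <= wt al (be - a2) + minn b c)%N)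
  (wt3 : forall al be, eps != 0 -> (al < a1)%N -> (a2 <= be)%N ->
     (wt al be <= wt (al + (a1 - 1)) (be - a2 + i))%N).

(** No rule lowers [wt] plus the exponents of y and z, so the normal form of a monomial heavier than
    the target cannot contain the target. *)
Lemma inv_sys_wt al be p q :
  (wt t1 t2 + t3 + t4 < wt al be + p + q)%N -> inv_sys al be p q = 0.
Proof.
rewrite /inv_sys; move: (msr al be).+1 => n; elim: n al be p q => // n IH al be p q h /=.
case: ifPn => [h1|]; first by have w1 := wt1 be h1; rewrite !IH ?addr0 ?oppr0 //; lia.
rewrite -ltnNge => h1; case: ifPn => [h2|h2].
  have w2 := wt2 h1 h2; rewrite (IH al (be - a2)%N (p + b)%N q) ?(IH al (be - a2)%N p (q + c)%N) ?mulr0 ?add0r; try lia.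
  have [->|e0] := eqVneq eps 0; first by rewrite mul0r oppr0.
  by have w3 := wt3 e0 h1 h2; rewrite !IH ?mulr0 ?oppr0 //; lia.
case: and4P => // -[/eqP e1 /eqP e2 /eqP e3 /eqP e4].
by rewrite e1 e2 e3 e4 ltnn in h.
Qed.

End InverseSystem.

Section FourVariables.
Variables (W : finType) (x1 x2 y z : W).
Hypotheses (uw : uniq [:: x1; x2; y; z]) (allw : forall w, w \in [:: x1; x2; y; z]).

Definition mk4 (al be p q : nat) : mindex W :=
  [ffun w => if w == x1 then al else if w == x2 then be else if w == y then p else q].

Let neqs : [/\ (x2 == x1) = false, (y == x1) = false, (y == x2) = false
   & [/\ (z == x1) = false, (z == x2) = false & (z == y) = false]].
Proof.
move: uw; rewrite /= !inE !negb_or => /and4P[/and3P[n1 n2 n3] /andP[n4 n5] n6 _].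
by split; last split; apply/negbTE; rewrite eq_sym.
Qed.

Lemma mk4_x1 al be p q : mk4 al be p q x1 = al.
Proof. by rewrite ffunE eqxx. Qed.
Lemma mk4_x2 al be p q : mk4 al be p q x2 = be.
Proof. by case: neqs => n1 n2 n3 [n4 n5 n6]; rewrite ffunE n1 eqxx. Qed.
Lemma mk4_y al be p q : mk4 al be p q y = p.
Proof. by case: neqs => n1 n2 n3 [n4 n5 n6]; rewrite ffunE n2 n3 eqxx. Qed.
Lemma mk4_z al be p q : mk4 al be p q z = q.
Proof. by case: neqs => n1 n2 n3 [n4 n5 n6]; rewrite ffunE n4 n5 n6. Qed.
Definition mk4E := (mk4_x1, mk4_x2, mk4_y, mk4_z).

Lemma mindex4P (m m' : mindex W) :
  m x1 = m' x1 -> m x2 = m' x2 -> m y = m' y -> m z = m' z -> m = m'.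
Proof.
move=> e1 e2 e3 e4; apply/ffunP => w; have := allw w.
by rewrite !inE => /or4P[] /eqP ->.
Qed.

Lemma mk4_eta (m : mindex W) : m = mk4 (m x1) (m x2) (m y) (m z).
Proof. by apply: mindex4P; rewrite mk4E. Qed.

Lemma madd4 al be p q al' be' p' q' : madd (mk4 al be p q) (mk4 al' be' p' q') =
  mk4 (al + al') (be + be') (p + p') (q + q').
Proof. by apply: mindex4P; rewrite ffunE !mk4E. Qed.

Lemma mdeg4E (m : mindex W) : mdeg m = (m x1 + m x2 + m y + m z)%N.
Proof.
rewrite /mdeg -big_enum /= (perm_big [:: x1; x2; y; z]).
  by rewrite !big_cons big_nil /= addn0 !addnA.
by apply: uniq_perm; rewrite ?enum_uniq // => w; rewrite mem_enum allw.
Qed.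

Lemma mdeg_mk4 al be p q : mdeg (mk4 al be p q) = (al + be + p + q)%N.
Proof. by rewrite mdeg4E !mk4E. Qed.

Lemma mvar4 d : [/\ mvar x1 d = mk4 d 0 0 0, mvar x2 d = mk4 0 d 0 0,
  mvar y d = mk4 0 0 d 0 & mvar z d = mk4 0 0 0 d].
Proof.
case: neqs => n1 n2 n3 [n4 n5 n6].
split; apply: mindex4P; rewrite mk4E ffunE ?eqxx ?n1 ?n2 ?n3 ?n4 ?n5 ?n6 //;
  by rewrite eq_sym ?n1 ?n2 ?n3 ?n4 ?n5 ?n6.
Qed.

End FourVariables.

Section StandardMonomials.
Variables (W : finType) (x1 x2 y z : W).
Hypotheses (uw : uniq [:: x1; x2; y; z]) (allw : forall w, w \in [:: x1; x2; y; z]).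
Variable Nx : seq (nat * nat).

Local Notation mk := (mk4 x1 x2 y).

(** Only the exponents of x1 and x2 are constrained, as the initial ideals are generated by
    monomials in these two variables; the exponent of z is what remains of the degree [k]. *)
Definition std_monos (k : nat) : seq (mindex W) :=
  [seq mk n.1 n.2 p (k - (n.1 + n.2) - p) |
     n <- [seq n <- Nx | n.1 + n.2 <= k]%N, p <- iota 0 (k - (n.1 + n.2)).+1].

Lemma size_std_monos k :
  size (std_monos k) = (\sum_(n <- Nx | n.1 + n.2 <= k) (k - (n.1 + n.2)).+1)%N.
Proof.
rewrite size_allpairs_dep sumnE big_map big_filter; apply: eq_bigr => n _.
by rewrite size_iota.
Qed.

Lemma mem_std_monos k (m : mindex W) : reflect
  ((m x1, m x2) \in Nx /\ mdeg m = k) (m \in std_monos k).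
Proof.
rewrite (mdeg4E uw allw).
apply: (iffP allpairsPdep); last move=> [mN mdk].
  move=> [n [p [+ + ->]]].
  rewrite mem_filter mem_iota => /andP[nk nN] pk; rewrite !(mk4E uw) -surjective_pairing.
  by split=> //; lia.
exists (m x1, m x2), (m y); rewrite mem_filter mN mem_iota /= andbT.
split; [lia|lia|rewrite [LHS](mk4_eta uw allw)].
by congr mk4; lia.
Qed.

Lemma uniq_std_monos k : uniq Nx -> uniq (std_monos k).
Proof.
move=> uNx; apply: allpairs_uniq_dep; rewrite ?filter_uniq //.
  by move=> n _; exact: iota_uniq.
move=> [n p] [n' p'] _ _ /= e.
have := congr1 (fun m : mindex W => m x1) e; have := congr1 (fun m : mindex W => m x2) e.
have := congr1 (fun m : mindex W => m y) e; rewrite !(mk4E uw) => <- e2 e1.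
by case: n n' e1 e2 {e} => [n1 n2] [n1' n2'] /= -> ->.
Qed.

End StandardMonomials.

Lemma gen_ideal_pairP (A : comNzRingType) (B : set A) (f1 f2 x : A) :
  gen_ideal B [:: f1; f2] x <->
  exists g1 g2, [/\ B g1, B g2 & x = g1 * f1 + g2 * f2].
Proof.
split=> [[g [Bg ->]]|[g1 [g2 [B1 B2 ->]]]].
  exists (g ord0), (g (lift ord0 ord0)); split=> //.
  by rewrite !big_ord_recl big_ord0 addr0.
exists (fun j => if val j == 0%N then g1 else g2); split.
  by move=> j; case: ifP.
by rewrite !big_ord_recl big_ord0 addr0.
Qed.

(** * Bases of the graded pieces of the local ring *)

Section HilbertSamuel.
Variables (R : realType) (W : finType) (x1 x2 y z : W).
Hypotheses (uw : uniq [:: x1; x2; y; z]) (allw : forall w, w \in [:: x1; x2; y; z]).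
Variables (a1 a2 b c i : nat) (gam eps : R[i]).
Hypotheses (a1_gt0 : (0 < a1)%N) (a2_gt0 : (0 < a2)%N) (lt_ia2 : (i < a2)%N).

Local Notation mk := (mk4 x1 x2 y).
Local Notation mono al be p q := (fps_mono R[i] (mk al be p q)).

Definition eqn1 : fps R[i] W := 'z_x1 ^+ a1 + 'z_y ^+ b + 'z_z ^+ c.
(** One family for both cases: [eps = 0] with [i = 0] gives (A), and [eps = 1] gives (B). *)
Definition eqn2 : fps R[i] W :=
  'z_x2 ^+ a2 + 'z_y ^+ b + gam *: 'z_z ^+ c + eps *: ('z_x1 ^+ (a1 - 1) * 'z_x2 ^+ i).

Definition eqn_ideal : set (fps R[i] W) :=
  gen_ideal (@conv_ring R W) [:: eqn1; eqn2].

Definition eqn_level (k : nat) : set (fps R[i] W) :=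
  add_set (ideal_pow (@conv_ring R W) (@conv_max R W) k) eqn_ideal.

Lemma eqn1E : eqn1 = mono a1 0 0 0 + mono 0 0 b 0 + mono 0 0 0 c.
Proof.
have [v1 _ _ _] := mvar4 uw allw a1; have [_ _ v3 _] := mvar4 uw allw b.
have [_ _ _ v4] := mvar4 uw allw c.
by rewrite /eqn1 !fps_varX v1 v3 v4.
Qed.

Lemma eqn2E : eqn2 = mono 0 a2 0 0 + mono 0 0 b 0 + gam *: mono 0 0 0 c
  + eps *: mono (a1 - 1) i 0 0.
Proof.
have [_ v1 _ _] := mvar4 uw allw a2; have [_ _ v3 _] := mvar4 uw allw b.
have [_ _ _ v4] := mvar4 uw allw c; have [v5 _ _ _] := mvar4 uw allw (a1 - 1).
have [_ v6 _ _] := mvar4 uw allw i.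
by rewrite /eqn2 !fps_varX mulr_mono v1 v3 v4 v5 v6 (madd4 uw allw) !addn0 add0n.
Qed.

Lemma eqn1_mvar : eqn1 = fps_mono R[i] (mvar x1 a1) +
  (fps_mono R[i] (mvar y b) + fps_mono R[i] (mvar z c)).
Proof. by rewrite /eqn1 !fps_varX addrA. Qed.

Lemma eqn2_mvar : eqn2 = fps_mono R[i] (mvar x2 a2) +
  (fps_mono R[i] (mvar y b) + gam *: fps_mono R[i] (mvar z c)) +
  eps *: fps_mono R[i] (madd (mvar x1 (a1 - 1)) (mvar x2 i)).
Proof. by rewrite /eqn2 !fps_varX mulr_mono !addrA. Qed.

Lemma eqn_idealD u v : eqn_ideal u -> eqn_ideal v -> eqn_ideal (u + v).
Proof.
move=> /gen_ideal_pairP[g1 [g2 [c1 c2 ->]]] /gen_ideal_pairP[h1 [h2 [d1 d2 ->]]].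
apply/gen_ideal_pairP; exists (g1 + h1), (g2 + h2).
by split; [exact: convergentD..|rewrite !mulrDl addrACA].
Qed.

Lemma eqn_idealZ a u : eqn_ideal u -> eqn_ideal (a *: u).
Proof.
move=> /gen_ideal_pairP[g1 [g2 [c1 c2 ->]]].
apply/gen_ideal_pairP; exists (a *: g1), (a *: g2).
by split; [exact: convergentZ..|rewrite scalerDr !scalerAl].
Qed.

Lemma eqn_ideal0 : eqn_ideal 0.
Proof.
apply/gen_ideal_pairP; exists 0, 0; split; try exact: convergent0.
by rewrite !mul0r addr0.
Qed.

Lemma eqn_ideal1 n : eqn_ideal (fps_mono _ n * eqn1).
Proof.
apply/gen_ideal_pairP; exists (fps_mono _ n), 0.
by split; [exact: convergent_mono|exact: convergent0|rewrite mul0r addr0].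
Qed.

Lemma eqn_ideal2 n : eqn_ideal (fps_mono _ n * eqn2).
Proof.
apply/gen_ideal_pairP; exists 0, (fps_mono _ n).
by split; [exact: convergent0|exact: convergent_mono|rewrite mul0r add0r].
Qed.

Lemma eqn_levelD k u v : eqn_level k u -> eqn_level k v -> eqn_level k (u + v).
Proof.
move=> [p [q [pp qq ->]]] [p' [q' [pp' qq' ->]]].
exists (p + p'), (q + q'); split; [exact: mpowD|exact: eqn_idealD|exact: addrACA].
Qed.

Lemma eqn_levelZ k a u : eqn_level k u -> eqn_level k (a *: u).
Proof.
move=> [p [q [pp qq ->]]].
exists (a *: p), (a *: q); split; [exact: mpowZ|exact: eqn_idealZ|exact: scalerDr].
Qed.

Lemma eqn_level_ideal k u : eqn_ideal u -> eqn_level k u.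
Proof. by move=> Iu; exists 0, u; split=> //; rewrite ?add0r //; exact: mpow0. Qed.

Lemma eqn_level_ord k u : convergent u -> ord_ge k u -> eqn_level k u.
Proof.
move=> cu ku; exists u, 0; split; rewrite ?addr0 //; last exact: eqn_ideal0.
exact: ord_ge_in_mpow.
Qed.

Lemma eqn_level_mono k n : (k <= mdeg n)%N -> eqn_level k (fps_mono _ n).
Proof.
move=> kn; apply: eqn_level_ord; first exact: convergent_mono.
exact: ord_ge_mono.
Qed.

Variables (wt : nat -> nat -> nat).
Hypotheses
  (wt0 : forall al be, (al + be <= wt al be)%N)
  (wt1 : forall al be, (a1 <= al)%N -> (wt al be <= wt (al - a1) be + minn b c)%N)
  (wt2 : forall al be, (al < a1)%N -> (a2 <= be)%N ->
     (wt al be <= wt al (be - a2) + minn b c)%N)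
  (wt3 : forall al be, eps != 0 -> (al < a1)%N -> (a2 <= be)%N ->
     (wt al be <= wt (al + (a1 - 1)) (be - a2 + i))%N).

Let lam t1 t2 t3 t4 (m : mindex W) : R[i] :=
  inv_sys a1 a2 b c i gam eps t1 t2 t3 t4 (m x1) (m x2) (m y) (m z).

Lemma lam_deg t1 t2 t3 t4 m : (wt t1 t2 + t3 + t4 < mdeg m)%N -> lam t1 t2 t3 t4 m = 0.
Proof.
rewrite (mdeg4E uw allw) => h; rewrite /lam; apply: (inv_sys_wt _ a1_gt0 a2_gt0 lt_ia2 wt1 wt2 wt3).
by apply: leq_trans h _; rewrite !leq_add2r.
Qed.

(** By adjointness, the coefficients of [g1 m] and [g2 m] in the pairing are the left sides of
    [inv_sys_eq1] and [inv_sys_eq2] at the exponent [m]. *)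
Lemma pairing_eqn_ideal t1 t2 t3 t4 u :
  eqn_ideal u -> pairing (wt t1 t2 + t3 + t4) (lam t1 t2 t3 t4) u = 0.
Proof.
move=> /gen_ideal_pairP[g1 [g2 [_ _ ->]]]; rewrite pairingD eqn1E eqn2E.
rewrite !mulrDr -!scalerAr !pairingD !pairingZ.
have dP := @lam_deg t1 t2 t3 t4; rewrite !(pairing_mul_mono dP) !mulr_sumr -!big_split /=.
have lamE m n : lam t1 t2 t3 t4 (madd m n) =
    inv_sys a1 a2 b c i gam eps t1 t2 t3 t4
      (m x1 + n x1) (m x2 + n x2) (m y + n y) (m z + n z).
  by rewrite /lam !ffunE.
rewrite big1 // => m _; rewrite !lamE !(mk4E uw) !addn0.
have e1 := inv_sys_eq1 b c gam eps a1_gt0 a2_gt0 lt_ia2 t1 t2 t3 t4.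
have e2 := inv_sys_eq2 b c gam eps a1_gt0 a2_gt0 lt_ia2 t1 t2 t3 t4.
transitivity (g1 m * 0 + g2 m * 0); last by rewrite !mulr0 addr0.
rewrite -{1}(e1 (m x1) (m x2) (m y) (m z)) -(e2 (m x1) (m x2) (m y) (m z)).
by rewrite !mulrDr ![gam * (_ * _)]mulrCA ![eps * (_ * _)]mulrCA.
Qed.

(** [tau n] is the exponent of the lightest term in the normal form of the standard monomial [n],
    and [sg n] is the coefficient of that term. *)
Variables (Nx : seq (nat * nat)) (tau : nat * nat -> nat * nat) (sg : nat * nat -> R[i]).
Hypotheses
  (uNx : uniq Nx)
  (wt_tau : forall n, n \in Nx -> wt (tau n).1 (tau n).2 = (n.1 + n.2)%N)
  (sg_neq0 : forall n, sg n != 0)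
  (dual_tau : forall n n' p q p' q', n \in Nx -> n' \in Nx ->
     (n.1 + n.2 + p + q = n'.1 + n'.2 + p' + q')%N ->
     inv_sys a1 a2 b c i gam eps (tau n).1 (tau n).2 p q n'.1 n'.2 p' q' =
     if [&& n == n', p == p' & q == q'] then sg n else 0).

Definition spanned (k : nat) (u : fps R[i] W) : Prop := exists cf : mindex W -> R[i],
  eqn_level k.+1 (u - \sum_(n <- std_monos x1 x2 y Nx k) cf n *: fps_mono _ n).

Lemma spannedD k u v : spanned k u -> spanned k v -> spanned k (u + v).
Proof.
move=> [cf Hu] [cg Hv]; exists (fun n => cf n + cg n).
under eq_bigr do rewrite scalerDl.
by rewrite big_split opprD addrACA; exact: eqn_levelD.
Qed.

Lemma spannedZ k a u : spanned k u -> spanned k (a *: u).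
Proof.
move=> [cf Hu]; exists (fun n => a * cf n).
under eq_bigr do rewrite -scalerA.
by rewrite -scaler_sumr -scalerBr; exact: eqn_levelZ.
Qed.

Lemma spanned_level k u : eqn_level k.+1 u -> spanned k u.
Proof. by exists (fun _ => 0); rewrite big1 ?subr0 // => n _; rewrite scale0r. Qed.

Lemma spanned_std k n : n \in std_monos x1 x2 y Nx k -> spanned k (fps_mono _ n).
Proof.
move=> nk; exists (fun m => (m == n)%:R).
rewrite (bigD1_seq n) ?(uniq_std_monos uw _ uNx) //= eqxx scale1r big1.
  rewrite addr0 subrr -(scale0r 0); apply: eqn_levelZ.
  by apply: eqn_level_ideal; exact: eqn_ideal0.
by move=> m /negPf ->; rewrite scale0r.
Qed.

Hypothesis span_mono : forall k m, mdeg m = k -> spanned k (fps_mono _ m).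

Lemma spanned_all k u : eqn_level k u -> spanned k u.
Proof.
move=> [p [q [pk qI ->]]]; apply: spannedD; last first.
  by apply/spanned_level/eqn_level_ideal.
have cp := mpow_convergent pk.
(* The part [p0] of degree k is a finite combination of monomials, and [p - p0] has order at least k
   + 1, hence lies in the next level. *)
pose s := [seq m <- below (mconst W k) | mdeg m == k].
pose p0 := \sum_(m <- s) p m *: fps_mono R[i] m.
have -> : p = p0 + (p - p0) by rewrite addrC subrK.
have cp0 : convergent p0.
  by apply: convergent_sum => m; apply: convergentZ; exact: convergent_mono.
apply: spannedD.
  rewrite /p0 big_seq.
  elim/big_rec: _ => [|m x]; first by apply/spanned_level/eqn_level_ideal/eqn_ideal0.
  rewrite mem_filter => /andP[/eqP mk _] sx; apply: spannedD => //.
  by apply: spannedZ; exact: span_mono.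
apply/spanned_level/eqn_level_ord.
  by apply: convergentD => //; exact: convergentN.
move=> m; rewrite ltnS leq_eqVlt => /orP[/eqP mk|mk].
  rewrite fpsDE fpsNE /p0 fps_sumE (bigD1_seq m) ?filter_uniq ?uniq_below //=.
    rewrite fpsZE /fps_mono eqxx mulr1 big1 ?addr0 ?subrr // => n /negPf nm.
    by rewrite fpsZE eq_sym nm mulr0.
  by rewrite mem_filter mk eqxx below_const ?mk.
rewrite fpsDE fpsNE (ord_ge_mpow pk) // /p0 fps_sumE big_seq big1 ?subrr //.
move=> n; rewrite mem_filter fpsZE /fps_mono => /andP[/eqP nk _].
by case: eqP mk => [->|]; rewrite ?nk ?ltnn ?mulr0.
Qed.

Lemma level_quotient_dim k :
  quotient_dim (eqn_level k) (eqn_level k.+1) (size (std_monos x1 x2 y Nx k)).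
Proof.
pose S j : mindex W := nth (mconst W 0) (std_monos x1 x2 y Nx k) j.
pose xx (m : mindex W) := (m x1, m x2).
pose L (j : 'I_(size (std_monos x1 x2 y Nx k))) :=
  let m := S j in pairing k (lam (tau (xx m)).1 (tau (xx m)).2 (m y) (m z)).
have SP (j : 'I_(size (std_monos x1 x2 y Nx k))) : xx (S j) \in Nx /\ mdeg (S j) = k.
  by apply/(mem_std_monos uw allw); exact: mem_nth.
(* The target of [L j] has weight exactly k, so [L j] vanishes in degrees above k and therefore on
   m^(k+1). *)
have wtS (j : 'I_(size (std_monos x1 x2 y Nx k))) : let m := S j in
    (wt (tau (xx m)).1 (tau (xx m)).2 + m y + m z)%N = k.
  by have [h1 h2] := SP j; rewrite /= wt_tau //= -[RHS]h2 (mdeg4E uw allw).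
apply: (@quotient_dim_dual _ _ _ _ _ (fun j => fps_mono _ (S j)) L
          (fun j => sg (xx (S j)))).
- exact: eqn_levelD.
- exact: eqn_levelZ.
- by move=> j u v; exact: pairingD.
- by move=> j u v; exact: pairingZ.
- move=> j u [p [q [pk qI ->]]]; rewrite /L pairingD.
  have dP := @lam_deg (tau (xx (S j))).1 (tau (xx (S j))).2 (S j y) (S j z).
  have := @pairing_eqn_ideal (tau (xx (S j))).1 (tau (xx (S j))).2 (S j y) (S j z) _ qI.
  rewrite wtS in dP *; move=> ->; rewrite addr0 pairing_ord //.
  exact: ord_ge_mpow pk.
- move=> i' j; have [h1 h2] := SP i'; have [h3 h4] := SP j.
  have dP := @lam_deg (tau (xx (S j))).1 (tau (xx (S j))).2 (S j y) (S j z).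
  rewrite wtS in dP; rewrite /L pairing_mono ?h2 // /lam.
  rewrite (@dual_tau (xx (S j)) (xx (S i')) (S j y) (S j z) (S i' y) (S i' z)) //; last first.
    by rewrite /= -!(mdeg4E uw allw) h2 h4.
  congr (if _ then _ else _); apply/and3P/eqP => [[/eqP[e1 e2] /eqP e3 /eqP e4]|->]; last by rewrite !eqxx.
  have e : S i' = S j by apply: (mindex4P allw).
  apply: val_inj; apply/eqP; 
  by rewrite -(nth_uniq (mconst W 0) (ltn_ord i') (ltn_ord j) (uniq_std_monos uw k uNx)); exact/eqP.
- by move=> j.
- by move=> j; apply: eqn_level_mono; case: (SP j) => _ ->.
move=> u /spanned_all[cf]; rewrite (big_nth (mconst W 0)) big_mkord => H.
exists (\row_j cf (S j)).
by under eq_bigr do rewrite mxE.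
Qed.

End HilbertSamuel.

(** * Reduction of monomials modulo the equations and terms of higher degree *)

Section Spanning.
Variables (R : realType) (W : finType) (x1 x2 y z : W).
Hypotheses (uw : uniq [:: x1; x2; y; z]) (allw : forall w, w \in [:: x1; x2; y; z]).
Variables (a1 a2 b c i : nat) (gam eps : R[i]) (Nx : seq (nat * nat)).
Hypothesis uNx : uniq Nx.

Local Notation mono al be p q := (fps_mono R[i] (mk4 x1 x2 y al be p q)).
Local Notation f1 := (@eqn1 R W x1 y z a1 b c).
Local Notation f2 := (@eqn2 R W x1 x2 y z a1 a2 b c i gam eps).
Local Notation span := (@spanned R W x1 x2 y z a1 a2 b c i gam eps Nx).

Lemma mulr_eqn1 al be p q : mono al be p q * f1 =
  mono (al + a1) be p q + mono al be (p + b) q + mono al be p (q + c).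
Proof. by rewrite (eqn1E _ uw allw) !mulrDr !mulr_mono !(madd4 uw allw) !addn0. Qed.

Lemma mulr_eqn2 al be p q : mono al be p q * f2 =
  mono al (be + a2) p q + mono al be (p + b) q + gam *: mono al be p (q + c)
  + eps *: mono (al + (a1 - 1)) (be + i) p q.
Proof.
by rewrite (eqn2E uw allw) !mulrDr -!scalerAr !mulr_mono !(madd4 uw allw) !addn0.
Qed.

Lemma span_deg k al be p q : (k < al + be + p + q)%N -> span k (mono al be p q).
Proof.
move=> h; apply: spanned_level; apply: eqn_level_mono.
by rewrite (mdeg_mk4 uw allw).
Qed.

Lemma spanN k u : span k u -> span k (- u).
Proof. by rewrite -scaleN1r; exact: spannedZ. Qed.

Lemma span_eqn1 k al be p q :
  span k (mono al be (p + b) q) -> span k (mono al be p (q + c)) ->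
  span k (mono (al + a1) be p q).
Proof.
move=> h1 h2; have := mulr_eqn1 al be p q.
move/eqP; rewrite -addrA -subr_eq => /eqP <-; apply: spannedD.
  by apply/spanned_level/eqn_level_ideal/eqn_ideal1.
by apply: spanN; apply: spannedD.
Qed.

Lemma span_eqn2 k al be p q :
  span k (mono al be (p + b) q) -> span k (mono al be p (q + c)) ->
  (eps != 0 -> span k (mono (al + (a1 - 1)) (be + i) p q)) ->
  span k (mono al (be + a2) p q).
Proof.
move=> h1 h2 h3; have := mulr_eqn2 al be p q.
move/eqP; rewrite -!addrA -subr_eq => /eqP <-; apply: spannedD.
  by apply/spanned_level/eqn_level_ideal/eqn_ideal2.
apply: spanN; apply: spannedD => //; apply: spannedD; first exact: spannedZ.
have [->|/h3] := eqVneq eps 0; last exact: spannedZ.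
by rewrite scale0r; apply/spanned_level/eqn_level_ideal/eqn_ideal0.
Qed.

(** The second equation solved for its new term instead of x2^a2: in (B) this term has the lowest
    degree, so graded reduction runs in the direction opposite to [inv_sys]. *)
Lemma span_eqn2' k al be p q : eps != 0 ->
  span k (mono al be (p + b) q) -> span k (mono al be p (q + c)) ->
  span k (mono al (be + a2) p q) ->
  span k (mono (al + (a1 - 1)) (be + i) p q).
Proof.
move=> e0 h1 h2 h3; have := mulr_eqn2 al be p q.
move/eqP; rewrite addrC -subr_eq => /eqP E.
rewrite -[fps_mono _ _](scalerK e0) -E; apply: spannedZ; apply: spannedD.
  by apply/spanned_level/eqn_level_ideal/eqn_ideal2.
apply: spanN; apply: spannedD; last exact: spannedZ.
by apply: spannedD.
Qed.

End Spanning.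

Section Dimensions.
Variables (R : realType) (W : finType) (x1 x2 y z : W).
Hypotheses (uw : uniq [:: x1; x2; y; z]) (allw : forall w, w \in [:: x1; x2; y; z]).
Variables (a1 a2 b c : nat) (gam : R[i]).

Definition std_box : seq (nat * nat) := [seq (al, be) | al <- iota 0 a1, be <- iota 0 a2].

Lemma mem_std_box n : (n \in std_box) = (n.1 < a1)%N && (n.2 < a2)%N.
Proof.
case: n => al be; rewrite /=; apply/allpairsP/andP => [[[u v] /=]|[h1 h2]].
  by rewrite !mem_iota => -[h1 h2 [-> ->]].
by exists (al, be); rewrite !mem_iota /=.
Qed.

Lemma uniq_std_box : uniq std_box.
Proof. by apply: allpairs_uniq; rewrite ?iota_uniq // => -[? ?] [? ?] _ _ [-> ->]. Qed.

Lemma level_dim_box k : (0 < a1)%N -> (0 < a2)%N ->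
  (maxn a1 a2 <= minn b c)%N ->
  quotient_dim (@eqn_level R W x1 x2 y z a1 a2 b c 0 gam 0 k)
               (@eqn_level R W x1 x2 y z a1 a2 b c 0 gam 0 k.+1)
    (\sum_(n <- std_box | n.1 + n.2 <= k) (k - (n.1 + n.2)).+1)%N.
Proof.
move=> a1_gt0 a2_gt0 hab; rewrite -(size_std_monos x1 x2 y).
apply: (@level_quotient_dim R W x1 x2 y z uw allw a1 a2 b c 0 gam 0
          a1_gt0 a2_gt0 a2_gt0 addn _ _ _ _ std_box id (fun=> 1)) => //.
- move=> al be; lia.
- move=> al be; lia.
- by move=> al be; rewrite eqxx.
- exact: uniq_std_box.
- by move=> n; rewrite oner_neq0.
- move=> n n' p q p' q'; rewrite !mem_std_box => _ /andP[h1 h2] _.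
  rewrite inv_sys_box // [n'.1 == _]eq_sym [n'.2 == _]eq_sym [p' == _]eq_sym [q' == _]eq_sym.
  by case: n n' {h1 h2} => [? ?] [? ?] /=; rewrite xpair_eqE -andbA; case: ifP.
move=> {}k m; rewrite (mk4_eta uw allw m) (mdeg_mk4 uw allw) => mk.
(* The induction on al + be covers all monomials of degree at least k, because replacing x1^a1 or
   x2^a2 by powers of y and z may raise the degree. *)
move: (m x1) (m x2) (m y) (m z) (eq_leq (esym mk)) => al be p q {m mk}.
have [n] := ubnP (al + be); elim: n al be p q => // n IH al be p q; rewrite ltnS => hn.
rewrite leq_eqVlt => /orP[/eqP hk|]; last exact: span_deg.
have [h1|h1] := leqP a1 al.
  rewrite -(subnK h1); apply: span_eqn1 => //; apply: IH; lia.
have [h2|h2] := leqP a2 be.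
  by rewrite -(subnK h2); apply: span_eqn2; rewrite ?eqxx //; apply: IH; lia.
apply: (spanned_std uw _ _ _ _ _ _ _ uniq_std_box).
by apply/(mem_std_monos uw allw); 
rewrite mem_std_box !(mk4E uw) h1 h2 (mdeg_mk4 uw allw).
Qed.

Variable i : nat.

Definition std_hook : seq (nat * nat) :=
  [seq (al, be) | al <- iota 1 (a1 - 2), be <- iota 0 a2]
  ++ [seq (0%N, be) | be <- iota 0 (2 * a2 - i)]
  ++ [seq ((a1 - 1)%N, be) | be <- iota 0 i].

Lemma mem_std_hook n : (2 <= a1)%N -> (n \in std_hook) =
  [|| (n.1 == 0)%N && (n.2 < 2 * a2 - i)%N, (n.1 == a1 - 1)%N && (n.2 < i)%N
    | [&& (0 < n.1)%N, (n.1 < a1 - 1)%N & (n.2 < a2)%N]].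
Proof.
move=> a1_ge2; rewrite /std_hook !mem_cat; case: n => al be /=.
have -> : ((al, be) \in [seq (al, be) | al <- iota 1 (a1 - 2), be <- iota 0 a2]) =
    [&& (0 < al)%N, (al < a1 - 1)%N & (be < a2)%N].
  apply/allpairsP/and3P => [[[u v] /=]|[h1 h2 h3]].
    by rewrite !mem_iota => -[h1 h2 [-> ->]]; split; lia.
  by exists (al, be); rewrite !mem_iota /=; split => //; lia.
have inj d : injective (fun j : nat => (d : nat, j)) by move=> u v [].
have E d n : ((al, be) \in [seq (d, j) | j <- iota 0 n]) = (al == d) && (be < n)%N.
  apply/mapP/andP => [[j]|[/eqP -> h]]; first by rewrite mem_iota => h [-> ->].
  by exists be; rewrite ?mem_iota.
by rewrite !E orbC -orbA.
Qed.

Lemma uniq_std_hook : (2 <= a1)%N -> uniq std_hook.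
Proof.
move=> a1_ge2; rewrite /std_hook !cat_uniq.
have inj d : injective (fun j : nat => (d : nat, j)) by move=> u v [].
rewrite !(map_inj_uniq (inj _)) ?iota_uniq //= andbT.
rewrite allpairs_uniq ?iota_uniq //=; last by move=> [? ?] [? ?] _ _ [-> ->].
apply/andP; split; last first.
  apply/hasPn => _ /mapP[j _ ->]; apply/mapP => -[l _ [h _]]; lia.
apply/hasPn => -[u v] h; apply/allpairsP => -[[u' v'] /= []].
rewrite mem_iota => hu _ [? ?]; subst; move: h.
by rewrite mem_cat => /orP[] /mapP[j _ [? _]]; lia.
Qed.

Lemma level_dim_hook k : (2 <= a1)%N -> (a1 < a2)%N -> (a2 < b)%N -> (b < c)%N ->
  (0 < i)%N -> (a1 - 1 + i < a2)%N -> (2 * a2 - i < b + a1 - 1)%N ->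
  quotient_dim (@eqn_level R W x1 x2 y z a1 a2 b c i gam 1 k)
               (@eqn_level R W x1 x2 y z a1 a2 b c i gam 1 k.+1)
    (\sum_(n <- std_hook | n.1 + n.2 <= k) (k - (n.1 + n.2)).+1)%N.
Proof.
move=> a1_ge2 a12 a2b bc i_gt0 hi hb; rewrite -(size_std_monos x1 x2 y).
have [a1_gt0 a2_gt0 lt_ia2] : [/\ 0 < a1, 0 < a2 & i < a2]%N by split; lia.
have mbc : minn b c = b by lia.
(* The correction b - a1 is the gain in degree when x1^a1 becomes y^b. The correction a2 - i - (a1 -
   1) is the difference of the degrees of x2^(a2+be-i) and x1^(a1-1) x2^be. The bound on b makes the
   rule for x2^a2 respect this weight also at al = a1 - 1. *)
pose wt al be := (al + be + if a1 <= al then b - a1 else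
   if (al == a1 - 1) && (i <= be) then a2 - i - (a1 - 1) else 0)%N.
(* For j >= a2 the normal form of x2^j is - x1^(a1-1) x2^(j-a2+i) up to terms of
   larger weight. *)
pose tau (n : nat * nat) :=
  if (n.1 == 0)%N && (a2 <= n.2)%N then ((a1 - 1)%N, (n.2 - a2 + i)%N) else n.
pose sg (n : nat * nat) : R[i] := if (n.1 == 0)%N && (a2 <= n.2)%N then -1 else 1.
apply: (@level_quotient_dim R W x1 x2 y z uw allw a1 a2 b c i gam 1
          a1_gt0 a2_gt0 lt_ia2 wt _ _ _ _ std_hook tau sg).
- by move=> al be; rewrite leq_addr.
- by move=> al be h; rewrite /wt mbc; do ?[case: ifPn => ?]; lia.
- by move=> al be h h'; rewrite /wt mbc; do ?[case: ifPn => ?]; lia.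
- by move=> al be _ h h'; rewrite /wt; do ?[case: ifPn => ?]; lia.
- exact: uniq_std_hook.
- move=> [u v]; rewrite mem_std_hook // /wt /tau /= => h.
  by case: ifPn => ? /=; do ?[case: ifPn => ?]; lia.
- by move=> n; rewrite /sg; case: ifP => _; rewrite ?oppr_eq0 oner_neq0.
- move=> [u v] [u' v'] p q p' q'; rewrite !mem_std_hook //= xpair_eqE => hn hn' hdeg.
  rewrite /tau /sg /=.
  (* As v' < 2 a2 - i, one use of the rule for x2^a2 lands in the box. Equality of degrees excludes
     the terms with y^b and z^c, and the third term is the target exactly when the two monomials
     agree; its sign is that of [sg]. *)
  have [hv'|hv'] := boolP ((u' == 0%N) && (a2 <= v')%N).
    rewrite inv_sysE2 // ?inv_sys_box //; try lia.
    case: ifPn => hv /=.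
      have -> : [&& u' == a1 - 1, v' - a2 == v - a2 + i, p' + b == p & q' == q]%N = false
        by lia.
      have -> : [&& u' == a1 - 1, v' - a2 == v - a2 + i, p' == p & q' + c == q]%N = false
        by lia.
      have -> : [&& u' + (a1 - 1) == a1 - 1, v' - a2 + i == v - a2 + i, p' == p & q' == q]%N
          = [&& (u == u') && (v == v'), p == p' & q == q'] by lia.
      by rewrite mulr0 mul1r !add0r; case: ifP; rewrite ?oppr0.
    have -> : [&& u' == u, v' - a2 == v, p' + b == p & q' == q]%N = false by lia.
    have -> : [&& u' == u, v' - a2 == v, p' == p & q' + c == q]%N = false by lia.
    have -> : [&& u' + (a1 - 1) == u, v' - a2 + i == v, p' == p & q' == q]%N = false by lia.
    have -> : [&& (u == u') && (v == v'), p == p' & q == q'] = false by lia.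
    by rewrite !mulr0 !addr0 oppr0.
  rewrite inv_sys_box //; try lia.
  case: ifPn => hv /=.
    have -> : [&& u' == a1 - 1, v' == v - a2 + i, p' == p & q' == q]%N = false by lia.
    by have -> : [&& (u == u') && (v == v'), p == p' & q == q'] = false by lia.
  have -> : [&& (u == u') && (v == v'), p == p' & q == q'] =
    [&& u' == u, v' == v, p' == p & q' == q] by lia.
  by case: ifP.
have e1 : (1 : R[i]) != 0 by exact: oner_neq0.
move=> {}k m; rewrite (mk4_eta uw allw m) (mdeg_mk4 uw allw).
move: (m x1) (m x2) (m y) (m z) => al be p q {m} mk.
have [h1|h1] := leqP a1 al.
  by rewrite -(subnK h1); apply: span_eqn1 => //; apply: span_deg => //; lia.
have [/andP[/eqP h2 h3]|h2] := boolP ((al == a1 - 1) && (i <= be))%N.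
  rewrite -(subnK h3) h2 -[(a1 - 1)%N]add0n.
  by apply: span_eqn2' => //; apply: span_deg => //; lia.
(* g3 = x1 f2 - x2^i f1 *)
have [/andP[h3 h4]|h3] := boolP ((0 < al) && (a2 <= be))%N.
  rewrite -(subnK h4); apply: span_eqn2 => // [||_]; try by apply: span_deg => //; lia.
  rewrite (_ : al + (a1 - 1) = al - 1 + a1)%N; last lia.
  by apply: span_eqn1 => //; apply: span_deg => //; lia.
(* x2^(a2-i) f2 - x1^(a1-2) g3 *)
have [/andP[/eqP h4 h5]|h4] := boolP ((al == 0) && (2 * a2 - i <= be))%N.
  have -> : be = (be - (2 * a2 - i) + (a2 - i) + a2)%N by lia.
  rewrite h4; apply: span_eqn2 => // [||_]; try by apply: span_deg => //; lia.
  rewrite (_ : be - (2 * a2 - i) + (a2 - i) + i = be - (2 * a2 - i) + a2)%N; last lia.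
  apply: span_eqn2 => // [||_]; try by apply: span_deg => //; lia.
  rewrite (_ : 0 + (a1 - 1) + (a1 - 1) = a1 - 2 + a1)%N; last lia.
  by apply: span_eqn1 => //; apply: span_deg => //; lia.
apply: (spanned_std uw _ _ _ _ _ _ _ (uniq_std_hook _)) => //.
apply/(mem_std_monos uw allw).
rewrite mem_std_hook // !(mk4E uw) (mdeg_mk4 uw allw); split=> //=; lia.
Qed.

End Dimensions.

(** * The generating series of the standard monomials *)

Section HilbertSeries.

Lemma mindex_unit (m : mindex unit) : m = mconst unit (m tt).
Proof. by apply/ffunP => -[]; rewrite ffunE. Qed.

Lemma Zt_ext (f g : Zt) : (forall k, f (mconst unit k) = g (mconst unit k)) -> f = g.
Proof. by move=> fg; apply/funext => m; rewrite (mindex_unit m). Qed.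

Lemma coef_mul_tX (g : Zt) d k :
  (g * 't ^+ d) (mconst unit k) = if (d <= k)%N then g (mconst unit (k - d)) else 0.
Proof.
rewrite fps_varX fps_mul_mono.
have -> : [forall w, (mvar tt d w <= mconst unit k w)%N] = (d <= k)%N.
  by apply/forallP/idP => [/(_ tt)|dk []]; rewrite !ffunE eqxx.
by case: ifP => // _; congr (g _); apply/ffunP => -[]; rewrite !ffunE eqxx.
Qed.

(** The series 1/(1-t) and, next, 1/(1-t)^2, which counts the monomials in y and z. *)
Definition geo : Zt := fun=> 1.
Definition geo2 : Zt := fun m => (m tt).+1%:Z.

Lemma geoE : geo * (1 - 't) = 1.
Proof.
apply: Zt_ext => k; rewrite mulrBr mulr1 fpsDE fpsNE -['t]expr1 coef_mul_tX -mono0.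
rewrite /geo /fps_mono; case: k => [|k] /=; first by rewrite subr0 eqxx.
rewrite subrr; case: eqP => // /ffunP/(_ tt); rewrite !ffunE; lia.
Qed.

Lemma geo2E : geo2 * (1 - 't) = geo.
Proof.
apply: Zt_ext => k; rewrite mulrBr mulr1 fpsDE fpsNE -['t]expr1 coef_mul_tX.
by rewrite /geo /geo2 !ffunE; case: k => [|k] //=; rewrite subn1 /=; lia.
Qed.

Lemma unit_1Bt : (1 - 't : Zt) \is a GRing.unit.
Proof. by apply/unitrP; exists geo; split; rewrite 1?[_ * geo]mulrC geoE. Qed.

Lemma inv_1Bt2 : ((1 - 't) ^+ 2)^-1 = geo2 :> Zt.
Proof.
apply: (mulIr (unitrX 2 unit_1Bt)); rewrite mulVr ?unitrX ?unit_1Bt //.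
by rewrite expr2 mulrA geo2E geoE.
Qed.

Lemma sub_tX (n : nat) : 1 - 't ^+ n = (1 - 't) * \sum_(j <- iota 0 n) 't ^+ j :> Zt.
Proof.
rewrite -[iota 0 n]/(index_iota 0 0 ++ iota 0 n) /= -{2}(subn0 n) -/(index_iota 0 n) big_mkord.
by rewrite -opprB subrX1 -mulNr opprB.
Qed.

Definition mono_series (Nx : seq (nat * nat)) : Zt :=
  \sum_(n <- Nx) 't ^+ (n.1 + n.2).

Lemma coef_mono_series Nx k : (geo2 * mono_series Nx) (mconst unit k) =
  (\sum_(n <- Nx | n.1 + n.2 <= k) (k - (n.1 + n.2)).+1)%N%:Z.
Proof.
rewrite /mono_series mulr_sumr fps_sumE -[RHS]natz natr_sum [RHS]big_mkcond.
apply: eq_bigr => n _; rewrite coef_mul_tX; case: ifP => // _.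
by rewrite /geo2 ffunE natz.
Qed.

Lemma mono_series_box a1 a2 :
  (1 - 't ^+ a1) * (1 - 't ^+ a2) / (1 - 't) ^+ 4 = geo2 * mono_series (std_box a1 a2).
Proof.
have -> : mono_series (std_box a1 a2) =
    (\sum_(j <- iota 0 a1) 't ^+ j) * (\sum_(j <- iota 0 a2) 't ^+ j).
  rewrite /mono_series big_allpairs big_distrl /=; apply: eq_bigr => al _.
  by rewrite mulr_sumr; apply: eq_bigr => be _; rewrite exprD.
rewrite !sub_tX (_ : 4 = 2 + 2)%N // exprD invrM ?unitrX ?unit_1Bt // inv_1Bt2.
set A := \sum_(_ <- _) _; set B := \sum_(_ <- _) _.
have -> : (1 - 't) * A * ((1 - 't) * B) * (geo2 * geo2) =
   (geo2 * (1 - 't) * (1 - 't)) * (geo2 * (A * B)) by ring.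
by rewrite geo2E geoE mul1r.
Qed.

(** The three summands are the three lists of [std_hook]: 0 < al < a1 - 1, al = 0 and al = a1 -
    1. *)
Lemma mono_series_hook a1 a2 i : (2 <= a1)%N ->
  1 / (1 - 't) ^+ 2
    * (('t - 't ^+ (a1 - 1)) / (1 - 't) * ((1 - 't ^+ a2) / (1 - 't))
       + (1 - 't ^+ (2 * a2 - i)) / (1 - 't)
       + 't ^+ (a1 - 1) * ((1 - 't ^+ i) / (1 - 't)))
  = geo2 * mono_series (std_hook a1 a2 i).
Proof.
move=> a1_ge2; rewrite mul1r inv_1Bt2; congr (_ * _).
have D (n : nat) : (1 - 't ^+ n) / (1 - 't) = \sum_(j <- iota 0 n) 't ^+ j :> Zt.
  by rewrite sub_tX mulrC mulKr ?unit_1Bt.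
have -> : 't - 't ^+ (a1 - 1) = 't * (1 - 't ^+ (a1 - 2)) :> Zt.
  by rewrite mulrBr mulr1 -exprS; congr (_ - 't ^+ _); lia.
rewrite -['t * _ / _]mulrA !D /mono_series /std_hook !big_cat /= big_allpairs !big_map addrA.
congr (_ + _ + _).
- rewrite ['t * _]mulr_sumr mulr_suml -[1%N]addn0 iotaDl big_map; apply: eq_bigr => al _.
  rewrite mulr_sumr; apply: eq_bigr => be _ /=.
  by rewrite -exprS -exprD.
- by rewrite mulr_sumr; apply: eq_bigr => be _; rewrite exprD.
Qed.

End HilbertSeries.

(** * Star-shaped graphs *)

(* [V i j] is the vertex at distance [j.+1] from the centre on the [i]-th of
   [k] legs, the [i]-th leg having [n i] vertices, end vertex included. *)
Definition star_coords (G : wgraph) (o : G) (k : nat) (n : nat -> nat)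
    (V : nat -> nat -> G) : Prop :=
  [/\ forall i, (i < k)%N -> (0 < n i)%N,
      forall u, u = o \/ exists i j, [/\ (i < k)%N, (j < n i)%N & u = V i j],
      forall i j, (i < k)%N -> (j < n i)%N -> V i j != o,
      forall i j i' j', (i < k)%N -> (j < n i)%N -> (i' < k)%N -> (j' < n i')%N ->
        V i j = V i' j' -> i = i' /\ j = j'
    & [/\ symmetric (@adj G), adj o o = false,
          forall i j, (i < k)%N -> (j < n i)%N -> adj o (V i j) = (j == 0)%N
        & forall i j i' j', (i < k)%N -> (j < n i)%N -> (i' < k)%N -> (j' < n i')%N ->
            adj (V i j) (V i' j') = (i == i') && ((j' == j.+1) || (j == j'.+1))]].

Section Coordinates.
Variables (G : wgraph) (o : G) (k : nat) (n : nat -> nat) (V : nat -> nat -> G).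
Hypothesis SC : star_coords o k n V.

Definition leg (i : nat) : seq G := [seq V i j | j <- iota 0 (n i)].

Lemma mem_leg i u : reflect (exists2 j, (j < n i)%N & u = V i j) (u \in leg i).
Proof.
apply: (iffP mapP) => [[j]|[j jn ->]]; first by rewrite mem_iota => jn ->; exists j.
by exists j; rewrite // mem_iota.
Qed.

Lemma coord_ind (P : G -> Prop) : P o ->
  (forall i j, (i < k)%N -> (j < n i)%N -> P (V i j)) -> forall u, P u.
Proof. by case: SC => _ + _ _ _ => cov Po PV u; case: (cov u) => [->|[i [j [? ? ->]]]]; auto. Qed.

Definition coord (u : G) : nat * nat :=
  xget (0, 0)%N [set p | [/\ (p.1 < k)%N, (p.2 < n p.1)%N & V p.1 p.2 = u]].

Lemma coordK i j : (i < k)%N -> (j < n i)%N -> coord (V i j) = (i, j).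
Proof.
case: SC => _ _ _ inj _ ik jn; rewrite /coord; case: xgetP => [[i' j'] _ /= [h1 h2 h3]|].
  by case: (inj _ _ _ _ h1 h2 ik jn h3) => -> ->.
by move/(_ (i, j)) => [].
Qed.

(** Serves for integer vectors on the graph as well as, with vertices as values, for maps between
    two stars. *)
Definition star_vec (T : Type) (t : T) (f : nat -> nat -> T) (u : G) : T :=
  if u == o then t else f (coord u).1 (coord u).2.

Lemma star_vec_o T (t : T) f : star_vec t f o = t.
Proof. by rewrite /star_vec eqxx. Qed.

Lemma star_vecV T (t : T) f i j : (i < k)%N -> (j < n i)%N -> star_vec t f (V i j) = f i j.
Proof.
case: (SC) => _ _ Vo _ _ ik jn.
by rewrite /star_vec (negPf (Vo _ _ ik jn)) coordK.
Qed.

Lemma perm_coords :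
  perm_eq (index_enum G) (o :: [seq V i j | i <- iota 0 k, j <- iota 0 (n i)]).
Proof.
case: SC => n0 cov Vo inj _; apply: uniq_perm; first exact: index_enum_uniq.
  rewrite /=; apply/andP; split.
    apply/allpairsPdep => -[i [j [/=]]]; rewrite !mem_iota => h1 h2 h3.
    by have := Vo i j h1 h2; rewrite -h3 eqxx.
  apply: allpairs_uniq_dep; rewrite ?iota_uniq //.
    by move=> i _; exact: iota_uniq.
  move=> _ _ /allpairsPdep[i [j [+ + ->]]] /allpairsPdep[i' [j' [+ + ->]]] /=.
  rewrite !mem_iota /= => h1 h2 h3 h4 e.
  by have [] := inj _ _ _ _ h1 h2 h3 h4 e => e1 e2; subst.
move=> u; rewrite mem_index_enum inE; case: (cov u) => [->|[i [j [ik jn ->]]]].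
  by rewrite eqxx.
by apply/esym/orP; right; apply/allpairsPdep; exists i, j; rewrite !mem_iota.
Qed.

Lemma sum_coords (T : nmodType) (F : G -> T) :
  \sum_(u : G) F u = F o + \sum_(0 <= i < k) \sum_(0 <= j < n i) F (V i j).
Proof.
rewrite (perm_big _ perm_coords) big_cons big_allpairs_dep /index_iota subn0.
by congr (_ + _); apply: eq_bigr => i _; rewrite subn0.
Qed.

Definition parent (i j : nat) : G := if j is j'.+1 then V i j' else o.

Lemma sum_adj_o (T : nmodType) (F : G -> T) :
  \sum_(v | adj o v) F v = \sum_(0 <= i < k) F (V i 0).
Proof.
case: SC => n0 _ _ _ [_ oo oV _].
rewrite big_mkcond sum_coords oo add0r; apply: eq_big_nat => i /andP[_ ik].
have := n0 i ik; case En : (n i) => [//|m] _.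
rewrite big_nat_recl // oV ?En // eqxx big_nat big1 ?addr0 // => j jm.
by rewrite oV // En.
Qed.

Lemma sum_adjV (T : nmodType) (F : G -> T) i j : (i < k)%N -> (j < n i)%N ->
  \sum_(v | adj (V i j) v) F v =
  F (parent i j) + (if (j.+1 < n i)%N then F (V i j.+1) else 0).
Proof.
case: SC => n0 _ _ _ [sym oo oV VV] ik jn.
have pick m (f : nat -> T) l : \sum_(0 <= x < l) (if x == m then f x else 0) =
    if (m < l)%N then f m else 0.
  by rewrite -big_mkcond big_nat1_eq.
have Es i' : (i' < k)%N ->
    \sum_(0 <= j' < n i') (if adj (V i j) (V i' j') then F (V i' j') else 0) =
    if i' == i then \sum_(0 <= j' < n i)
      ((if j' == j.+1 then F (V i j') else 0) + (if j'.+1 == j then F (V i j') else 0)) else 0.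
  move=> i'k; case: eqP => [->|/eqP ne].
    apply: eq_big_nat => j' /andP[_ h]; rewrite VV // eqxx /=.
    have [->|] := eqVneq j' j.+1; first by rewrite (_ : (_ == j) = false) ?addr0 //; lia.
    by rewrite add0r [j == _]eq_sym.
  by rewrite big_nat big1 // => j' /andP[_ h]; rewrite VV // eq_sym (negPf ne).
rewrite big_mkcond sum_coords sym oV //.
under eq_big_nat => i' /andP[_ h] do rewrite Es //.
rewrite (pick i (fun i' => \sum_(0 <= j' < n i) _)) ik big_split (pick j.+1) /=.
rewrite addrCA [RHS]addrC; congr (_ + _); case: j jn {Es} => [|j] jn.
  by rewrite eqxx big1 ?addr0.
rewrite /= add0r; under eq_bigr => j' _ do rewrite eqSS.
by rewrite pick ltnW.
Qed.

Lemma degree_sum (u : G) : degree u = (\sum_(v | adj u v) 1)%N.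
Proof.
rewrite /degree -sum1_card; apply: eq_bigl => v.
by apply/idP/idP => [/set_mem|h]; last exact: mem_set.
Qed.

Lemma degree_o : degree o = k.
Proof. by rewrite degree_sum (sum_adj_o (fun=> 1%N)) sum_nat_const_nat subn0 muln1. Qed.

Lemma degreeV i j : (i < k)%N -> (j < n i)%N ->
  degree (V i j) = (if (j.+1 < n i)%N then 2 else 1)%N.
Proof. by move=> ik jn; rewrite degree_sum (sum_adjV (fun=> 1%N)) //; case: ifP. Qed.

Lemma curveV i j : (i < k)%N -> (j < n i)%N -> curve (V i j) = (j.+1 < n i)%N.
Proof. by move=> ik jn; rewrite /curve degreeV //; case: ifP. Qed.

Lemma curve_o : (1 < k)%N -> curve o.
Proof. by rewrite /curve degree_o. Qed.

Lemma node_coords (u : G) : (2 < k)%N -> node u = (u == o).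
Proof.
move=> k2; move: u; apply: coord_ind => [|i j ik jn]; first by rewrite /node degree_o k2 eqxx.
case: SC => _ _ Vo _ _; rewrite (negPf (Vo _ _ ik jn)) /node degreeV //.
by case: ifP.
Qed.

Lemma end_coords (u : G) : (1 < k)%N -> degree u = 1%N -> exists2 i, (i < k)%N & u = V i (n i).-1.
Proof.
move=> k1; move: u; apply: coord_ind => [|i j ik jn].
  by rewrite degree_o => e; rewrite e in k1.
rewrite degreeV //; case: ifP => // h _; exists i => //; congr V; lia.
Qed.

Lemma degree_end i : (i < k)%N -> degree (V i (n i).-1) = 1%N.
Proof.
move=> ik; case: SC => n0 _ _ _ _; have := n0 i ik => h.
rewrite degreeV //; last lia.
by case: ifP => //; lia.
Qed.

Lemma adj_parent i j : (i < k)%N -> (j < n i)%N -> adj (V i j) (parent i j).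
Proof.
case: SC => _ _ _ _ [sym oo oV VV] ik; case: j => [|j] jn /=; first by rewrite sym oV.
by rewrite VV ?eqxx ?orbT // ltnW.
Qed.

Definition height (u : G) : nat := if u == o then 0 else (coord u).2.+1.

Lemma height_o : height o = 0%N. Proof. by rewrite /height eqxx. Qed.
Lemma heightV i j : (i < k)%N -> (j < n i)%N -> height (V i j) = j.+1.
Proof.
case: (SC) => _ _ Vo _ _ ik jn.
by rewrite /height (negPf (Vo _ _ ik jn)) coordK.
Qed.

Lemma adj_height (u v : G) : adj u v -> height u = (height v).+1 \/ height v = (height u).+1.
Proof.
case: (SC) => _ _ _ _ [sym oo oV VV].
move: u v; apply: coord_ind => [|i j ik jn]; apply: coord_ind => [|i' j' ik' jn'].
- by rewrite oo.
- by rewrite oV // height_o heightV // => /eqP ->; right.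
- by rewrite sym oV // height_o heightV // => /eqP ->; left.
by rewrite VV // !heightV // => /andP[_ /orP[] /eqP ->]; [right|left].
Qed.

Lemma adj_height_uniq (u v w : G) : adj u v -> adj u w -> (height v < height u)%N ->
  (height w < height u)%N -> v = w.
Proof.
case: (SC) => _ _ _ _ [sym oo oV VV].
move: u; apply: coord_ind => [|i j ik jn]; first by rewrite height_o.
have E x : adj (V i j) x -> (height x < j.+1)%N -> x = parent i j.
  move: x; apply: coord_ind => [|i' j' ik' jn'].
    by rewrite sym oV // => /eqP ->.
  rewrite VV // heightV // => /andP[/eqP <- h] h'.
  by have -> : j = j'.+1 by lia.
by rewrite heightV // => /E Ev /E Ew /Ev -> /Ew ->.
Qed.

(** Start the cycle at a vertex of maximal height. Its two neighbours on the cycle are lower, and a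
    vertex has only one lower neighbour, so they coincide, which a simple cycle of length at least 3
    forbids. *)
Lemma star_acyclic (c : seq G) : ucycle (@adj G) c -> (size c <= 2)%N.
Proof.
case: (SC) => _ _ _ _ [sym oo oV VV].
case: c => [//|x0 c0]; set c := x0 :: c0 => uc.
have x0c : x0 \in c by rewrite mem_head.
case: (@arg_maxnP _ x0 [pred x | x \in c] height x0c) => u /= uc' umax.
have [i c' Ec] := rot_to uc'.
have : ucycle (@adj G) (rot i c) by rewrite rot_ucycle.
have umax' x : x \in rot i c -> (height x <= height u)%N by rewrite mem_rot; exact: umax.
rewrite -[X in (X < 2)%N]/(size c).-1 -[(_ < _)%N]/(size c <= 2)%N -(size_rot i c) {}Ec in umax' *; case: c' umax' => [//|v [//|w s]] umax' /andP[+ un].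
rewrite /= => /andP[uv /andP[vw]]; rewrite rcons_path => /andP[_ lu].
have lt x : x \in [:: u, v, w & s] -> adj u x -> (height x < height u)%N.
  by move=> /umax' h /adj_height; lia.
have lastin : last w s \in [:: u, v, w & s] by rewrite 2!inE mem_last !orbT.
have vl : v = last w s.
  apply: (adj_height_uniq uv); rewrite 1?sym //; apply: lt => //.
    by rewrite !inE eqxx orbT.
  by rewrite sym.
by move: un => /= /and3P[_]; rewrite vl mem_last.
Qed.

Lemma path_leg i m : (i < k)%N -> (m <= n i)%N ->
  path (@adj G) o [seq V i j | j <- iota 0 m].
Proof.
case: (SC) => _ _ _ _ [sym oo oV VV] ik.
elim: m => // m IH mn; rewrite -addn1 iotaD map_cat cat_path IH /=; last exact: ltnW.
rewrite add0n andbT; case: m mn {IH} => [|m] mn /=; first by rewrite oV.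
rewrite (last_map (V i) (iota 1 m) 0%N) (last_nth 0%N) size_iota.
rewrite -[0%N :: iota 1 m]/(iota 0 m.+1) nth_iota // add0n.
by rewrite VV ?eqxx //; lia.
Qed.

Lemma star_connected (u v : G) : connect (@adj G) u v.
Proof.
case: (SC) => _ _ _ _ [sym oo oV VV].
suff H w : connect (@adj G) o w.
  by apply: connect_trans (H v); rewrite (sym_connect_sym sym).
move: w; apply: coord_ind => [|i j ik jn]; first exact: connect0.
elim: j jn => [|j IH] jn; first by rewrite connect1 // oV.
by apply: connect_trans (IH (ltnW jn)) _; rewrite connect1 // VV ?eqxx // ltnW.
Qed.

Lemma star_is_tree : is_tree G.
Proof.
case: (SC) => _ _ _ _ [sym oo oV VV].
split=> // [u|u v|c].
- by apply/negbTE/negP => /adj_height; lia.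
- exact: star_connected.
- exact: star_acyclic.
Qed.

Lemma branchE i j : (i < k)%N -> (j < n i)%N -> branch o (V i j) =i leg i.
Proof.
case: (SC) => n0 _ Vo _ [sym oo oV VV] ik jn w.
pose e := fun p q : G => [&& p != o, q != o & adj p q].
have syme : symmetric e by move=> p q; rewrite /e sym; lia.
have stay p u : (exists2 l, (l < n i)%N & u = V i l) -> path e u p ->
    exists2 l, (l < n i)%N & last u p = V i l.
  elim: p u => [//|x p IH] u [l ln ->] /= /andP[/and3P[_ xo]]; move: xo.
  move: x; apply: coord_ind => [|i' j' ik' jn']; first by rewrite eqxx.
  by rewrite VV // => _ /andP[/eqP e1 _]; apply: IH; exists j'; rewrite e1.
rewrite inE; apply/idP/mem_leg => [/connectP[p ep ->]|[j' jn' ->]].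
  by apply: stay ep; exists j.
have H l : (l < n i)%N -> connect e (V i 0) (V i l).
  elim: l => [|l IH] ln; first exact: connect0.
  apply: connect_trans (IH (ltnW ln)) _; apply: connect1.
  by rewrite /e !Vo ?VV ?eqxx // ltnW.
by apply: connect_trans (H _ jn'); rewrite (sym_connect_sym syme) H.
Qed.

Lemma branches_coords : branches o =i [seq branch o (V i 0) | i <- iota 0 k].
Proof.
case: (SC) => n0 _ Vo _ [sym oo oV VV] C.
apply/imsetP/mapP; last first.
  move=> [l]; rewrite mem_iota => /andP[_ ik] ->; exists (V l 0) => //.
  by rewrite inE oV // n0.
move=> [u]; rewrite inE; move: u; apply: coord_ind => [|i j ik jn]; first by rewrite oo.
by rewrite oV // => /eqP -> ->; exists i; rewrite ?mem_iota.
Qed.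

Lemma star_shaped_coords : star_shaped o.
Proof.
case: (SC) => n0 _ Vo inj _.
split=> [|C]; first exact: star_is_tree.
move=> CB; have : C \in [seq branch o (V i 0) | i <- iota 0 k] by rewrite -branches_coords.
move/mapP => [l]; rewrite mem_iota => /andP[_ ik] ->.
exists (leg l); split; first exact: path_leg.
  rewrite map_inj_in_uniq ?iota_uniq // => j j'; rewrite !mem_iota => h h' e.
  by case: (inj _ _ _ _ ik h ik h' e).
by apply: branchE => //; exact: n0.
Qed.

Lemma branch_inj i j i' j' : (i < k)%N -> (j < n i)%N -> (i' < k)%N -> (j' < n i')%N ->
  branch o (V i j) = branch o (V i' j') -> i = i'.
Proof.
case: (SC) => n0 _ Vo inj _ ik jn ik' jn' /setP/(_ (V i j)).
rewrite !branchE // => /esym; have -> : V i j \in leg i by apply/mem_leg; exists j.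
by move=> /mem_leg[l ln]; case/inj.
Qed.

End Coordinates.

(** * Coordinates on an abstract star-shaped tree *)

Section Components.
Variables (G : wgraph) (o : G).
Hypotheses (sym : symmetric (@adj G)) (irr : irreflexive (@adj G))
  (conn : forall u v, connect (@adj G) u v)
  (acyc : forall c : seq G, ucycle (@adj G) c -> (size c <= 2)%N).

Let e := fun p q : G => [&& p != o, q != o & adj p q].

Let syme : connect_sym e.
Proof. by apply: sym_connect_sym => p q; rewrite /e sym; lia. Qed.

Lemma mem_branch u w : (w \in branch o u) = connect e u w.
Proof. by rewrite inE. Qed.

Lemma branch_o u : u != o -> o \notin branch o u.
Proof.
rewrite mem_branch syme => uo; apply/connectP => -[[|x p] /= + eu].
  by rewrite eu eqxx in uo.
by rewrite /e eqxx.
Qed.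

Lemma branch_eq u w : w \in branch o u -> branch o w = branch o u.
Proof.
rewrite mem_branch => uw; apply/setP => v; rewrite !mem_branch.
by rewrite (same_connect syme uw).
Qed.

Lemma branch_adj u v w : v \in branch o u -> w != o -> adj v w -> u != o -> w \in branch o u.
Proof.
move=> vu wo vw uo; have vo : v != o.
  by apply/eqP => vo; move: vu (branch_o uo); rewrite vo => ->.
move: vu; rewrite !mem_branch => /connect_trans; apply; apply: connect1.
by rewrite /e vo wo vw.
Qed.

Lemma branch_cover u : u != o -> exists2 v, adj o v & u \in branch o v.
Proof.
move=> uo; have /connectP[p0 p0P] := conn o u.
case: (shortenP p0P) => p pP up _ eu; case: p pP up eu => [|v p] pP up eu.
  by rewrite eu eqxx in uo.
move: pP => /= /andP[ov vp]; exists v => //; rewrite mem_branch; apply/connectP.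
exists p => //; move: up => /=; rewrite inE negb_or => /andP[/andP[vo op] _].
elim: p v vp vo op {ov eu} => //= x p IH v /andP[vx xp] vo; rewrite inE negb_or => /andP[xo op].
by rewrite {1}/e eq_sym vo eq_sym xo vx IH.
Qed.

(** A simple path in a tree has no chords: a chord would close the segment [s] between its ends to a
    cycle of length at least 3. *)
Lemma adj_path p j l : path (@adj G) o p -> uniq (o :: p) ->
  (j < l)%N -> (l < (size p).+1)%N ->
  adj (nth o (o :: p) j) (nth o (o :: p) l) = (l == j.+1).
Proof.
move=> pp up jl lp; have so : sorted (@adj G) (o :: p) by [].
apply/idP/eqP => [jlA|lj]; last first.
  by rewrite lj in lp *; have /(sortedP o)/(_ j lp) := so.
apply/eqP; rewrite eqn_leq jl andbT leqNgt; apply/negP => lt.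
pose s := drop j (take l.+1 (o :: p)).
have ss : size s = (l.+1 - j)%N by rewrite size_drop size_takel.
have nthE i : (i < size s)%N -> nth o s i = nth o (o :: p) (j + i).
  by move=> si; rewrite nth_drop nth_take //; lia.
suff : (size s <= 2)%N by rewrite ss; lia.
apply: acyc; apply/andP; split; last by rewrite drop_uniq // take_uniq.
have : sorted (@adj G) s by apply: drop_sorted; apply: take_sorted.
have s0 := nthE 0%N; have sl := nthE (size s).-1.
have : (0 < size s)%N by rewrite ss; lia.
move: s0 sl; rewrite ss; case Es : s ss => [//|y s'] /= ss s0 sl _ ps.
rewrite rcons_path ps /=.
have -> : last y s' = nth o (o :: p) l.
  rewrite (last_nth o) (_ : size s' = (l.+1 - j).-1); last by rewrite -ss.
  by rewrite sl; [congr nth; lia|lia].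
rewrite s0; [by rewrite addn0 sym|lia].
Qed.

(** The paths provided by [star_shaped] are the legs. Adjacency within a leg is known as there are
    no chords, and vertices of different legs are not adjacent as the legs are different
    components. *)
Lemma tree_star_coords (ws : seq (end_vertex G)) : (1 < size ws)%N ->
  star_shaped o ->
  uniq [seq branch o (val w) | w <- ws] ->
  branches o =i [seq branch o (val w) | w <- ws] ->
  exists n V, star_coords o (size ws) n V /\
    forall i, (i < size ws)%N -> nth o [seq val w | w <- ws] i = V i (n i).-1.
Proof.
move=> k1 [_ sh] uC br; pose C l := nth finset.set0 [seq branch o (val w) | w <- ws] l.
pose W l := nth o [seq val w | w <- ws] l.
have [w0 _] : exists w : end_vertex G, w \in ws.
  by case: (ws) k1 => // w s _; exists w; rewrite mem_head.
have WE l : (l < size ws)%N -> W l = val (nth w0 ws l) by move=> lk; rewrite /W (nth_map w0).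
have CW l : (l < size ws)%N -> C l = branch o (W l).
  by move=> lk; rewrite WE // /C (nth_map w0).
have Cbr l : (l < size ws)%N -> exists2 v, adj o v & C l = branch o v.
  move=> lk; have : C l \in branches o by rewrite br mem_nth ?size_map.
  by case/imsetP => v; rewrite inE => ov ->; exists v.
have adjo v : adj o v -> v != o by move=> ov; apply/eqP => vo; rewrite vo irr in ov.
have Co l : (l < size ws)%N -> o \notin C l.
  by move=> /Cbr[v /adjo vo ->]; exact: branch_o.
have Cmem l u : (l < size ws)%N -> u \in C l -> C l = branch o u.
  by move=> /Cbr[v ov ->] /branch_eq ->.
have Cinj l l' u : (l < size ws)%N -> (l' < size ws)%N -> u \in C l -> u \in C l' -> l = l'.
  move=> lk l'k ul ul'; apply/eqP; rewrite -(nth_uniq finset.set0 _ _ uC) ?size_map //.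
  by rewrite -/(C l) -/(C l') (Cmem _ _ lk ul) (Cmem _ _ l'k ul').
have /choice[p pP] : forall l, exists p : seq G, (l < size ws)%N ->
    [/\ path (@adj G) o p, uniq p & C l =i p].
  move=> l; case: (ltnP l (size ws)) => [lk|]; last by exists [::].
  have [|p ?] := sh (C l); last by exists p.
  by rewrite br mem_nth ?size_map.
have memV l j : (l < size ws)%N -> (j < size (p l))%N -> nth o (p l) j \in C l.
  by move=> lk jn; case: (pP l lk) => _ _ ->; rewrite mem_nth.
have SC : star_coords o (size ws) (fun l => size (p l)) (fun l j => nth o (p l) j).
  have uop l : (l < size ws)%N -> uniq (o :: p l).
    move=> lk; case: (pP l lk) => _ ul Cp /=; rewrite ul andbT.
    by rewrite -Cp Co.
  split.
  - move=> l lk; case: (pP l lk) => _ _ Cp; have : W l \in p l.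
      by rewrite -Cp CW // mem_branch connect0.
    by case: (p l).
  - move=> u; have [->|uo] := eqVneq u o; [by left|right].
    have [v ov uv] := branch_cover uo.
    have : branch o v \in branches o by apply: imset_f; rewrite inE.
    rewrite br => /(nthP finset.set0)[l]; rewrite size_map => lk Cv; exists l.
    have up : u \in p l by case: (pP l lk) => _ _ <-; rewrite /C Cv.
    by exists (index u (p l)); rewrite lk index_mem nth_index.
  - move=> l j lk jn; apply/eqP => e'; have := memV l j lk jn.
    by rewrite e' (negPf (Co l lk)).
  - move=> l j l' j' lk jn l'k j'n e'.
    have ll' : l = l' by apply: (Cinj _ _ (nth o (p l) j)) => //; [exact: memV|rewrite e' memV].
    split=> //; subst l'; case: (pP l lk) => _ ul _.
    by apply/eqP; rewrite -(nth_uniq o _ _ ul) // e'.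
  - split=> //.
      move=> l j lk jn; case: (pP l lk) => pl _ _.
      by rewrite -[LHS]/(adj (nth o (o :: p l) 0) (nth o (o :: p l) j.+1)) adj_path ?uop.
    move=> l j l' j' lk jn l'k j'n.
    have [ll'|ll'] := eqVneq l l'; last first.
      apply/negbTE/negP => A; move/eqP: ll'; apply.
      apply: (Cinj _ _ (nth o (p l') j')) => //; last exact: memV.
      have [v ov Cv] := Cbr l lk; rewrite Cv; apply: branch_adj A _; last exact: adjo.
        by rewrite -Cv memV.
      by apply/eqP => e'; have := memV l' j' l'k j'n; rewrite e' (negPf (Co l' l'k)).
    subst l'; case: (pP l lk) => pl _ _.
    have nE x : nth o (p l) x = nth o (o :: p l) x.+1 by [].
    rewrite !nE; case: (ltngtP j j') => [jj'|jj'|->].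
    - by rewrite adj_path ?uop //; lia.
    - by rewrite sym adj_path ?uop //; lia.
    - by rewrite irr; lia.
exists (fun l => size (p l)), (fun l j => nth o (p l) j); split=> // l lk.
have : W l \in p l by case: (pP l lk) => _ _ <-; rewrite CW // mem_branch connect0.
move=> /(nthP o)[j jn Wj]; rewrite -/(W l) -Wj; congr nth.
(* The given end vertex has degree 1, and on a leg only the last vertex has that degree. *)
have := degreeV SC lk jn; rewrite Wj.
have -> : degree (W l) = 1%N.
  by rewrite WE //; exact/eqP/(valP (nth w0 ws l)).
by case: ifPn => /= h; [|move=> _; move: h jn => /=; lia].
Qed.

End Components.

(** * Determinants and continued fractions *)

Section ListDeterminant.
Variables (K : comUnitRingType) (T : eqType).
Implicit Types (M : T -> T -> K) (s t : seq T).

(** Indexing by a list makes the determinant independent of enumerations of vertex sets and lets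
    blocks be split off by concatenation. *)
Definition seq_det M s : K :=
  \det (\matrix_(i < size s, j < size s) M (tnth (in_tuple s) i) (tnth (in_tuple s) j)).

Lemma seq_detE M (x0 : T) s m (f : nat -> T) : m = size s ->
  (forall l, (l < m)%N -> f l = nth x0 s l) ->
  \det (\matrix_(i < m, j < m) M (f i) (f j)) = seq_det M s.
Proof.
move=> em fE; rewrite {}em in fE *; rewrite /seq_det; congr determinant.
by apply/matrixP => l r; rewrite !mxE !(tnth_nth x0) !fE.
Qed.

Lemma seq_det_perm M s t : perm_eq s t -> seq_det M s = seq_det M t.
Proof.
move=> st; have /tuple_permP[p sE] : perm_eq s (in_tuple t) by [].
have e := perm_size st.
pose A : 'M[K]_(size t) :=
  \matrix_(i, j) M (tnth (in_tuple t) i) (tnth (in_tuple t) j).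
transitivity (\det (row_perm p (col_perm p A))); last first.
  by rewrite row_permE col_permE !det_mulmx !det_perm odd_permV [_ * (-1) ^+ _]mulrC signrMK.
case: t => [|x0 t] in st p sE e A *.
  by case: s st sE e => // _ _ _; rewrite /seq_det !det_mx00.
rewrite -(@seq_detE M x0 s _ (fun l => nth x0 s l) (esym e)) //.
congr determinant; apply/matrixP => l r; rewrite !mxE !(tnth_nth x0) /=.
have nE (a : 'I_(size (x0 :: t))) : nth x0 s a = tnth (in_tuple (x0 :: t)) (p a).
  by rewrite sE /= (nth_map a) ?size_enum_ord // nth_ord_enum.
by rewrite !nE !(tnth_nth x0).
Qed.

Lemma seq_det_nil M : seq_det M [::] = 1.
Proof. exact: det_mx00. Qed.

Lemma seq_det_cat M s t : (forall a b, a \in s -> b \in t -> M b a = 0) ->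
  seq_det M (s ++ t) = seq_det M s * seq_det M t.
Proof.
move=> M0; case E : (s ++ t) => [|x0 r].
  by case: s t E {M0} => // -[] // _; rewrite seq_det_nil mulr1.
rewrite -{r}E; pose f l := nth x0 (s ++ t) l.
have fs l : (l < size s)%N -> f l = nth x0 s l by move=> h; rewrite /f nth_cat h.
have ft l : f (size s + l)%N = nth x0 t l.
  by rewrite /f nth_cat ltnNge leq_addr /= addKn.
rewrite -(@seq_detE M x0 (s ++ t) _ f (esym (size_cat s t))) //.
rewrite -[X in \det X]submxK.
rewrite [dlsubmx _](_ : _ = 0); last first.
  apply/matrixP => l r; rewrite !mxE /= M0 // ?ft ?fs //; exact: mem_nth.
rewrite det_ublock; congr (_ * _).
  rewrite -(@seq_detE M x0 s _ f erefl) //; congr determinant.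
  by apply/matrixP => l r; rewrite !mxE.
rewrite -(@seq_detE M x0 t _ (fun l => f (size s + l)%N) erefl) //; congr determinant.
by apply/matrixP => l r; rewrite !mxE.
Qed.

Lemma seq_det_flatten M (ss : seq (seq T)) :
  pairwise (fun s t => all (fun a => all (fun b => M b a == 0) t) s) ss ->
  seq_det M (flatten ss) = \prod_(s <- ss) seq_det M s.
Proof.
elim: ss => [|s ss IH] /=; first by rewrite seq_det_nil big_nil.
move=> /andP[/allP sss /IH {}IH]; rewrite big_cons seq_det_cat ?IH // => a b as_.
move=> /flattenP[t tss bt]; have /allP/(_ a as_)/allP/(_ b bt)/eqP := sss t tss.
by [].
Qed.

(* Replacing the first column of the matrix by its image of [x], as in the proof
   of Cramer's rule. *)
Lemma seq_det_pivot M v s (x : T -> K) D : uniq (v :: s) ->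
  (forall w, w \in v :: s -> \sum_(u <- v :: s) M w u * x u = if w == v then D else 0) ->
  x v * seq_det M (v :: s) = D * seq_det M s.
Proof.
move=> us Mx; pose f l := nth v (v :: s) l.
have E : seq_det M (v :: s) = \det (\matrix_(i < 1 + size s, j < 1 + size s) M (f i) (f j)).
  by rewrite -(@seq_detE M v (v :: s) _ f erefl).
rewrite {}E; set A := \matrix_(_, _) _.
pose X : 'M[K]_(1 + size s) := block_mx (x v)%:M 0 (\col_i x (f i.+1)) 1%:M.
have detX : \det X = x v by rewrite det_lblock det1 mulr1 det_scalar expr1.
rewrite mulrC -{1}detX -det_mulmx -[A]submxK /X mulmx_block !mulmx0 !mulmx1 !add0r.
have ltl (l : 'I_(1 + size s)) : (l < size (v :: s))%N by exact: ltn_ord.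
have row0 (l : 'I_(1 + size s)) : \sum_(j < 1 + size s) A l j * x (f j) =
    if val l == 0%N then D else 0.
  have <- : (f l == v) = (val l == 0%N).
    by rewrite /f -[X in _ == X]/(nth v (v :: s) 0) (nth_uniq v (ltl l) _ us).
  rewrite -(Mx (f l) (mem_nth v (ltl l))) (big_nth v) big_mkord.
  by apply: eq_bigr => j _; rewrite mxE.
have sumE (l : 'I_(1 + size s)) : \sum_(j < 1 + size s) A l j * x (f j) =
    A l (lshift _ ord0) * x v + \sum_(j < size s) A l (rshift 1 j) * x (f j.+1).
  by rewrite big_split_ord big_ord1.
rewrite [ulsubmx A *m _ + _](_ : _ = D%:M); last first.
  apply/matrixP => l r; rewrite !ord1 !mxE big_ord_recl big_ord0 addr0 !mxE eqxx !mulr1n.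
  have := row0 (lshift _ ord0); rewrite sumE /= => <-.
  congr (_ + _); first by rewrite !mxE.
  by apply: eq_bigr => j _; rewrite !mxE.
rewrite [dlsubmx A *m _ + _](_ : _ = 0); last first.
  apply/matrixP => l r; rewrite !ord1 !mxE big_ord_recl big_ord0 addr0 !mxE eqxx !mulr1n.
  have := row0 (rshift 1 l); rewrite sumE /= => H; rewrite -[RHS]H.
  congr (_ + _); first by rewrite !mxE.
  by apply: eq_bigr => j _; rewrite !mxE.
rewrite det_ublock det_scalar expr1; congr (_ * _).
rewrite -(@seq_detE M v s _ (fun l => f l.+1) erefl) //; congr determinant.
by apply/matrixP => l r; rewrite !mxE.
Qed.

End ListDeterminant.

(* [hj [:: c1; ..; cr] = (a, w)] when a / w is the Hirzebruch-Jung continued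
   fraction c1 - 1 / (c2 - ..), in lowest terms; [hj [::] = (1, 0)]. *)
Fixpoint hj (c : seq int) : int * int :=
  if c is x :: s then (x * (hj s).1 - (hj s).2, (hj s).1) else (1, 0).

Lemma hj_bounds c : all (fun x => 2 <= x) c -> 0 <= (hj c).2 < (hj c).1.
Proof.
elim: c => //= x s IH /andP[x2 /IH /andP[h1 h2]]; nia.
Qed.

Lemma hj_gt0 c : all (fun x => 2 <= x) c -> 0 < (hj c).1.
Proof. by move=> /hj_bounds/andP[]; exact: le_lt_trans. Qed.

(** By [hj_bounds] the first entry is a / w rounded up, so it is determined, and with it the pair of
    the tail. *)
Lemma hj_inj c c' : all (fun x => 2 <= x) c -> all (fun x => 2 <= x) c' ->
  hj c = hj c' -> c = c'.
Proof.
elim: c c' => [|x s IH] [|x' s'] //=.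
- by move=> _ /andP[_ /hj_gt0 h] [_ h']; rewrite -h' ltxx in h.
- by move=> /andP[_ /hj_gt0 h] _ [_ h']; rewrite h' ltxx in h.
move=> /andP[x2 s2] /andP[x2' s2'] [e1 e2].
have /andP[h1 h2] := hj_bounds s2; have /andP[h1' h2'] := hj_bounds s2'.
have ex : x = x' by nia.
congr (_ :: _) => //; apply: IH => //; rewrite [hj s]surjective_pairing [hj s']surjective_pairing.
by rewrite e2; congr (_, _); rewrite ex e2 in e1; lia.
Qed.

Lemma hj_surj (a w : nat) : (w < a)%N -> coprime a w ->
  exists2 c, all (fun x => 2 <= x) c & hj c = (a%:Z, w%:Z).
Proof.
elim/ltn_ind: a w => a IH [|w] wa.
  by rewrite /coprime gcdn0 => /eqP ->; exists [::].
move=> cop; have := divn_eq a w.+1; have := ltn_pmod a (ltn0Sn w).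
(* [q] is a / (w + 1) rounded up. Then a = q (w + 1) - v with 0 <= v < w + 1, and the induction
   continues with the pair (w + 1, v). *)
move: (a %/ w.+1)%N (a %% w.+1)%N => d r rw ad; pose q := (d + (r != 0))%N.
have q2 : (2 <= q)%N by rewrite /q; case: (d) ad => [|[|d']]; case: eqP => //= r0; rewrite ?r0; lia.
pose v := (q * w.+1 - a)%N.
have vE : (a + v = q * w.+1)%N by rewrite /v /q ad; case: eqP => /= [->|_]; nia.
have vw : (v < w.+1)%N by rewrite /v /q ad; case: eqP => /= [->|/eqP r0]; nia.
have copv : coprime w.+1 v.
  rewrite /coprime -dvdn1 -[X in (_ %| X)%N](eqP cop) dvdn_gcd dvdn_gcdl andbT.
  by rewrite -(dvdn_addl a (dvdn_gcdr w.+1 v)) vE dvdn_mull ?dvdn_gcdl.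
have [c c2 hc] := IH w.+1 wa v vw copv.
exists (q%:Z :: c); rewrite /= ?c2 ?andbT // hc /=.
by congr (_, _); rewrite -PoszM -vE PoszD addrK.
Qed.

Lemma sum_tridiag (m j : nat) (a : int) (F : nat -> int) : (j < m)%N ->
  \sum_(0 <= l < m) (if j == l then a else if (l == j.+1) || (j == l.+1) then -1 else 0) * F l
  = a * F j - (if (j.+1 < m)%N then F j.+1 else 0) - (if (0 < j)%N then F j.-1 else 0).
Proof.
move=> jm.
have pick p (f : nat -> int) : \sum_(0 <= x < m) (if x == p then f x else 0) =
    if (p < m)%N then f p else 0.
  by rewrite -big_mkcond big_nat1_eq.
rewrite (eq_bigr (fun l => (if l == j then a * F l else 0) +
    ((if l == j.+1 then - F l else 0) + (if l == j.-1 then if (0 < j)%N then - F l else 0 else 0)))).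
  by rewrite !big_split /= !pick jm; do !case: ifP => //=; lia.
by move=> l _; do !case: ifP => ?; lia.
Qed.

(** The numerators [y l] of the tails satisfy the three-term recursion, so the vector with entries y
    1, y 2, .. is mapped to (y 0, 0, ..). Pivoting on it gives y 1 det = y 0 y 1. *)
Lemma seq_det_chain (T : eqType) (M : T -> T -> int) (x0 : T) (s : seq T) (c : seq int) :
  uniq s -> size s = size c -> all (fun x => 2 <= x) c ->
  (forall j l, (j < size s)%N -> (l < size s)%N -> M (nth x0 s j) (nth x0 s l) =
     if j == l then nth 0 c j else if (l == j.+1) || (j == l.+1) then -1 else 0) ->
  seq_det M s = (hj c).1.
Proof.
elim: s c => [|v s IH] c us; first by case: c => // _ _ _; rewrite seq_det_nil.
move=> sc c2 ME; pose y l := (hj (drop l c)).1.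
have yS j : (j < size c)%N -> y j = nth 0 c j * y j.+1 - (hj (drop j.+1 c)).2.
  by move=> jc; rewrite /y (drop_nth 0 jc).
have y2 j : (hj (drop j c)).2 = if (j < size c)%N then y j.+1 else 0.
  by case: ltnP => jc; [rewrite (drop_nth 0 jc)|rewrite drop_oversize].
have IHs : seq_det M s = y 1.
  apply: IH; first by case/andP: us.
  - by rewrite size_drop -sc subn1.
  - by apply/allP => x /mem_drop; move/allP: c2; apply.
  by move=> j l js ls; have := ME j.+1 l.+1 js ls; rewrite nth_drop !eqSS /= => ->.
pose xx u := y (index u (v :: s)).+1.
have xn l : (l < size (v :: s))%N -> xx (nth v (v :: s) l) = y l.+1.
  by move=> ls; rewrite /xx index_uniq.
have := @seq_det_pivot _ _ M v s xx (y 0%N) us.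
rewrite IHs (xn 0%N isT) => H.
have y0 : y 0%N = (hj c).1 by rewrite /y drop0.
rewrite -y0.
have y1 : y 1%N != 0.
  by rewrite gt_eqF // hj_gt0 //; apply/allP => x /mem_drop; move/allP: c2; apply.
apply: (mulfI y1); rewrite H 1?mulrC // {H} => w.
move=> /(nthP v)[j js <-]; rewrite (big_nth v).
rewrite (eq_big_nat _ _ (F2 := fun l => (if j == l then nth 0 c j else
    if (l == j.+1) || (j == l.+1) then -1 else 0) * y l.+1)); last first.
  move=> l /andP[_ ls]; rewrite xn // (set_nth_default x0 v ls) (set_nth_default x0 v js).
  by rewrite ME.
rewrite sum_tridiag // -[X in _ = if _ == X then _ else _]/(nth v (v :: s) 0) nth_uniq //.
rewrite -/(size (v :: s)) sc; have := yS j; rewrite -sc js y2 -sc => /(_ isT) yj.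
by case: j js yj => [|j] js -> /=; [rewrite subr0|rewrite subrr].
Qed.

Section Laplacian.
Variable G : wgraph.
Implicit Types (x : G -> int).

(** The intersection number of x with E_u when x vanishes off the curves. Summing over all
    neighbours avoids distinguishing curves from end vertices. *)
Definition lap x (u : G) : int := weight u * x u + \sum_(v | adj u v) x v.

Definition ratv x : {ffun G -> rat} := [ffun u => (x u)%:~R].

Lemma form_Evec (x : {ffun G -> rat}) (u : G) : curve u ->
  form x (Evec u) = \sum_(v | curve v) x v * (inter v u)%:~R.
Proof.
move=> cu; rewrite /form; apply: eq_bigr => v _.
rewrite (bigD1 u) //= ffunE eqxx mulr1 big1 ?addr0 // => w /andP[_ /negPf wu].
by rewrite ffunE wu mulr0 mul0r.
Qed.

Lemma form_sum (x y : {ffun G -> rat}) :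
  form x y = \sum_(u | curve u) y u * form x (Evec u).
Proof.
rewrite [LHS]exchange_big /=; apply: eq_bigr => u cu.
by rewrite form_Evec // mulr_sumr; apply: eq_bigr => v _; ring.
Qed.

Hypotheses (sym : symmetric (@adj G)) (irr : irreflexive (@adj G)).

Lemma inter_sym (u v : G) : inter u v = inter v u.
Proof. by rewrite /inter eq_sym sym; case: eqP => // ->. Qed.

Lemma lap_sum x w : lap x w = \sum_u inter w u * x u.
Proof.
rewrite /lap [RHS](bigD1 w) //= /inter eqxx; congr (_ + _).
rewrite big_mkcond [RHS]big_mkcond; apply: eq_bigr => u _ /=.
have [->|] := eqVneq u w; first by rewrite irr.
by case: (adj w u); rewrite ?mul1r ?mul0r.
Qed.

Lemma sum_inter x w (s : seq G) : uniq s -> (forall u, u \notin s -> x u = 0) ->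
  \sum_(u <- s) (- inter w u) * x u = - lap x w.
Proof.
move=> us x0; rewrite lap_sum -sumrN big_uniq //= big_mkcond; apply: eq_bigr => u _.
by case: ifPn => [_|/x0 ->]; rewrite ?mulNr // mulr0 oppr0.
Qed.

Lemma form_ratv x u : (forall v, ~~ curve v -> x v = 0) -> curve u ->
  form (ratv x) (Evec u) = (lap x u)%:~R.
Proof.
move=> x0 cu; rewrite form_Evec // lap_sum rmorph_sum big_mkcond /=.
apply: eq_bigr => v _; rewrite ffunE rmorphM /= mulrC inter_sym.
by case: ifPn => // /x0 ->; rewrite mulr0.
Qed.

Lemma graph_detE (A : {set G}) (s : seq G) : uniq s -> s =i A :&: curves G ->
  graph_det A = seq_det (fun u v : G => - inter u v) s.
Proof.
move=> us sA; rewrite /graph_det.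
have /seq_det_perm <- : perm_eq (enum (A :&: curves G)) s.
  by apply: uniq_perm; rewrite ?enum_uniq // => u; rewrite mem_enum sA.
have [A0|[x0 x0A]] := set_0Vmem (A :&: curves G).
  have c0 : #|A :&: curves G| = 0%N by rewrite A0 cards0.
  have -> : enum (A :&: curves G) = [::] by apply/nilP; rewrite /nilp -cardE c0.
  have E m (f : 'I_m -> G) : m = 0%N -> \det (\matrix_(a, b) (- inter (f a) (f b))) = 1 :> int.
    by move=> m0; move: f; rewrite m0 => f; exact: det_mx00.
  by rewrite seq_det_nil E.
rewrite -(@seq_detE _ _ _ x0 _ _ (nth x0 (enum (A :&: curves G))) (cardE _)) //.
by congr determinant; apply/matrixP => l r; rewrite !mxE !(enum_val_nth x0).
Qed.

End Laplacian.

Section LegWeights.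
Variables (G : wgraph) (n : nat -> nat) (V : nat -> nat -> G).

Definition leg_weights (i : nat) : seq int := [seq - weight (V i j) | j <- iota 0 (n i).-1].
Local Notation lw := leg_weights.

Lemma size_leg_weights i : size (lw i) = (n i).-1.
Proof. by rewrite size_map size_iota. Qed.

Lemma nth_leg_weights i j : (j.+1 < n i)%N -> nth 0 (lw i) j = - weight (V i j).
Proof. by move=> jn; rewrite (nth_map 0%N) ?size_iota ?nth_iota ?add0n //; lia. Qed.

Lemma hj_drop i j : (j.+1 < n i)%N -> (hj (drop j (lw i))).1 =
  - weight (V i j) * (hj (drop j (lw i))).2 - (hj (drop j.+1 (lw i))).2.
Proof.
move=> jn; have jl : (j < size (lw i))%N by rewrite size_leg_weights; lia.
by rewrite (drop_nth 0 jl) /= nth_leg_weights.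
Qed.

Lemma hj_drop2 i j : (j.+1 < n i)%N ->
  (hj (drop j (lw i))).2 = (hj (drop j.+1 (lw i))).1.
Proof.
move=> jn; have jl : (j < size (lw i))%N by rewrite size_leg_weights; lia.
by rewrite (drop_nth 0 jl).
Qed.

End LegWeights.

(** * The determinant of a star *)

Section StarGraph.
Variables (G : wgraph) (o : G) (k : nat) (n : nat -> nat) (V : nat -> nat -> G).
Hypotheses (SC : star_coords o k n V) (k1 : (1 < k)%N).

Local Notation lw := (leg_weights n V).

Lemma leg_weights_ge2 i : (i < k)%N ->
  (forall u, curve u -> u != o -> weight u <= - 2%:Z) -> all (fun x => 2 <= x) (lw i).
Proof.
move=> ik w2; apply/allP => _ /mapP[j + ->]; rewrite mem_iota => h.
have jn : (j.+1 < n i)%N by lia.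
have := w2 (V i j); rewrite (curveV SC) ?jn // => [/(_ isT)|]; last exact: ltnW.
by case: (SC) => _ _ Vo _ _; rewrite Vo ?(ltnW jn) // => /(_ isT); lia.
Qed.

Let sym : symmetric (@adj G). Proof. by case: SC => _ _ _ _ []. Qed.
Let irr : irreflexive (@adj G). Proof. by case: (star_is_tree SC). Qed.

Lemma lap_o t f : lap (star_vec o k n V t f) o =
  weight o * t + \sum_(0 <= i < k) f i 0%N.
Proof.
rewrite /lap star_vec_o (sum_adj_o SC); congr (_ + _); apply: eq_big_nat => i /andP[_ ik].
by rewrite (star_vecV SC) //; case: SC => n0 *; exact: n0.
Qed.

Lemma lapV t f i j : (i < k)%N -> (j < n i)%N -> lap (star_vec o k n V t f) (V i j) =
  weight (V i j) * f i j + (if j is j'.+1 then f i j' else t)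
  + (if (j.+1 < n i)%N then f i j.+1 else 0).
Proof.
move=> ik jn; rewrite /lap (star_vecV SC) // (sum_adjV SC) // addrA; congr (_ + _ + _).
  case: j jn => [|j] jn /=; first by rewrite star_vec_o.
  by rewrite (star_vecV SC) // ltnW.
by case: ifP => // h; rewrite (star_vecV SC).
Qed.

(** A multiple of E_o^* when each [N i] is N0 divided by the determinant of leg i: the value at a
    curve is [N i] times the determinant of the part of the leg beyond it, and the value at end
    vertices is 0. *)
Definition tail_vec (N0 : int) (N : nat -> int) : G -> int :=
  star_vec o k n V N0 (fun i j => N i * (hj (drop j (lw i))).2).

Section Tail.
Variables (N0 : int) (N : nat -> int).
Hypothesis NN0 : forall i, (i < k)%N -> N i * (hj (lw i)).1 = N0.

Lemma tail_vec_supp u : ~~ curve u -> tail_vec N0 N u = 0.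
Proof.
move: u; apply: (coord_ind SC) => [|i j ik jn]; first by rewrite (curve_o SC).
rewrite (curveV SC) // -leqNgt => h; rewrite /tail_vec (star_vecV SC) //.
by rewrite drop_oversize ?mulr0 // size_leg_weights; lia.
Qed.

Lemma lap_tail_o : lap (tail_vec N0 N) o =
  weight o * N0 + \sum_(0 <= i < k) N i * (hj (lw i)).2.
Proof. by rewrite lap_o; under eq_bigr do rewrite drop0. Qed.

Lemma lap_tailV i j : (i < k)%N -> (j.+1 < n i)%N -> lap (tail_vec N0 N) (V i j) = 0.
Proof.
move=> ik jn; rewrite lapV ?(ltnW jn) // jn.
have -> : (if j is j'.+1 then N i * (hj (drop j' (lw i))).2 else N0) =
    N i * (hj (drop j (lw i))).1.
  case: j jn => [|j] jn; first by rewrite drop0 NN0.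
  by rewrite hj_drop2 // ltnW.
by rewrite hj_drop //; ring.
Qed.

End Tail.

Definition leg_curves (i : nat) : seq G := [seq V i j | j <- iota 0 (n i).-1].

Lemma leg_curvesP i u : reflect (exists2 j, (j.+1 < n i)%N & u = V i j) (u \in leg_curves i).
Proof.
apply: (iffP mapP) => [[j]|[j jn ->]].
  by rewrite mem_iota => h ->; exists j => //; lia.
by exists j; rewrite // mem_iota; lia.
Qed.

Lemma uniq_leg_curves i : (i < k)%N -> uniq (leg_curves i).
Proof.
case: SC => _ _ _ inj _ ik; rewrite map_inj_in_uniq ?iota_uniq // => j j'.
rewrite !mem_iota => h h' e; have jn : (j < n i)%N by lia.
have jn' : (j' < n i)%N by lia.
by case: (inj _ _ _ _ ik jn ik jn' e).
Qed.

Lemma inter_coords i j i' j' : (i < k)%N -> (j < n i)%N -> (i' < k)%N -> (j' < n i')%N ->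
  inter (V i j) (V i' j') = if (i == i') && (j == j') then weight (V i j) else
    ((i == i') && ((j' == j.+1) || (j == j'.+1)))%:Z.
Proof.
case: SC => _ _ _ inj [_ _ _ VV] ik jn ik' jn'; rewrite /inter VV //.
case: eqP => [/(inj _ _ _ _ ik jn ik' jn')[-> ->]|ne]; first by rewrite !eqxx.
rewrite (_ : (i == i') && (j == j') = false) //.
by apply/negbTE/negP => /andP[/eqP e1 /eqP e2]; rewrite e1 e2 in ne.
Qed.

Hypothesis w2 : forall u, curve u -> u != o -> weight u <= - 2%:Z.

Lemma seq_det_leg i : (i < k)%N ->
  seq_det (fun u v : G => - inter u v) (leg_curves i) = (hj (lw i)).1.
Proof.
move=> ik; apply: (seq_det_chain (x0 := o)).
- exact: uniq_leg_curves.
- by rewrite !size_map.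
- exact: leg_weights_ge2.
move=> j l; rewrite size_map size_iota => js ls.
rewrite !(nth_map 0%N) ?size_iota // !nth_iota // !add0n inter_coords ?eqxx //=; try lia.
by case: eqP => // _; case: ifP.
Qed.

Lemma branch_det i j : (i < k)%N -> (j < n i)%N ->
  graph_det (branch o (V i j)) = (hj (lw i)).1.
Proof.
move=> ik jn; rewrite -seq_det_leg //; apply: graph_detE.
  exact: uniq_leg_curves.
move=> u; rewrite inE (branchE SC) // inE; apply/leg_curvesP/andP => [[l ln ->]|[/mem_leg[l ln ->]]].
  by rewrite (curveV SC) // ?(ltnW ln) //; split=> //; apply/mem_leg; exists l; rewrite // ltnW.
by rewrite (curveV SC) // => h; exists l.
Qed.

(** Pivot on the centre with [tail_vec], whose image vanishes on the legs. Without the centre the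
    matrix splits into the legs and has determinant N0, which then cancels. *)
Lemma star_det (N : nat -> int) :
  (forall i, (i < k)%N -> N i * (hj (lw i)).1 = \prod_(0 <= i < k) (hj (lw i)).1) ->
  graph_det (curves G) =
  - weight o * \prod_(0 <= i < k) (hj (lw i)).1 - \sum_(0 <= i < k) N i * (hj (lw i)).2.
Proof.
move=> NN0; set N0 := \prod_(_ <= _ < _) _ in NN0 *.
pose ss := [seq leg_curves i | i <- iota 0 k].
have memss u : reflect (exists i j, [/\ (i < k)%N, (j.+1 < n i)%N & u = V i j]) (u \in flatten ss).
  apply: (iffP flattenP) => [[_ /mapP[l + ->]]|[l [j [lk jn ->]]]].
    by rewrite mem_iota => lk /leg_curvesP[j jn ->]; exists l, j.
  exists (leg_curves l); first by apply: map_f; rewrite mem_iota.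
  by apply/leg_curvesP; exists j.
have us : uniq (o :: flatten ss).
  rewrite /=; apply/andP; split.
    apply/memss => -[l [j [lk jn]]]; case: SC => _ _ Vo _ _ e.
    by have := Vo l j lk (ltnW jn); rewrite -e eqxx.
  have := perm_uniq (perm_coords SC); rewrite index_enum_uniq => /esym /= /andP[_].
  apply: subseq_uniq; rewrite /ss -[X in subseq _ X]/(flatten _).
  elim: (iota 0 k) => //= l s IH; rewrite cat_subseq //; apply: map_subseq.
  have -> : iota 0 (n l).-1 = take (n l).-1 (iota 0 (n l)) by rewrite take_iota; congr iota; lia.
  exact: take_subseq.
have detss : seq_det (fun u v : G => - inter u v) (flatten ss) = N0.
  rewrite seq_det_flatten ?big_map /N0 /index_iota ?subn0.
    by rewrite big_seq [RHS]big_seq; apply: eq_bigr => l; rewrite mem_iota => lk; exact: seq_det_leg.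
  rewrite pairwise_map; apply: (@sub_in_pairwise _ (fun l => (l < k)%N) ltn).
  - move=> l l' lk l'k ll'; apply/allP => _ /leg_curvesP[j jn ->].
    apply/allP => _ /leg_curvesP[j' jn' ->]; rewrite inter_coords ?(ltnW jn) ?(ltnW jn') //.
    by rewrite (_ : (l' == l) = false) ?oppr0 //; apply/negbTE; rewrite neq_ltn; apply/orP; right.
  - by apply/allP => l; rewrite mem_iota.
  - by rewrite -sorted_pairwise ?iota_ltn_sorted //; exact: ltn_trans.
have N0_neq0 : N0 != 0.
  rewrite gt_eqF // /N0 big_nat; apply: (big_ind (fun x => 0 < x)) => //.
    exact: mulr_gt0.
  by move=> l lk; apply: hj_gt0; apply: leg_weights_ge2.
rewrite (@graph_detE _ _ (o :: flatten ss)) //; last first.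
  move=> u; rewrite !inE andbb; move: u; apply: (coord_ind SC) => [|i j ik jn].
    by rewrite eqxx (curve_o SC).
  case: (SC) => _ _ Vo inj _; rewrite (negPf (Vo _ _ ik jn)) (curveV SC) //=.
  apply/memss/idP => [[i' [j' [ik' jn' e]]]|h]; last by exists i, j.
  by case: (inj _ _ _ _ ik jn ik' (ltnW jn') e) => -> ->.
have := @seq_det_pivot _ _ (fun u v : G => - inter u v) o (flatten ss) (tail_vec N0 N)
   (- weight o * N0 - \sum_(0 <= i < k) N i * (hj (lw i)).2) us.
rewrite detss /tail_vec star_vec_o -/(tail_vec N0 N) => H; apply: (mulIf N0_neq0).
rewrite mulrC H // => w wf {H}.
rewrite (sum_inter irr) //; last first.
  move=> u; rewrite inE negb_or => /andP[uo uf]; apply: tail_vec_supp.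
  apply: contra uf => cu; apply/memss; move: uo cu; move: u.
  apply: (coord_ind SC) => [|i j ik jn _]; first by rewrite eqxx.
  by rewrite (curveV SC) // => h; exists i, j.
move: wf; rewrite inE => /orP[/eqP ->|/memss[i [j [ik jn ->]]]].
  by rewrite eqxx lap_tail_o; ring.
case: (SC) => _ _ Vo _ _; rewrite (negPf (Vo _ _ ik (ltnW jn))).
by rewrite (lap_tailV NN0) ?oppr0.
Qed.

End StarGraph.

(** * Arithmetic of the determinant equation for coprime leg determinants *)

Section CoprimeDenominators.
Variables (k : nat) (d : nat -> nat).
Hypotheses (d_gt0 : forall i, (i < k)%N -> (0 < d i)%N)
  (d_cop : forall i j, (i < k)%N -> (j < k)%N -> i != j -> coprime (d i) (d j)).

Definition codet (i : nat) : nat := (\prod_(0 <= j < k | j != i) d j)%N.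

Lemma codetM i : (i < k)%N -> (codet i * d i = \prod_(0 <= j < k) d j)%N.
Proof.
move=> ik; rewrite /codet mulnC [RHS](bigD1_seq i) ?iota_uniq //=.
by rewrite mem_index_iota.
Qed.

Lemma dvd_codet i j : (i < k)%N -> i != j -> (d i %| codet j)%N.
Proof.
move=> ik ij; rewrite /codet -big_filter (bigD1_seq i) ?filter_uniq ?iota_uniq //=.
  exact: dvdn_mulr.
by rewrite mem_filter ij mem_index_iota.
Qed.

Lemma coprime_codet i : (i < k)%N -> coprime (d i) (codet i).
Proof.
move=> ik; rewrite /codet big_seq_cond.
apply: (big_ind (fun x => coprime (d i) x)) => [|x y cx cy|j].
- exact: coprimen1.
- by rewrite coprimeMr cx.
by rewrite mem_index_iota => /andP[jk ji]; apply: d_cop => //; rewrite eq_sym.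
Qed.

Lemma dvd_prod_cop m x : (m <= k)%N -> (forall i, (i < k)%N -> (d i %| x)%N) ->
  (\prod_(0 <= j < m) d j %| x)%N.
Proof.
move=> + dx; elim: m => [|m IH] mk; first by rewrite big_geq // dvd1n.
rewrite big_nat_recr //= Gauss_dvd ?IH ?dx // 1?ltnW //.
rewrite big_nat; apply: (big_ind (fun x => coprime x (d m))) => [|u v cu cv|j /andP[_ jm]].
- exact: coprime1n.
- by rewrite coprimeMl cu.
by apply: d_cop => //; [exact: ltn_trans mk|rewrite neq_ltn jm].
Qed.

(** Bezout gives om i < d i with om i codet i = -1 modulo d i. Then 1 + sum codet i om i is
    divisible by each d i, hence by their product, and b is the quotient. *)
Lemma exists_numerators : exists (om : nat -> nat) (b : nat),
  (forall i, (i < k)%N -> (om i < d i)%N /\ coprime (d i) (om i)) /\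
  (b * \prod_(0 <= j < k) d j = 1 + \sum_(0 <= i < k) codet i * om i)%N.
Proof.
have /choice[om omP] : forall i, exists w, (i < k)%N ->
    (w < d i)%N /\ (d i %| 1 + w * codet i)%N.
  move=> i; case: (ltnP i k) => [ik|]; last by exists 0%N.
  have [w wd] := Bezoutl (codet i) (d_gt0 ik).
  by rewrite (eqP (coprime_codet ik)) => dw; exists w.
pose D := (1 + \sum_(0 <= i < k) codet i * om i)%N.
have dD i : (i < k)%N -> (d i %| D)%N.
  move=> ik; have [_ h] := omP i ik.
  rewrite /D (bigD1_seq i) ?iota_uniq ?mem_index_iota //= addnA dvdn_addr.
    rewrite big_seq_cond; apply: (big_ind (fun x => d i %| x)%N) => [|u v|j].
    - exact: dvdn0.
    - exact: dvdn_add.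
    by move=> /andP[_ ji]; apply: dvdn_mulr; apply: dvd_codet; rewrite // eq_sym.
  by rewrite mulnC.
exists om, (D %/ \prod_(0 <= j < k) d j)%N; split.
  move=> i ik; have [h1 h2] := omP i ik; split=> //.
  rewrite /coprime -dvdn1 -(dvdn_addl 1 (_ : _ %| om i * codet i)%N).
    by apply: dvdn_trans h2; exact: dvdn_gcdl.
  by rewrite dvdn_mulr // dvdn_gcdr.
by rewrite divnK //; apply: dvd_prod_cop.
Qed.

(** Modulo d i only the i-th term of each equation survives and codet i is invertible, so the bounds
    force om i = om' i; the central weights then agree by cancelling the product. *)
Lemma numerators_uniq (w w' : int) (om om' : nat -> int) :
  (forall i, (i < k)%N -> 0 <= om i < (d i)%:Z) ->
  (forall i, (i < k)%N -> 0 <= om' i < (d i)%:Z) ->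
  - w * (\prod_(0 <= j < k) d j)%N%:Z - \sum_(0 <= i < k) (codet i)%:Z * om i = 1 ->
  - w' * (\prod_(0 <= j < k) d j)%N%:Z - \sum_(0 <= i < k) (codet i)%:Z * om' i = 1 ->
  w = w' /\ forall i, (i < k)%N -> om i = om' i.
Proof.
move=> omb omb' e e'; pose P := (\prod_(0 <= j < k) d j)%N%:Z.
have omE i : (i < k)%N -> om i = om' i.
  move=> ik; have dP : (d i %| P)%Z.
    by rewrite /P -(codetM ik) PoszM dvdz_mull.
  have dS (f : nat -> int) : (d i %| \sum_(0 <= j < k | j != i) (codet j)%:Z * f j)%Z.
    apply: rpred_sum => j ji; rewrite dvdz_mulr //.
    by rewrite /dvdz /= ; apply: dvd_codet; rewrite // eq_sym.
  have S1 (f : nat -> int) : \sum_(0 <= j < k) (codet j)%:Z * f j =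
      (codet i)%:Z * f i + \sum_(0 <= j < k | j != i) (codet j)%:Z * f j.
    by rewrite (bigD1_seq i) ?iota_uniq ?mem_index_iota.
  have : (d i %| (codet i)%:Z * (om i - om' i))%Z.
    have -> : (codet i)%:Z * (om i - om' i) = (w' - w) * P
       + (\sum_(0 <= j < k | j != i) (codet j)%:Z * om' j
       - \sum_(0 <= j < k | j != i) (codet j)%:Z * om j).
      by rewrite !S1 -/P in e e'; lia.
    by apply: rpredD; [rewrite dvdz_mull|apply: rpredB].
  rewrite Gauss_dvdzr; last by rewrite /coprimez /gcdz /= (eqP (coprime_codet ik)).
  have := omb i ik; have := omb' i ik => /andP[h1 h2] /andP[h3 h4] /dvdzP[q qe].
  have q0 : q = 0 by nia.
  by rewrite q0 mul0r in qe; apply/eqP; rewrite -subr_eq0 qe.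
split=> //; have P0 : P != 0.
  rewrite /P eqz_nat -lt0n big_nat; apply: (big_ind (fun x => 0 < x)%N) => //.
  by move=> x y x0 y0; rewrite muln_gt0 x0.
apply/eqP; rewrite -(inj_eq (mulIf P0)).
rewrite -/P (eq_big_nat _ _ (F2 := fun j => (codet j)%:Z * om' j)) in e.
  by apply/eqP; have /addIr := etrans e (esym e'); rewrite !mulNr => /oppr_inj.
by move=> j /andP[_ jk]; rewrite omE.
Qed.

End CoprimeDenominators.

Section Isomorphism.
Variables (k : nat) (G G' : wgraph) (o : G) (o' : G') (n n' : nat -> nat)
  (V : nat -> nat -> G) (V' : nat -> nat -> G').
Hypotheses (SC : star_coords o k n V) (SC' : star_coords o' k n' V')
  (nn' : forall i, (i < k)%N -> n i = n' i).

Lemma star_iso :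
  (1 < k)%N -> weight o = weight o' ->
  (forall i j, (i < k)%N -> (j.+1 < n i)%N -> weight (V i j) = weight (V' i j)) ->
  wgraph_iso G G'.
Proof.
move=> k1 wo wV; pose f := star_vec o k n V o' V'; pose g := star_vec o' k n' V' o V.
have fo : f o = o' by rewrite /f star_vec_o.
have go : g o' = o by rewrite /g star_vec_o.
have fV i j : (i < k)%N -> (j < n i)%N -> f (V i j) = V' i j.
  by move=> ik jn; rewrite /f (star_vecV SC).
have gV i j : (i < k)%N -> (j < n i)%N -> g (V' i j) = V i j.
  by move=> ik jn; rewrite /g (star_vecV SC') // -nn'.
exists f; split.
- exists g; first by apply: (coord_ind SC) => [|i j ik jn]; rewrite ?fo // fV // gV.
  by apply: (coord_ind SC') => [|i j ik jn]; rewrite ?go // gV ?fV // nn'.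
- case: (SC) => _ _ _ _ [sym oo oV VV]; case: (SC') => _ _ _ _ [sym' oo' oV' VV'].
  apply: (coord_ind SC) => [|i j ik jn]; apply: (coord_ind SC) => [|i' j' ik' jn'];
    rewrite ?fo ?fV ?oo ?oo' //.
  + by rewrite oV ?oV' // -nn'.
  + by rewrite sym sym' oV ?oV' // -nn'.
  + by rewrite VV ?VV' // -nn'.
apply: (coord_ind SC) => [_|i j ik jn]; first by rewrite fo.
by rewrite (curveV SC) // => jn'; rewrite fV // wV.
Qed.

End Isomorphism.

Section NegativeDefinite.
Variables (G : wgraph) (o : G) (k : nat) (n : nat -> nat) (V : nat -> nat -> G).
Hypotheses (SC : star_coords o k n V) (k1 : (1 < k)%N).
Variable x : G -> int.
Hypotheses (x_supp : forall u, ~~ curve u -> x u = 0)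
  (x_gt0 : forall u, curve u -> 0 < x u)
  (lap_x : forall u, curve u -> lap x u = - (u == o)%:Z).

(* With z = y / x, the form is [- z_o ^ 2 x_o - sum x_u x_v (z_u - z_v) ^ 2], the
   sum being over the edges. *)
Lemma star_negative_definite : negative_definite G.
Proof.
case: (SC) => _ _ _ _ [sym _ _ _]; have [_ irr _ _] := star_is_tree SC.
move=> y [u0 cu0 yu0]; pose t u : rat := (x u)%:~R; pose z u := y u / t u.
have t0 u : curve u -> 0 < t u by move=> cu; rewrite ltr0z x_gt0.
have yE u : curve u -> y u = z u * t u by move=> cu; rewrite divfK // gt_eqF ?t0.
pose I (u v : G) : rat := (inter u v)%:~R.
have Isym u v : I u v = I v u by rewrite /I inter_sym.
have lapt u : curve u -> \sum_(v | curve v) t v * I u v = - (u == o)%:R.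
  move=> cu; have -> : - (u == o)%:R = (lap x u)%:~R :> rat by rewrite lap_x //; case: (u == o).
  rewrite lap_sum // rmorph_sum /= big_mkcond.
  apply: eq_bigr => v _; rewrite rmorphM /= mulrC; case: ifPn => // /x_supp xv.
  by rewrite xv mulr0.
pose B := \sum_(u | curve u) \sum_(v | curve v) I u v * t u * t v * (z u - z v) ^+ 2.
have formE : form y y = - (z o ^+ 2 * t o) - 2^-1 * B.
  have -> : form y y = \sum_(u | curve u) \sum_(v | curve v) I u v * t u * t v * (z u * z v).
    by apply: eq_bigr => u cu; apply: eq_bigr => v cv; rewrite !yE // /I; ring.
  have S : \sum_(u | curve u) \sum_(v | curve v) I u v * t u * t v * z u ^+ 2 =
      - (z o ^+ 2 * t o).
    rewrite (eq_bigr (fun u => - (z u ^+ 2 * t u) * (u == o)%:R)); last first.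
      move=> u cu; rewrite mulNr -mulrN -lapt // mulr_sumr; apply: eq_bigr => v _; ring.
    rewrite (bigD1 o) ?(curve_o SC) //= eqxx mulr1 big1 ?addr0 // => u /andP[_ /negPf ->].
    by rewrite mulr0.
  have S' : \sum_(u | curve u) \sum_(v | curve v) I u v * t u * t v * z v ^+ 2 =
      - (z o ^+ 2 * t o).
    rewrite exchange_big -S; apply: eq_bigr => u cu; apply: eq_bigr => v cv.
    by rewrite Isym; ring.
  have BE : B = - (z o ^+ 2 * t o) - (z o ^+ 2 * t o) - 2 *
      \sum_(u | curve u) \sum_(v | curve v) I u v * t u * t v * (z u * z v).
    rewrite -{1}S -S' mulr_sumr -big_split -sumrB /=; apply: eq_bigr => u cu.
    rewrite mulr_sumr -big_split -sumrB /=; apply: eq_bigr => v cv; ring.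
  by rewrite BE; field.
have term0 u v : curve u -> curve v -> 0 <= I u v * t u * t v * (z u - z v) ^+ 2.
  move=> cu cv; have [->|uv] := eqVneq u v; first by rewrite subrr expr0n mulr0.
  apply: mulr_ge0 (sqr_ge0 _).
  apply: mulr_ge0; last exact/ltW/t0; apply: mulr_ge0; last exact/ltW/t0.
  by rewrite /I /inter (negPf uv); case: (adj u v).
have B0 : 0 <= B by apply: sumr_ge0 => u cu; apply: sumr_ge0 => v cv; exact: term0.
have to0 := t0 o (curve_o SC k1).
have zo0 : 0 <= z o ^+ 2 * t o by rewrite mulr_ge0 ?sqr_ge0 // ltW.
rewrite ltNge; apply/negP; rewrite formE => f0.
(* Both terms of the form have a sign, so z vanishes at o and is constant along edges between
   curves; following the legs, z = 0 on all curves. *)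
have B_eq0 : B = 0 by lra.
have zo : z o = 0.
  have : z o ^+ 2 * t o = 0 by lra.
  by move/eqP; rewrite mulf_eq0 sqrf_eq0 (gt_eqF to0) orbF => /eqP.
have zadj u v : curve u -> curve v -> adj u v -> z u = z v.
  move=> cu cv uv; move/eqP: B_eq0; rewrite psumr_eq0; last first.
    by move=> w cw; apply: sumr_ge0 => w' cw'; exact: term0.
  move/allP/(_ u (mem_index_enum _)); rewrite cu psumr_eq0; last by move=> w cw; exact: term0.
  move/allP/(_ v (mem_index_enum _)); rewrite cv /=.
  have uv' : u != v by apply/eqP => e; rewrite e irr in uv.
  rewrite /I /inter (negPf uv') uv mul1r mulf_eq0 sqrf_eq0 subr_eq0 mulf_eq0.
  by rewrite (gt_eqF (t0 u cu)) (gt_eqF (t0 v cv)) => /eqP.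
suff z0 u : curve u -> z u = 0 by move: yu0; rewrite yE // z0 // mul0r eqxx.
move: u; apply: (coord_ind SC) => [//|i j ik jn].
case: (SC) => _ _ _ _ [_ _ oV VV].
rewrite (curveV SC) //; elim: j jn => [|j IH] jn jn'.
  rewrite -zo; apply: zadj; rewrite ?(curve_o SC) ?(curveV SC) //.
  by rewrite sym oV.
rewrite -(IH (ltnW jn) jn); apply: zadj; rewrite ?(curveV SC) ?(ltnW jn) //.
by rewrite VV ?(ltnW jn) // eqxx eqxx orbT.
Qed.

End NegativeDefinite.

(** * A star with prescribed self-intersections; existence and uniqueness of the graph *)

Section Model.
Variables (k : nat) (b : int) (c : nat -> seq int).

Definition model_verts : seq (nat * nat) :=
  (0, 0)%N :: [seq (i.+1, j) | i <- iota 0 k, j <- iota 0 (size (c i)).+1].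

Definition model_adj (p q : nat * nat) : bool :=
  [|| [&& p.1 == 0, q.1 != 0 & q.2 == 0], [&& q.1 == 0, p.1 != 0 & p.2 == 0]
    | [&& p.1 != 0, p.1 == q.1 & (q.2 == p.2.+1) || (p.2 == q.2.+1)]]%N.

Definition model_weight (p : nat * nat) : int :=
  if p.1 is i.+1 then - nth 0 (c i) p.2 else - b.

Definition model : wgraph :=
  @WGraph (seq_sub model_verts) (fun u v => model_adj (val u) (val v))
    (fun u => model_weight (val u)).

Definition model_o : model := SeqSub (mem_head _ _ : (0, 0)%N \in model_verts).

Definition model_V (i j : nat) : model := insubd model_o (i.+1, j).

Lemma model_VK i j : (i < k)%N -> (j < (size (c i)).+1)%N ->
  val (model_V i j) = (i.+1, j) :> nat * nat.
Proof.
move=> ik jc; apply: insubdK; rewrite inE; apply/orP; right.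
by apply/allpairsPdep; exists i, j; rewrite !mem_iota.
Qed.

Lemma model_star_coords : star_coords model_o k (fun i => (size (c i)).+1) model_V.
Proof.
have adjE (u v : model) : adj u v = model_adj (val u) (val v) by [].
split=> //.
- move=> u; have := valP u; rewrite inE => /orP[/eqP e|].
    by left; apply: val_inj; rewrite e.
  move=> /allpairsPdep[i [j [+ + e]]]; rewrite !mem_iota => ik jc; right; exists i, j.
  by split=> //; apply: val_inj; rewrite e model_VK.
- by move=> i j ik jn; apply/eqP => /(congr1 val); rewrite model_VK.
- move=> i j i' j' ik jn ik' jn' /(congr1 val); rewrite !model_VK //.
  by case.
split=> //.
- by move=> u v; rewrite !adjE /model_adj; lia.
- by move=> i j ik jn; rewrite adjE model_VK // /model_adj /= orbF.
- move=> i j i' j' ik jn ik' jn'; rewrite adjE !model_VK // /model_adj /=; lia.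
Qed.

Lemma model_weight_o : weight model_o = - b. Proof. by []. Qed.

Lemma model_leg_weights i : (i < k)%N ->
  leg_weights (fun i => (size (c i)).+1) model_V i = c i.
Proof.
move=> ik; apply: (@eq_from_nth _ 0); rewrite size_leg_weights //= => j js.
rewrite nth_leg_weights // -[weight _]/(model_weight (val (model_V i j))) model_VK //.
  by rewrite /model_weight /= opprK.
exact: ltnW.
Qed.

End Model.

Lemma end_vertex_seq (G : wgraph) (s : seq G) : (forall u, u \in s -> degree u = 1%N) ->
  exists ws : seq (end_vertex G), [seq val w | w <- ws] = s.
Proof.
elim: s => [|u s IH] ds; first by exists [::].
have [w wsE] : exists ws : seq (end_vertex G), [seq val w | w <- ws] = s.
  by apply: IH => v vs; apply: ds; rewrite inE vs orbT.
have du : degree u == 1%N by rewrite ds // mem_head.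
by exists ((exist _ u du : end_vertex G) :: w); rewrite /= wsE.
Qed.

Section StarGraphExists.
Variable ds : seq nat.
Hypotheses (ds2 : (1 < size ds)%N) (ds_gt0 : all (fun d => 0 < d)%N ds)
  (ds_cop : pairwise coprime ds).

Let k := size ds.
Let d i := nth 1%N ds i.

Lemma nth_ds_gt0 i : (i < k)%N -> (0 < d i)%N.
Proof. by move=> ik; move/(all_nthP 1%N): ds_gt0; apply. Qed.

Lemma nth_ds_coprime i j : (i < k)%N -> (j < k)%N -> i != j -> coprime (d i) (d j).
Proof.
move=> ik jk; rewrite neq_ltn => /orP[] ij; last rewrite coprime_sym.
  by move/(pairwiseP 1%N): ds_cop; apply.
by move/(pairwiseP 1%N): ds_cop; apply.
Qed.

Lemma star_graph_exists : exists (G : wgraph) (o : G) (ws : seq (end_vertex G)),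
  star_graph o ws ds /\ graph_det (curves G) = 1.
Proof.
have [om [b [omP bE]]] := exists_numerators nth_ds_gt0 nth_ds_coprime.
have /choice[c cP] : forall i, exists c, (i < k)%N ->
    all (fun x => 2 <= x) c /\ hj c = ((d i)%:Z, (om i)%:Z).
  move=> i; case: (ltnP i k) => [ik|]; last by exists [::].
  by have [h1 h2] := omP i ik; have [c c2 hc] := hj_surj h1 h2; exists c.
have SC := model_star_coords k b%:Z c.
set G := model k b%:Z c in SC *; set o := model_o k b%:Z c in SC *.
set n := (fun i => (size (c i)).+1) in SC *; set V := model_V k b%:Z c in SC *.
have lwE i : (i < k)%N -> leg_weights n V i = c i by exact: model_leg_weights.
have w2 (u : G) : curve u -> u != o -> weight u <= - 2%:Z.
  move: u; apply: (coord_ind SC) => [|i j ik jn]; first by rewrite eqxx.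
  rewrite (curveV SC) // => jn' _.
  have [/(all_nthP 0) c2 _] := cP i ik; have := c2 j jn'.
  rewrite -lwE // nth_leg_weights //; move=> /=; lia.
have hjE i : (i < k)%N -> hj (leg_weights n V i) = ((d i)%:Z, (om i)%:Z).
  by move=> ik; rewrite lwE //; case: (cP i ik).
have prodE : \prod_(0 <= i < k) (hj (leg_weights n V i)).1 = (\prod_(0 <= i < k) d i)%N%:Z.
  rewrite -[RHS]natz natr_prod; apply: eq_big_nat => i /andP[_ ik].
  by rewrite hjE //= natz.
have NN0 i : (i < k)%N -> (codet k d i)%:Z * (hj (leg_weights n V i)).1 =
    \prod_(0 <= i < k) (hj (leg_weights n V i)).1.
  by move=> ik; rewrite prodE hjE //= -PoszM codetM.
(* This one identity gives determinant 1 through [star_det], and it says that [tail_vec] has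
   intersection number -1 with the centre, as needed for negative definiteness. *)
have D1 : weight o * (\prod_(0 <= i < k) (hj (leg_weights n V i)).1)
   + \sum_(0 <= i < k) (codet k d i)%:Z * (hj (leg_weights n V i)).2 = - 1.
  rewrite prodE model_weight_o mulNr -PoszM bE.
  have -> : \sum_(0 <= i < k) (codet k d i)%:Z * (hj (leg_weights n V i)).2 =
      (\sum_(0 <= i < k) codet k d i * om i)%N%:Z.
    rewrite -[RHS]natz natr_sum; apply: eq_big_nat => i /andP[_ ik].
    by rewrite hjE //= natz PoszM.
  lia.
have [ws wsE] : exists ws : seq (end_vertex G),
    [seq val w | w <- ws] = [seq V i (n i).-1 | i <- iota 0 k].
  apply: end_vertex_seq => u /mapP[l + ->]; rewrite mem_iota => /andP[_ lk].
  exact: (degree_end SC).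
have brE : [seq branch o (val w) | w <- ws] = [seq branch o (V i (n i).-1) | i <- iota 0 k].
  by rewrite (map_comp (branch o) val) wsE -map_comp.
exists G, o, ws; split; last first.
  rewrite (star_det SC ds2 w2 NN0); by rewrite mulNr -opprD D1 opprK.
split.
- split; first exact: (star_is_tree SC).
    rewrite -sum1_card (sum_coords SC (fun=> 1%N)) ltnS; apply: leq_trans ds2 _.
    rewrite -/k -[X in (X <= _)%N]subn0 -[X in (X <= _)%N]muln1 -sum_nat_const_nat.
    by apply: leq_sum => l _; rewrite sum_nat_const_nat /n.
  apply: (@star_negative_definite _ _ _ _ _ SC ds2 (tail_vec o k n V
     (\prod_(0 <= i < k) (hj (leg_weights n V i)).1) (fun i => (codet k d i)%:Z))).
  + exact: tail_vec_supp.
  + apply: (coord_ind SC) => [_|i j ik jn].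
      rewrite /tail_vec star_vec_o prodE ltz_nat big_nat.
      by apply: (big_ind (fun x => 0 < x)%N) => // [x y x0 y0|i ik];
        [rewrite muln_gt0 x0|exact: nth_ds_gt0].
    rewrite (curveV SC) // => jn'; rewrite /tail_vec (star_vecV SC) //.
    rewrite hj_drop2 // mulr_gt0 //.
      rewrite ltz_nat -(ltn_pmul2r (nth_ds_gt0 ik)) mul0n codetM // big_nat.
      by apply: (big_ind (fun x => 0 < x)%N) => // [x y x0 y0|l lk];
        [rewrite muln_gt0 x0|exact: nth_ds_gt0].
    apply: hj_gt0; apply/allP => x /mem_drop; rewrite lwE //.
    by case: (cP i ik) => /allP + _; apply.
  + apply: (coord_ind SC) => [_|i j ik jn]; first by rewrite eqxx lap_tail_o.
    case: (SC) => _ _ Vo _ _; rewrite (curveV SC) // => jn'.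
    by rewrite (lap_tailV SC NN0) // (negPf (Vo _ _ ik jn)) oppr0.
- exact: (star_shaped_coords SC).
- exact: w2.
- rewrite brE; split.
    rewrite map_inj_in_uniq ?iota_uniq // => i j; rewrite !mem_iota => /andP[_ ik] /andP[_ jk].
    by apply: (branch_inj SC).
  have <- : [seq branch o (V i 0) | i <- iota 0 k] =
      [seq branch o (V i (n i).-1) | i <- iota 0 k].
    apply/eq_in_map => l; rewrite mem_iota => /andP[_ lk]; apply/setP => u.
    by rewrite !(branchE SC).
  exact: (branches_coords SC).
rewrite (map_comp (fun u => graph_det (branch o u)) val) wsE.
apply: (@eq_from_nth _ 0); rewrite !size_map ?size_iota // => i ik.
rewrite (nth_map o) ?size_map ?size_iota // (nth_map 0%N) ?size_iota // nth_iota // add0n.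
rewrite (branch_det SC ds2 w2) // hjE //= (nth_map 1%N) //.
Qed.

End StarGraphExists.

Lemma star_graph_coords (G : wgraph) (o : G) (ws : seq (end_vertex G)) (ds : seq nat) :
  (1 < size ds)%N -> star_graph o ws ds -> exists n V,
  [/\ star_coords o (size ds) n V,
      forall i, (i < size ds)%N -> nth o [seq val w | w <- ws] i = V i (n i).-1
    & forall i, (i < size ds)%N -> all (fun x => 2 <= x) (leg_weights n V i) /\
        (hj (leg_weights n V i)).1 = (nth 1%N ds i)%:Z].
Proof.
move=> k1 [[[sym irr conn acyc] _ _] sh w2 [uC br] dE].
have sE : size ws = size ds by have := congr1 size dE; rewrite !size_map.
have k1' : (1 < size ws)%N by rewrite sE.
have [n [V [SC endE]]] := tree_star_coords sym irr conn acyc k1' sh uC br.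
rewrite sE in SC endE; exists n, V; split=> // i ik.
split; first exact: (leg_weights_ge2 SC k1 ik w2).
have n0 : (0 < n i)%N by case: SC => h _ _ _ _; exact: h.
have := congr1 (fun s => nth 0 s i) dE; rewrite (nth_map 1%N) // => <-.
rewrite (map_comp (fun u => graph_det (branch o u)) val) (nth_map o) ?size_map ?sE //.
by rewrite endE // (branch_det SC k1 w2) // prednK.
Qed.

Section Uniqueness.
Variable ds : seq nat.
Hypotheses (ds2 : (1 < size ds)%N) (ds_gt0 : all (fun d => 0 < d)%N ds)
  (ds_cop : pairwise coprime ds).

Let k := size ds.
Let d i := nth 1%N ds i.

Lemma star_det_ds (G : wgraph) (o : G) n V : star_coords o k n V ->
  (forall u : G, curve u -> u != o -> weight u <= - 2%:Z) ->
  (forall i, (i < k)%N -> (hj (leg_weights n V i)).1 = (d i)%:Z) ->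
  graph_det (curves G) = - weight o * (\prod_(0 <= j < k) d j)%N%:Z
    - \sum_(0 <= i < k) (codet k d i)%:Z * (hj (leg_weights n V i)).2.
Proof.
move=> SC w2 hE.
have prodE : \prod_(0 <= i < k) (hj (leg_weights n V i)).1 = (\prod_(0 <= i < k) d i)%N%:Z.
  rewrite -[RHS]natz natr_prod; apply: eq_big_nat => i /andP[_ ik].
  by rewrite hE //= natz.
rewrite (star_det SC ds2 w2 (N := fun i => (codet k d i)%:Z)) prodE // => i ik.
by rewrite hE // -PoszM codetM.
Qed.

Lemma star_graph_unique (G G' : wgraph) (o : G) (o' : G') ws ws' :
  star_graph o ws ds -> graph_det (curves G) = 1 ->
  star_graph o' ws' ds -> graph_det (curves G') = 1 -> wgraph_iso G G'.
Proof.
move=> sg det1 sg' det1'.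
have [n [V [SC _ hV]]] := star_graph_coords ds2 sg.
have [n' [V' [SC' _ hV']]] := star_graph_coords ds2 sg'.
case: sg sg' => _ _ w2 _ _ [_ _ w2' _ _].
have hE i : (i < k)%N -> (hj (leg_weights n V i)).1 = (d i)%:Z by case/hV.
have hE' i : (i < k)%N -> (hj (leg_weights n' V' i)).1 = (d i)%:Z by case/hV'.
rewrite (star_det_ds SC w2 hE) in det1; rewrite (star_det_ds SC' w2' hE') in det1'.
have [||wo omE] := numerators_uniq (nth_ds_gt0 ds_gt0) (nth_ds_coprime ds_cop) _ _ det1 det1'.
- by move=> i ik; rewrite -hE //; apply: hj_bounds; case: (hV i ik).
- by move=> i ik; rewrite -hE' //; apply: hj_bounds; case: (hV' i ik).
have lwE i : (i < k)%N -> leg_weights n V i = leg_weights n' V' i.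
  move=> ik; apply: hj_inj; [by case: (hV i ik)|by case: (hV' i ik)|].
  rewrite [LHS]surjective_pairing [RHS]surjective_pairing hE // hE' //.
  by congr (_, _); exact: omE.
have nE i : (i < k)%N -> n i = n' i.
  move=> ik; have := congr1 size (lwE i ik); rewrite !size_leg_weights.
  by case: SC SC' => n0 _ _ _ _ [n0' _ _ _ _]; have := n0 i ik; have := n0' i ik; lia.
apply: (star_iso SC SC' nE) => // i j ik jn; apply: oppr_inj.
by rewrite -(@nth_leg_weights _ n V) // -(@nth_leg_weights _ n' V') -?nE // lwE.
Qed.

End Uniqueness.

(** * Dual vectors and splice systems *)

Section UnimodularDual.
Variable G : wgraph.
Hypotheses (sym : symmetric (@adj G)) (irr : irreflexive (@adj G))
  (nd : negative_definite G) (det1 : graph_det (curves G) = 1).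
Implicit Types (u v : G).

Lemma form_inj (x x' : {ffun G -> rat}) :
  (forall u, ~~ curve u -> x u = 0) -> (forall u, ~~ curve u -> x' u = 0) ->
  (forall u, curve u -> form x (Evec u) = form x' (Evec u)) -> x = x'.
Proof.
move=> x0 x0' xx'; apply/ffunP => u; apply/eqP; rewrite -subr_eq0; apply/negP => /negP ne.
have cu : curve u by apply: contraNT ne => cu; rewrite x0 ?x0' ?subrr.
have := nd (x := x - x'); rewrite form_sum big1 => [|v cv].
  by rewrite ltxx => h; have : false by apply: h; exists u; rewrite // !ffunE.
rewrite form_Evec //; suff -> : \sum_(w | curve w) (x - x') w * (inter w v)%:~R =
    form x (Evec v) - form x' (Evec v) by rewrite xx' // subrr mulr0.
by rewrite !form_Evec // -sumrB; apply: eq_bigr => w _; rewrite !ffunE mulrBl.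
Qed.

(** The matrix is unimodular, hence invertible over the integers; [y] is a column of the inverse,
    extended by zero. *)
Lemma exists_int_dual v : curve v -> exists y : G -> int,
  (forall u, ~~ curve u -> y u = 0) /\ (forall u, curve u -> lap y u = - (u == v)%:Z).
Proof.
(* With this redundant intersection, [A] is literally the matrix in [graph_det (curves G)], so
   [det1] applies. *)
move=> cv; pose C := curves G :&: curves G.
have CE u : (u \in C) = curve u by rewrite !inE andbb.
pose A : 'M[int]_#|C| := \matrix_(i, j) - inter (enum_val i) (enum_val j).
have uA : A \in unitmx by rewrite unitmxE (_ : \det A = 1) ?unitr1.
pose X := invmx A *m (\col_i (enum_val i == v)%:Z).
pose y u : int := \sum_(i < #|C|) (if enum_val i == u then X i 0 else 0).
exists y; split=> [u cu|u cu].
  rewrite /y big1 // => i _; case: eqP => // e; have := enum_valP i.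
  by rewrite e CE (negPf cu).
rewrite lap_sum //; under eq_bigr => w _ do rewrite /y mulr_sumr.
rewrite exchange_big /=.
have uC : u \in C by rewrite CE.
rewrite -{1}(enum_rankK_in uC uC) -[RHS]opprK; set j := enum_rank_in uC u.
have AX : (A *m X) j 0 = (u == v)%:Z.
  by rewrite /X mulmxA mulmxV // mul1mx mxE enum_rankK_in.
rewrite -AX mxE opprK -sumrN; apply: eq_bigr => i _.
rewrite (bigD1 (enum_val i)) //= eqxx big1 ?addr0.
  by rewrite !mxE mulNr opprK.
by move=> w /negPf; rewrite eq_sym => ->; rewrite mulr0.
Qed.

(** [curve_dual] is a choice among all solutions; negative definiteness makes the solution
    unique. *)
Lemma curve_dualE v (y : G -> int) : curve v -> (forall u, ~~ curve u -> y u = 0) ->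
  (forall u, curve u -> lap y u = - (u == v)%:Z) -> curve_dual v = ratv y.
Proof.
move=> cv y0 yl; rewrite /curve_dual; case: xgetP => [x _ [x0 xl]|/(_ (ratv y))[]].
  apply: form_inj => // [u cu|u cu]; first by rewrite ffunE y0.
  by rewrite xl // form_ratv // yl //; case: (u == v).
split=> u cu; first by rewrite ffunE y0.
by rewrite form_ratv // yl //; case: (u == v).
Qed.

Lemma curve_dual_int v : curve v -> exists y : G -> int,
  [/\ forall u, ~~ curve u -> y u = 0, forall u, curve u -> lap y u = - (u == v)%:Z
    & curve_dual v = ratv y].
Proof.
move=> cv; have [y [y0 yl]] := exists_int_dual cv.
by exists y; split=> //; exact: curve_dualE.
Qed.

(** Pairing with E_u^* reads off a coordinate. Hence v-degrees are coordinates at v, and integral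
    dual vectors give trivial characters. *)
Lemma form_dual u (x : {ffun G -> rat}) : curve u -> form (dual u) x = - x u.
Proof.
move=> cu; rewrite form_sum /dual cu; have [y [y0 yl ->]] := curve_dual_int cu.
rewrite (bigD1 u) //= form_ratv // yl // eqxx big1 => [|w /andP[cw /negPf wu]].
  by rewrite addr0 mulrN1.
by rewrite form_ratv // yl // wu mulr0.
Qed.

End UnimodularDual.

(* [head_seq c j = (A_(j-1), A_j)], where A_j is the determinant of the first j
   curves of a chain with self-intersections -(c 0), -(c 1), .. *)
Fixpoint head_seq (c : nat -> int) (j : nat) : int * int :=
  if j is j'.+1 then ((head_seq c j').2, c j' * (head_seq c j').2 - (head_seq c j').1)
  else (0, 1).

Lemma head_seq_bounds (c : seq int) j : all (fun x => 2 <= x) c -> (j <= size c)%N ->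
  0 <= (head_seq (nth 0 c) j).1 < (head_seq (nth 0 c) j).2.
Proof.
move=> /(all_nthP 0) c2; elim: j => //= j IH jc.
have := IH (ltnW jc); have h1 : 2 <= nth 0 c j := c2 j jc; move: h1; move: (nth 0 c j) (head_seq _ j).1
  (head_seq _ j).2 => x u v h1 /andP[h2 h3]; nia.
Qed.

Lemma head_seq_wronskian (c : seq int) j : (j <= size c)%N ->
  (head_seq (nth 0 c) j).2 * (hj (drop j c)).1
    - (head_seq (nth 0 c) j).1 * (hj (drop j c)).2 = (hj c).1.
Proof.
elim: j => [|j IH] jc; first by rewrite drop0 /=; ring.
by rewrite -IH ?(ltnW jc) // (drop_nth 0 jc) /=; ring.
Qed.

Lemma head_seq_end (c : seq int) : (head_seq (nth 0 c) (size c)).2 = (hj c).1.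
Proof. by rewrite -(head_seq_wronskian (leqnn _)) drop_size /= mulr1 mulr0 subr0. Qed.

(** * Dual vectors of the ends of a star *)

Section StarDual.
Variables (G : wgraph) (o : G) (k : nat) (n : nat -> nat) (V : nat -> nat -> G).
Hypotheses (SC : star_coords o k n V) (k1 : (1 < k)%N)
  (nd : negative_definite G) (det1 : graph_det (curves G) = 1).

Let sym : symmetric (@adj G). Proof. by case: SC => _ _ _ _ []. Qed.
Let irr : irreflexive (@adj G). Proof. by case: (star_is_tree SC). Qed.

Lemma dual_end i : (i < k)%N -> dual (V i (n i).-1) = curve_dual (parent o V i (n i).-1).
Proof.
clear k1 nd det1; move=> ik; have n0 : (0 < n i)%N by case: SC => h _ _ _ _; exact: h.
have jn : ((n i).-1 < n i)%N by lia.
rewrite /dual (curveV SC) // prednK // ltnn; congr curve_dual.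
case: pickP => [u|/(_ (parent o V i (n i).-1))]; last by rewrite (adj_parent SC).
case: (SC) => _ _ _ _ [_ oo oV VV].
move: u; apply: (coord_ind SC) => [|i' j' ik' jn']; first by rewrite sym oV // => /eqP ->.
rewrite VV // => /andP[/eqP e]; move: jn'; rewrite -e => jn' h.
by have -> : (n i).-1 = j'.+1 by lia.
Qed.

Lemma curve_parent i : (i < k)%N -> curve (parent o V i (n i).-1).
Proof.
clear nd det1; move=> ik; have n0 : (0 < n i)%N by case: SC => h _ _ _ _; exact: h.
case En : (n i).-1 => [|j] /=; first exact: (curve_o SC).
by rewrite (curveV SC) //; lia.
Qed.

(** These will be the coefficients alpha of admissibility: at a curve of leg i, the determinant of
    the curves between it and the centre. *)
Definition head_vec (i : nat) : G -> int := star_vec o k n V 0 (fun i' j =>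
  if (i' == i) && (j.+1 < n i)%N then (head_seq (nth 0 (leg_weights n V i)) j).2 else 0).

(** This is the admissibility equation for z_w^d, d being the determinant of the branch. Both sides
    have the same intersection numbers with all curves, by the recursion of [head_seq]. *)
Lemma dual_end_head i (d : nat) : (i < k)%N -> (hj (leg_weights n V i)).1 = d%:Z ->
  dual (V i (n i).-1) *+ d - ratv (head_vec i) = dual o.
Proof.
move=> ik; set a := (hj _).1 => ad; have n0 : (0 < n i)%N by case: SC => h _ _ _ _; exact: h.
have co : curve o := curve_o SC k1.
rewrite dual_end // /dual co.
have [y [y0 yl ->]] := curve_dual_int sym irr nd det1 (curve_parent ik).
pose x u := a * y u - head_vec i u.
have -> : ratv y *+ d - ratv (head_vec i) = ratv x.
  apply/ffunP => u; rewrite !ffunE ffunMnE ffunE /x ad rmorphB rmorphM /=.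
  by rewrite mulr_natl.
apply/esym/curve_dualE => // [u cu|u cu].
  rewrite /x y0 // mulr0 sub0r; apply/eqP; rewrite oppr_eq0; apply/eqP.
  move: u cu; apply: (coord_ind SC) => [|i' j ik' jn]; first by rewrite co.
  rewrite (curveV SC) // => h; rewrite /head_vec (star_vecV SC) //.
  by case: eqP h => //= ->; case: ifP.
have lapB : lap x u = a * lap y u - lap (head_vec i) u.
  rewrite !lap_sum // mulr_sumr -sumrB; apply: eq_bigr => w _; rewrite /x; ring.
rewrite lapB yl // {lapB x}.
have sz : size (leg_weights n V i) = (n i).-1 by rewrite size_leg_weights.
move: u cu; apply: (coord_ind SC) => [_|i' j ik' jn].
  (* At the centre the value -1 has two sources: A_0 = 1 from the first curve of the leg, or, if the
     leg has no curve, the end being attached to [o] itself with a = 1. *)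
  rewrite eqxx /head_vec (lap_o SC).
  have -> : \sum_(0 <= l < k) (if (l == i) && (1 < n i)%N then
      (head_seq (nth 0 (leg_weights n V i)) 0).2 else 0) = (1 < n i)%N%:Z.
    rewrite (bigD1_seq i) ?iota_uniq ?mem_index_iota //= eqxx big1 ?addr0 /=.
      by case: ifP.
    by move=> l /negPf ->.
  have [n1|n1] := ltnP 1 (n i).
    have -> : (n i).-1 = (n i).-2.+1 by lia.
    case: (SC) => _ _ Vo _ _; rewrite /= eq_sym (negPf (Vo _ _ _ _)) //; last lia.
    by rewrite mulr0; lia.
  have e1 : n i = 1%N by lia.
  rewrite e1 /= eqxx /a; move: sz; rewrite e1 /=; case: (leg_weights n V i) => //= _; lia.
rewrite (curveV SC) // => jn'.
case: (SC) => _ _ Vo inj _; rewrite (negPf (Vo _ _ ik' jn)) oppr0.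
rewrite /head_vec (lapV SC) // jn'.
have parE : (V i' j == parent o V i (n i).-1) = (i' == i) && (j.+2 == n i).
  case En : (n i).-1 => [|m] /=.
    rewrite (negPf (Vo _ _ ik' jn)); apply/esym/negbTE/negP => /andP[_ /eqP h]; lia.
  have mn : (m < n i)%N by lia.
  apply/eqP/andP => [/(inj _ _ _ _ ik' jn ik mn)[-> ->]|[/eqP -> /eqP h]].
    by split=> //; apply/eqP; lia.
  by congr V; lia.
rewrite parE; have [e|_] := eqVneq i' i; last first.
  by case: j {jn jn' parE} => [|j] /=; lia.
move: jn jn'; rewrite e /= => jn jn'; rewrite jn'.
have wE : weight (V i j) = - nth 0 (leg_weights n V i) j by rewrite nth_leg_weights ?opprK.
have S : (head_seq (nth 0 (leg_weights n V i)) j.+1).2 =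
    nth 0 (leg_weights n V i) j * (head_seq (nth 0 (leg_weights n V i)) j).2
    - (head_seq (nth 0 (leg_weights n V i)) j).1 by [].
have P : (if j is j'.+1 then if (j'.+1 < n i)%N then
     (head_seq (nth 0 (leg_weights n V i)) j').2 else 0 else 0) =
     (head_seq (nth 0 (leg_weights n V i)) j).1.
  by case: j jn jn' {parE wE S} => //= j jn jn'; rewrite jn.
(* At the last curve of the leg the missing next value A_(j+1) equals [a], which compensates the
   intersection number -1 of the dual of the end. *)
rewrite P wE mulNr; have [h|h] := eqVneq j.+2 (n i).
  have aE : a = (head_seq (nth 0 (leg_weights n V i)) j.+1).2.
    by rewrite /a -head_seq_end sz; congr (head_seq _ _).2; lia.
  by rewrite -h ltnn aE S /=; lia.
by rewrite (_ : (j.+2 < n i)%N = true) ?S /=; lia.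
Qed.

End StarDual.

Lemma expi_2pi_int (R : realType) (m : int) :
  expi (- (2 * pi * ratr (m%:~R : rat))) = 1 :> R[i].
Proof.
have nat_case (l : nat) : cos (2 * pi * l%:R) = 1 :> R /\ sin (2 * pi * l%:R) = 0 :> R.
  have -> : 2 * pi * l%:R = 0 + pi *+ 2 *+ l :> R by rewrite add0r -[RHS]mulr_natr -[pi *+ 2]mulr_natl.
  by rewrite (periodicn (@cosD2pi R)) (periodicn (@sinD2pi R)) cos0 sin0.
rewrite /expi ratr_int cosN sinN; case: m => l.
  by have [-> ->] := nat_case l; rewrite oppr0.
rewrite NegzE mulrNz mulrN cosN sinN opprK.
by have [-> ->] := nat_case l.+1.
Qed.

Section FourLegs.
Variables (R : realType) (G : wgraph) (o : G) (ws : seq (end_vertex G)) (ds : seq nat).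
Hypotheses (ds2 : (2 < size ds)%N) (SG : star_graph o ws ds)
  (det1 : graph_det (curves G) = 1).

Let k := size ds.
Let k1 : (1 < k)%N. Proof. exact: ltnW. Qed.

Lemma size_ws : size ws = k.
Proof. by case: SG => _ _ _ _ /(congr1 size); rewrite !size_map. Qed.

Lemma uniq_ws : uniq ws.
Proof. by case: SG => _ _ _ [u _] _; exact: map_uniq u. Qed.

Lemma mem_ws (w : end_vertex G) : w \in ws.
Proof.
have [n [V [SC endE _]]] := star_graph_coords k1 SG.
have [i ik wV] := end_coords SC k1 (eqP (valP w)).
rewrite -endE // in wV; rewrite -(mem_map val_inj) wV mem_nth // size_map size_ws //.
Qed.

Lemma node_star v : node v = (v == o).
Proof. by have [n [V [SC _ _]]] := star_graph_coords k1 SG; exact: (node_coords SC). Qed.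

Lemma degree_star : degree o = k.
Proof. by have [n [V [SC _ _]]] := star_graph_coords k1 SG; exact: (degree_o SC). Qed.

Lemma dual_end_int (w : end_vertex G) : exists y : G -> int, dual (val w : G) = ratv y.
Proof.
have [n [V [SC _ _]]] := star_graph_coords k1 SG.
have [[[sym irr _ _] _ nd] _ _ _ _] := SG.
have [i ik wV] := end_coords SC k1 (eqP (valP w)).
rewrite wV (dual_end SC) //.
by have [y [_ _ ->]] := curve_dual_int sym irr nd det1 (curve_parent SC k1 ik); exists y.
Qed.

Lemma char_star u (m : mindex (end_vertex G)) : curve u -> char_of R u m = 1.
Proof.
move=> cu; have [[[sym irr _ _] _ nd] _ _ _ _] := SG.
rewrite /char_of big1 // => w _; rewrite (form_dual sym irr nd det1) //.
have [y ->] := dual_end_int w; rewrite ffunE -rmorphN expi_2pi_int expr1n //.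
Qed.

Lemma curve_star : curve o. Proof. by rewrite /curve degree_star. Qed.

Lemma dual_star_gt0 : 0 < dual o o.
Proof.
have [[[sym irr _ _] _ nd] _ _ _ _] := SG.
have co := curve_star.
rewrite -oppr_lt0 -(form_dual sym irr nd det1 _ co); apply: (nd); apply: contrapT => nex.
have := form_dual sym irr nd det1 (Evec o) co.
rewrite form_Evec // big1 => [|v cv].
  by rewrite ffunE eqxx => /eqP; rewrite eq_sym oppr_eq0 oner_eq0.
have [->|dv] := eqVneq (dual o v) 0; first by rewrite mul0r.
by case: nex; exists v.
Qed.

Lemma vdegree_star (m : mindex (end_vertex G)) :
  vdegree o m = \sum_(w : end_vertex G) dual (val w) o *+ m w.
Proof.
have [[[sym irr _ _] _ nd] _ _ _ _] := SG.
rewrite /vdegree -sumrN; apply: eq_bigr => w _.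
by rewrite (form_dual sym irr nd det1) ?curve_star // mulNrn opprK.
Qed.

Lemma vdegree_node : - form (dual o) (dual o) = dual o o.
Proof.
have [[[sym irr _ _] _ nd] _ _ _ _] := SG.
by rewrite (form_dual sym irr nd det1) ?curve_star // opprK.
Qed.

(** Both parts come from [dual_end_head]. As [head_vec] vanishes at the centre, evaluation there
    shows that z_w^d has the same v-degree as the node. *)
Lemma admissible_star (w : end_vertex G) i : (i < k)%N -> nth o [seq val w | w <- ws] i = val w ->
  admissible o (branch o (val w)) (mvar w (nth 1%N ds i)) /\
  dual (val w) o *+ nth 1%N ds i = dual o o.
Proof.
move=> ik wi; have [n [V [SC endE lwE]]] := star_graph_coords k1 SG.
have [[[sym irr _ _] _ nd] _ _ _ _] := SG; have [lw2 hE] := lwE i ik.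
have n0 : (0 < n i)%N by case: (SC) => h _ _ _ _; exact: h.
have wV : val w = V i (n i).-1 by rewrite -endE.
have dE := dual_end_head SC k1 nd det1 ik hE.
have headV i' j : (i' < k)%N -> (j < n i')%N -> head_vec o k n V i (V i' j) =
    if (i' == i) && (j.+1 < n i)%N then (head_seq (nth 0 (leg_weights n V i)) j).2 else 0.
  by move=> ik' jn; rewrite /head_vec (star_vecV SC).
split; last first.
  rewrite wV -[in RHS]dE !ffunE /head_vec star_vec_o subr0 ffunMnE //.
split=> [v|].
  rewrite ffunE; case: (v =P w) => [-> _|_]; last by rewrite eqxx.
  by rewrite mem_branch connect0.
(* The absolute value only turns integers into naturals: by [head_seq_bounds] the entries are
   non-negative. *)
exists (fun u => `|head_vec o k n V i u|%N).
rewrite (bigD1 w) //= ffunE eqxx big1 ?addr0; last first.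
  by move=> v /negPf vw; rewrite ffunE vw.
rewrite -[RHS]dE wV; congr (_ - _); apply/ffunP => u.
rewrite sum_ffunE ffunE.
have CE : branch o (V i (n i).-1) =i leg n V i by apply: (branchE SC) => //; lia.
rewrite (eq_bigr (fun v => if v == u then `|head_vec o k n V i u|%N%:R else 0)); last first.
  move=> v _; rewrite ffunMnE ffunE eq_sym; case: eqP => [->//|_]; exact: mul0rn.
rewrite big_mkcond (bigD1 u) //= eqxx big1 ?addr0; last first.
  by move=> v /negPf ->; rewrite if_same.
rewrite CE; move: u; apply: (coord_ind SC) => [|i' j ik' jn].
  by rewrite /head_vec star_vec_o; case: ifP.
rewrite (curveV SC) // headV //; have -> : (V i' j \in leg n V i) = (i' == i).
  apply/mem_leg/eqP => [[j' jn' e]|e]; last by exists j; rewrite -?e.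
  by case: (SC) => _ _ _ inj _; case: (inj _ _ _ _ ik' jn ik jn' e).
case: eqP jn => //= -> jn; case: ifP => // h.
have /andP[h1 h2] : 0 <= (head_seq (nth 0 (leg_weights n V i)) j).1 <
    (head_seq (nth 0 (leg_weights n V i)) j).2.
  by apply: head_seq_bounds => //; rewrite size_leg_weights; lia.
by rewrite h -[in RHS](gez0_abs (ltW (le_lt_trans h1 h2))).
Qed.

End FourLegs.

(** * The splice equations of a star with four legs *)

Section SpliceEquations.
Variables (R : realType) (G : wgraph) (o : G) (x1 x2 y z : end_vertex G)
  (a1 a2 b c : nat).
Hypotheses (SG : star_graph o [:: x1; x2; y; z] [:: a1; a2; b; c])
  (det1 : graph_det (curves G) = 1).

Let C (w : end_vertex G) : {set G} := branch o (val w).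
Let Cs := [:: C x1; C x2; C y; C z].

Let uC : uniq Cs. Proof. by case: SG => _ _ _ []. Qed.

Let idx : [/\ index (C x1) Cs = 0, index (C x2) Cs = 1, index (C y) Cs = 2
  & index (C z) Cs = 3]%N.
Proof.
by split; [have := @index_uniq _ (C x1) 0 Cs|have := @index_uniq _ (C x1) 1 Cs
  |have := @index_uniq _ (C x1) 2 Cs|have := @index_uniq _ (C x1) 3 Cs]; apply.
Qed.

Let brE D : D \in branches o = (D \in Cs).
Proof. by case: SG => _ _ _ [_ ->]. Qed.

(** Up to sign, the minors of the 2 x 4 matrix are 1, gam and gam - 1. The size [m] stays a variable
    because degree o - 2 is only provably equal to 2. *)
Lemma minors_neq0 (gam : R[i]) (m : nat) (D : 'I_m -> {set G}) : m = 2%N ->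
  gam != 0 -> gam != 1 -> injective D -> (forall j, D j \in branches o) ->
  \det (\matrix_(l < m, j < m) nth 0 (nth [::]
     [:: [:: 1; 0; 1; 1]; [:: 0; 1; 1; gam]] l) (index (D j) Cs)) != 0.
Proof.
move=> m2; move: D; rewrite m2 => D g0 g1 injD DC.
have [p pP] : exists p : 'I_2 -> nat, forall j, (p j < 4)%N /\ D j = nth (C x1) Cs (p j).
  exists (fun j => index (D j) Cs) => j; have := DC j; rewrite brE => h.
  by rewrite nth_index // index_mem.
have iE j : index (D j) Cs = p j by case: (pP j) => h ->; rewrite index_uniq.
have p01 : p ord0 != p (lift ord0 ord0).
  apply/eqP => e; case: (pP ord0) (pP (lift ord0 ord0)) => _ e0 [_ e1].
  by have : ord0 = lift ord0 ord0 :> 'I_2 by apply: injD; rewrite e0 e1 e.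
rewrite (expand_det_row _ ord0) big_ord_recl big_ord1 /cofactor !det_mx11 !mxE !iE .
rewrite (_ : lift (lift ord0 ord0) 0 = ord0); last exact: val_inj.
rewrite (_ : lift ord0 0 = lift ord0 ord0); last exact: val_inj.
have := p01; case: (pP ord0) => [p0 _]; case: (pP (lift ord0 ord0)) => [p1 _].
have g1' : 1 - gam != 0 by rewrite subr_eq0 eq_sym.
move: (p ord0) (p (lift ord0 ord0)) p0 p1 => [|[|[|[|//]]]] [|[|[|[|//]]]] //= _ _ _;
  rewrite ?addn0 ?addn1 ?expr0 ?expr1 ?mul0r ?mul1r ?mulr0 ?mul0r ?mulr1 ?add0r ?addr0 ?mulN1r
    ?mulrN ?oppr_eq0 ?oner_neq0 // ?opprK ?subr_eq0 // eq_sym //.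
Qed.

(** The admissible monomials are the pure powers. If w is the v-degree of the node, x1 and x2 have
    v-degrees w / a1 and w / a2, so x1^(a1-1) x2^i has v-degree w - w / a1 + i w / a2, which exceeds
    w exactly when i a1 > a2. *)
Lemma splice_system_eqns (i : nat) (gam eps : R[i]) :
  (0 < a1)%N -> (0 < a2)%N -> gam != 0 -> gam != 1 -> (eps != 0 -> (a2 < i * a1)%N) ->
  splice_system [:: eqn1 R x1 y z a1 b c; eqn2 x1 x2 y z a1 a2 b c i gam eps].
Proof.
move=> a1_gt0 a2_gt0 g0 g1 hi; case: (idx) => ix1 ix2 iy iz.
have ds2 : (2 < size [:: a1; a2; b; c])%N by [].
pose Ms := [:: mvar x1 a1; mvar x2 a2; mvar y b; mvar z c].
pose M (v : G) (D : {set G}) : mindex (end_vertex G) := nth (mvar z c) Ms (index D Cs).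
pose A (v : G) (l : nat) (D : {set G}) : R[i] := nth 0 (nth [::]
     [:: [:: 1; 0; 1; 1]; [:: 0; 1; 1; gam]] l) (index D Cs).
pose m0 := madd (mvar x1 (a1 - 1)) (mvar x2 i).
pose F (v : G) (l : nat) : fps R[i] (end_vertex G) :=
  if l == 0%N then 0 else eps *: fps_mono R[i] m0.
have [[[sym irr _ _] _ nd] _ _ _ _] := SG.
have nodeE (v : G) : node v = (v == o) by exact: (node_star ds2 SG).
have degE : degree o = 4 by exact: (degree_star ds2 SG).
split; first by case: SG.
exists M, A, F; split.
- move=> v D; rewrite nodeE => /eqP -> {v}; rewrite brE !inE /M.
  case/or4P => /eqP ->; rewrite ?ix1 ?ix2 ?iy ?iz /=.
  + by case: (admissible_star ds2 SG det1 (w := x1) (i := 0)).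
  + by case: (admissible_star ds2 SG det1 (w := x2) (i := 1)).
  + by case: (admissible_star ds2 SG det1 (w := y) (i := 2)).
  + by case: (admissible_star ds2 SG det1 (w := z) (i := 3)).
- move=> v; rewrite nodeE => /eqP -> {v} D; rewrite /A; apply: minors_neq0 => //.
  by rewrite degE.
- move=> v l; rewrite nodeE => /eqP -> {v} _; split.
  + rewrite /F; case: ifP => _; first exact: convergent0.
    by apply: convergentZ; exact: convergent_mono.
  + move=> m; rewrite /F; case: ifP => _; first by rewrite fps0E eqxx.
    rewrite fpsZE /fps_mono; case: (m =P m0) => [-> |_]; last by rewrite mulr0 eqxx.
    rewrite mulr1 => /hi {}hi; rewrite (vdegree_node ds2 SG) // (vdegree_star ds2 SG) //.
    have [_ h1] := admissible_star ds2 SG det1 (w := x1) (i := 0) isT erefl.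
    have [_ h2] := admissible_star ds2 SG det1 (w := x2) (i := 1) isT erefl.
    have h0 := dual_star_gt0 ds2 SG det1; rewrite /= in h1 h2.
    have -> : \sum_(w : end_vertex G) dual (val w) o *+ m0 w =
        dual (val x1) o *+ (a1 - 1) + dual (val x2) o *+ i.
      under eq_bigr => w _ do rewrite /m0 !ffunE mulrnDr.
      rewrite big_split /=; congr (_ + _).
        rewrite (bigD1 x1) //= eqxx big1 ?addr0 // => w /negPf ->; exact: mulr0n.
      rewrite (bigD1 x2) //= eqxx big1 ?addr0 // => w /negPf ->; exact: mulr0n.
    move: (dual (val x1) o) (dual (val x2) o) (dual o o) h0 h1 h2 => u v w w0 uw vw.
    have A0 : 0 < a1%:R :> rat by rewrite ltr0n.
    have B0 : 0 < a2%:R :> rat by rewrite ltr0n.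
    rewrite -mulr_natr in uw; rewrite -mulr_natr in vw.
    rewrite -[u *+ _]mulr_natr -[v *+ _]mulr_natr natrB //.
    have {}hi : 0 < i%:R * a1%:R - a2%:R :> rat by rewrite subr_gt0 -natrM ltr_nat.
    have E : (v * i%:R - u) * (a1%:R * a2%:R) = w * (i%:R * a1%:R - a2%:R).
      transitivity (v * a2%:R * (i%:R * a1%:R) - u * a1%:R * a2%:R); first by ring.
      by rewrite uw vw; ring.
    have : 0 < v * i%:R - u.
      by rewrite -(pmulr_lgt0 _ (mulr_gt0 A0 B0)) E mulr_gt0.
    by rewrite -uw mulrBr mulr1; lra.
  + move=> D _ u cu; apply/funext => m; rewrite /H_act fpsZE.
    by rewrite !(char_star R ds2 SG det1).
have -> : enum (@node G) = [:: o].
  by rewrite -(enum1 o); apply: eq_enum => v; exact: nodeE.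
rewrite /= degE /=.
have S l : \sum_(D in branches o) A o l D *: fps_mono R[i] (M o D) =
    \sum_(D <- Cs) A o l D *: fps_mono R[i] (M o D).
  by rewrite big_uniq //; apply: eq_bigl => D; rewrite brE.
rewrite !S /Cs !big_cons !big_nil /A /M ix1 ix2 iy iz /= !scale1r !scale0r !addr0 !add0r.
by rewrite eqn1_mvar eqn2_mvar perm_refl.
Qed.

(** All characters are trivial, so every convergent series is invariant and the ring of the splice
    quotient is the full ring of convergent series. *)
Lemma splice_hilbert_samuel_eqns (i : nat) (gam eps : R[i]) (Nx : seq (nat * nat)) :
  (forall k, quotient_dim (@eqn_level R _ x1 x2 y z a1 a2 b c i gam eps k)
                          (@eqn_level R _ x1 x2 y z a1 a2 b c i gam eps k.+1)
    (\sum_(n <- Nx | n.1 + n.2 <= k) (k - (n.1 + n.2)).+1)%N) ->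
  splice_hilbert_samuel [:: eqn1 R x1 y z a1 b c; eqn2 x1 x2 y z a1 a2 b c i gam eps]
    (geo2 * mono_series Nx).
Proof.
move=> H; have ds2 : (2 < size [:: a1; a2; b; c])%N by [].
set s := [:: _; _].
have ringE : splice_ring s = @conv_ring R (end_vertex G).
  apply/seteqP; split=> f /=; first by case.
  move=> cf; split=> // u cu.
  have -> : H_act u f - f = 0.
    by apply/funext => m; rewrite fpsDE fpsNE /H_act (char_star R ds2 SG det1) // mul1r subrr.
  exact: (@eqn_ideal0 R (end_vertex G) x1 x2 y z a1 a2 b c i gam eps).
rewrite /splice_hilbert_samuel ringE => k.
exists (\sum_(n <- Nx | n.1 + n.2 <= k) (k - (n.1 + n.2)).+1)%N; split; last exact: H.
exact: coef_mono_series.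
Qed.

Hypotheses (a1_gt0 : (0 < a1)%N) (a2_gt0 : (0 < a2)%N).

Let ds2 : (2 < size [:: a1; a2; b; c])%N. Proof. by []. Qed.

Lemma splice_A (gam : R[i]) : gam != 0 -> gam != 1 ->
  let s : seq (fps R[i] (end_vertex G)) :=
    [:: 'z_x1 ^+ a1 + 'z_y ^+ b + 'z_z ^+ c;
        'z_x2 ^+ a2 + 'z_y ^+ b + gam *: 'z_z ^+ c] in
  splice_system s /\
  ((maxn a1 a2 <= minn b c)%N ->
   splice_hilbert_samuel s (geo2 * mono_series (std_box a1 a2))).
Proof.
move=> g0 g1 s.
have -> : s = [:: eqn1 R x1 y z a1 b c; eqn2 x1 x2 y z a1 a2 b c 0 gam 0].
  by rewrite /s /eqn1 /eqn2 scale0r addr0.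
split=> [|hab]; first by apply: splice_system_eqns => //; rewrite eqxx.
apply: splice_hilbert_samuel_eqns => k.
exact: (level_dim_box (uniq_ws SG) (mem_ws ds2 SG)).
Qed.

Lemma splice_B (gam : R[i]) (i : nat) : gam != 0 -> gam != 1 ->
  (2 <= a1)%N -> (a1 < a2)%N -> (a2 < b)%N -> (b < c)%N ->
  (a2 < i * a1)%N -> (a1 - 1 + i < a2)%N -> (2 * a2 - i < b + a1 - 1)%N ->
  let s : seq (fps R[i] (end_vertex G)) :=
    [:: 'z_x1 ^+ a1 + 'z_y ^+ b + 'z_z ^+ c;
        'z_x2 ^+ a2 + 'z_y ^+ b + gam *: 'z_z ^+ c + 'z_x1 ^+ (a1 - 1) * 'z_x2 ^+ i] in
  splice_system s /\ splice_hilbert_samuel s (geo2 * mono_series (std_hook a1 a2 i)).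
Proof.
move=> g0 g1 h1 h2 h3 h4 h5 h6 h7 s.
have -> : s = [:: eqn1 R x1 y z a1 b c; eqn2 x1 x2 y z a1 a2 b c i gam 1].
  by rewrite /s /eqn1 /eqn2 scale1r.
split; first exact: splice_system_eqns.
apply: splice_hilbert_samuel_eqns => k.
apply: (level_dim_hook (uniq_ws SG) (mem_ws ds2 SG)) => //.
by case: (i) h5 => [|//]; rewrite mul0n.
Qed.

End SpliceEquations.

(** The functions of (A) and (B) for a1 = 2, a2 = 5, i = 3 first differ in degree 4, where x1 x2^3
    is standard in the box but not in the hook. *)
Lemma mono_series_box_hook_neq :
  geo2 * mono_series (std_box 2 5) <> geo2 * mono_series (std_hook 2 5 3).
Proof.
move=> /(congr1 (fun h : Zt => h (mconst unit 4))); rewrite !coef_mono_series.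
by rewrite unlock.
Qed.

Theorem mainTheorem4 (R : realType) :
  (* the Hilbert-Samuel function is not determined by the graph *)
  (exists (G : wgraph) (s1 s2 : seq (fps R[i] (end_vertex G))) (h1 h2 : Zt),
     [/\ splice_system s1, splice_system s2,
         splice_hilbert_samuel s1 h1, splice_hilbert_samuel s2 h2
       & h1 <> h2])
  /\
  forall (a1 a2 b c : nat) (gamma : R[i]),
    all (fun n => 0 < n)%N [:: a1; a2; b; c] ->
    pairwise coprime [:: a1; a2; b; c] ->
    gamma != 0 -> gamma != 1 ->
    let is_the_graph (G : wgraph) (o : G) (ws : seq (end_vertex G)) :=
      star_graph o ws [:: a1; a2; b; c] /\ graph_det (curves G) = 1 in
    (* existence and uniqueness of the graph *)
    [/\ exists G o ws, is_the_graph G o ws,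
        forall G o ws G' o' ws', is_the_graph G o ws ->
          is_the_graph G' o' ws' -> wgraph_iso G G'
      & forall (G : wgraph) (o : G) (x1 x2 y z : end_vertex G),
        is_the_graph G o [:: x1; x2; y; z] ->
        (* (A); the formula needs the orders of the two equations to be a1 and
           a2, whence maxn a1 a2 <= minn b c *)
        (let s : seq (fps R[i] (end_vertex G)) :=
           [:: 'z_x1 ^+ a1 + 'z_y ^+ b + 'z_z ^+ c;
               'z_x2 ^+ a2 + 'z_y ^+ b + gamma *: 'z_z ^+ c] in
         splice_system s /\
         ((maxn a1 a2 <= minn b c)%N ->
          splice_hilbert_samuel s
            ((1 - 't ^+ a1) * (1 - 't ^+ a2) / (1 - 't) ^+ 4)))
        /\
        (* (B) *)
        (forall i : int,
           (2 <= a1)%N -> (a1 < a2)%N -> (a2 < b)%N -> (b < c)%N ->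
           a2%:Z < i * a1%:Z -> a1%:Z - 1 + i < a2%:Z ->
           2 * a2%:Z - i < b%:Z + a1%:Z - 1 ->
           (* the hypotheses give 0 < i < a2, so n = i *)
           let n := `|i|%N in
           let s : seq (fps R[i] (end_vertex G)) :=
             [:: 'z_x1 ^+ a1 + 'z_y ^+ b + 'z_z ^+ c;
                 'z_x2 ^+ a2 + 'z_y ^+ b + gamma *: 'z_z ^+ c
                   + 'z_x1 ^+ (a1 - 1) * 'z_x2 ^+ n] in
           splice_system s /\
           splice_hilbert_samuel s
             (1 / (1 - 't) ^+ 2
                * (('t - 't ^+ (a1 - 1)) / (1 - 't)
                     * ((1 - 't ^+ a2) / (1 - 't))
                   + (1 - 't ^+ (2 * a2 - n)) / (1 - 't)
                   + 't ^+ (a1 - 1) * ((1 - 't ^+ n) / (1 - 't)))))].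
Proof.
have thA := @splice_A R; have thB := @splice_B R.
split.
  have two (m : nat) : (m != 2)%N -> (2 : R[i]) != m%:R.
    by move=> m2; rewrite eqr_nat eq_sym.
  have [G [o [ws [SG det1]]]] : exists (G : wgraph) (o : G) (ws : seq (end_vertex G)),
      star_graph o ws [:: 2; 5; 7; 9]%N /\ graph_det (curves G) = 1.
    exact: star_graph_exists.
  have := size_ws SG; case: ws SG => [|x1 [|x2 [|y [|z [|? ?]]]]] // SG _.
  have g0 : (2 : R[i]) != 0 by exact: (two 0%N isT).
  have g1 : (2 : R[i]) != 1 by exact: (two 1%N isT).
  have [sysA hsA] := thA G o x1 x2 y z _ _ _ _ SG det1 isT isT 2 g0 g1.
  have [sysB hsB] := thB G o x1 x2 y z _ _ _ _ SG det1 isT isT 2 3 g0 g1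
     isT isT isT isT isT isT isT.
  exists G; do 4!eexists; split; [exact: sysA|exact: sysB|exact: (hsA isT)|exact: hsB|].
  exact: mono_series_box_hook_neq.
move=> a1 a2 b c gam ds_gt0 ds_cop g0 g1 is_the_graph; split.
- exact: star_graph_exists.
- move=> G o ws G' o' ws' [SG det1] [SG' det1'].
  exact: (star_graph_unique _ ds_gt0 ds_cop SG det1 SG' det1').
move=> G o x1 x2 y z [SG det1].
have /and5P[a1_gt0 a2_gt0 _ _ _] := ds_gt0.
split.
  rewrite mono_series_box; exact: (thA G o x1 x2 y z _ _ _ _ SG det1).
move=> i h1 h2 h3 h4 h5 h6 h7 n.
rewrite (mono_series_hook _ _ h1).
(* A negative i would contradict i a1 > a2. *)
have [l il] : exists l : nat, i = l%:Z.
  case: i h5 {h6 h7 n} => l h5; first by exists l.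
  by move: h5; rewrite NegzE; nia.
rewrite {}/n {}il in h5 h6 h7 *.
apply: (thB G o x1 x2 y z _ _ _ _ SG det1) => //=; lia.
Qed.
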